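(* For each integer $n\ge3$, with $\beta_n=\frac{1-2/n!}{4n-4}$, for all $X\ge1$ and every $\varepsilon>0$, \[|Z_n(\mathbb{Q},A_n;X)|\gg_{n,\varepsilon}X^{\beta_n-\varepsilon},\] where $Z_n(\mathbb{Q},A_n;X)$ is the set of degree $n$ fields $K\subset\overline{\mathbb{Q}}$ with $\mathrm{Gal}(\tilde K/\mathbb{Q})\simeq A_n$ and $|\mathrm{Disc}(K/\mathbb{Q})|\le X$.
   Context: $\tilde K$ is the Galois closure of $K$ over $\mathbb{Q}$; $\mathrm{Gal}(\tilde K/\mathbb{Q})\simeq A_n$ means permutation-isomorphic to $A_n\subseteq S_n$ as a group acting on the $n$ embeddings of $K$.
   Formalization: The lower bound is proved for all X ≥ X_0(n), with X_0 independent of ε, instead of for all X ≥ 1: at X = 1 the set Z_n(Q,A_n;X) is empty, so the bound as written fails there. *)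

(* Defs.v *)
From HB Require Import structures.
From mathcomp Require Import all_boot all_order all_algebra.
From mathcomp Require Import all_fingroup all_solvable all_field.
From mathcomp Require Import all_classical all_reals all_analysis.

Set Implicit Arguments.
Unset Strict Implicit.
Unset Printing Implicit Defensive.

Import Order.TTheory GRing.Theory Num.Theory.

Local Open Scope classical_set_scope.
Local Open Scope ring_scope.

(* Tr_(L/Q)(x): the trace of the Q-linear map y |-> y * x of L. *)
Definition field_trace (L : fieldExtType rat) (x : L) : rat :=
  \tr (passmx.mxof (vbasis {:L}) (vbasis {:L}) (amulr x)).

Definition algebraic_integer (L : fieldExtType rat) (x : L) : Prop :=
  integralOver (intr : int -> L) x.

Definition integral_basis (L : fieldExtType rat)
    (b : (\dim {:L}).-tuple L) : Prop :=
  basis_of {:L} b /\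
  forall x : L, algebraic_integer x <->
    exists z : 'I_(\dim {:L}) -> int, x = \sum_i tnth b i *~ z i.

(* A relation rather than a function, since the integral basis is not
   canonical; the value d does not depend on b. *)
Definition has_discriminant (L : fieldExtType rat) (d : rat) : Prop :=
  exists2 b : (\dim {:L}).-tuple L, integral_basis b &
    d = \det (\matrix_(i, j) field_trace (tnth b i * tnth b j)).

(* N is the smallest Galois extension of Q containing the image of L. *)
Definition is_galois_closure (L : fieldExtType rat)
    (N : splittingFieldType rat) : Prop :=
  exists s : 'AHom(L, N),
    galois 1 {:N} /\
    forall F : {subfield N},
      (limg s <= F)%VS -> galois 1 F -> F = {:N}%AS.

(* For a Galois closure N of L, Gal(N/Q) acts by postcomposition on the
   embeddings of L; all of them take their values in N, so they are the elements
   of 'AHom(L, N).  This action is permutation isomorphic to the action of G on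
   'I_n; the bijection e forces L to have exactly n embeddings. *)
Definition galois_group_permisom (n : nat) (G : {group {perm 'I_n}})
    (L : fieldExtType rat) : Prop :=
  exists N : splittingFieldType rat, is_galois_closure L N /\
  exists e : 'I_n -> 'AHom(L, N), bijective e /\
  exists f : {morphism 'Gal({:N} / 1)%g >-> {perm 'I_n}},
    isom 'Gal({:N} / 1)%g G f /\
    forall g, g \in 'Gal({:N} / 1)%g ->
      forall i x, e (f g i) x = g (e i x).

(* Z_n(Q, G; X).  The type algC is an algebraic closure of Q, and the elements
   of this set are subfields of algC, not isomorphism classes of fields. *)
Definition Zfields (R : realType) (n : nat) (G : {group {perm 'I_n}}) (X : R) :
    set (set algC) :=
  [set K | exists (L : fieldExtType rat) (iota : {rmorphism L -> algC}),
    [/\ K = range iota,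
        \dim {:L} = n,
        galois_group_permisom G L &
        exists2 d : rat, has_discriminant L d & ratr `|d| <= X]].

Definition beta (R : realType) (n : nat) : R :=
  (1 - 2 / (n`!)%:R) / (4 * n%:R - 4).

(* Main.v *)
(** Idea.  Take a pencil [f_s = P + c s^2 Q] of monic integral polynomials of degree [n]
    such that the rational function [P/Q] has the three finite critical points [0]
    (ramification [2e+1], with [n - (2e+1)] equal to [1] or [2]), [b] (ramification [3])
    and [a] (ramification [2]), where [P(a) = 0].  Then [P'Q - PQ'] is a constant times
    [(X^e (X - b))^2 (X - a)], so that [disc f_s] is, up to squares, a constant times
    [f_s(a) = c s^2 Q(a)]; for the right sign [c] it is a square and the Galois group
    [G_s] of [f_s] lies in [A_n].  Let [s] run through an arithmetic progression for which
    a prime [p1] exactly divides the value of [f_s] at [0] and a prime [p2] exactly divides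
    its value at [b].  A decomposition group above [p1] permutes transitively the [2e+1]
    roots congruent to [0], and an inertia group above [p2] is nontrivial and moves only
    three roots, so [G_s] contains a 3-cycle.  For large [s] the group [G_s] is transitive,
    because the norm of [Q(theta)] is a fixed integer; these facts force [G_s = A_n].

    The discriminant of [f_s] is [O(s^(4n-4))], which gives [X^(1/(4n-4))] values of [s].
    Few of them share a field [K]: the elements [Q(theta_s)] of [K] have the same norm, and
    if the conjugates of two of them have the same dyadic sizes, then their quotient, times
    a fixed integer, is an algebraic integer all of whose conjugates are bounded.  Hence each
    field occurs at most [O((log s)^n)] times, which is absorbed in [X^(-2/(n! (4n-4)))]. *)

From HB Require Import structures.
Require Import Defs.
From mathcomp Require Import all_boot all_order all_algebra.
From mathcomp Require Import all_fingroup all_solvable all_field.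
From mathcomp Require Import ring lra zify.

Set Implicit Arguments.
Unset Strict Implicit.
Unset Printing Implicit Defensive.

Import Order.TTheory GRing.Theory Num.Theory.

(** * Recognizing the alternating group *)

Section ThreeCycles.
Local Open Scope group_scope.
Variables (T : finType).
Implicit Types (i j k l : T) (s : {perm T}).

(** The ramification index at [0] is odd so that its contribution [X^(2e)] to the Wronskian
    [P'Q - PQ'] is a square; a cluster of odd size leaves one point over when [n] is even and two
    when [n] is odd, which is why there are two families, with [deg Q = 2] and [deg Q = 1]. In both,
    [2e + 2 + 1 = n + deg Q - 1] is the degree of the Wronskian, so there are no further finite
    critical points.

    The norm of [Q(theta)] is constant because [f_s] is congruent to [P] modulo [Q]: up to sign it
    is the resultant of [P] and [Q]. This one fact serves three times: it makes the discriminant a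
    square, it proves transitivity (a stable set of roots has a [Q]-norm dividing the constant, so
    it contains a root at which [Q] is bounded), and it makes quotients of two values [Q(theta)]
    almost integral.

    The local arguments use a maximal ideal [m] of the ring of integers of the splitting field.
    Divisibility by [p] at [m] is expressed by an equation [x * u = p * y] between algebraic
    integers with [u] outside [m]; that [p] is a uniformizer of a subfield means that all elements
    of [m] in this subfield satisfy such an equation. *)

Definition cycle3 i j k : {perm T} := tperm i j * tperm i k.

Lemma cycle3J i j k s : cycle3 i j k ^ s = cycle3 (s i) (s j) (s k).
Proof. by rewrite /cycle3 conjMg !tpermJ. Qed.

Lemma cycle3E1 i j k : i != j -> j != k -> cycle3 i j k i = j.
Proof. by move=> ij jk; rewrite permM tpermL tpermD // eq_sym. Qed.

Lemma cycle3E2 i j k : cycle3 i j k j = k.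
Proof. by rewrite permM tpermR tpermL. Qed.

Lemma cycle3E3 i j k : i != k -> j != k -> cycle3 i j k k = i.
Proof. by move=> ik jk; rewrite permM [X in tperm i k X]tpermD // tpermR. Qed.

Lemma cycle3D i j k l : l != i -> l != j -> l != k -> cycle3 i j k l = l.
Proof. by move=> li lj lk; rewrite permM [X in tperm i k X]tpermD 1?eq_sym // tpermD // eq_sym. Qed.

Lemma cycle3_rot i j k : i != j -> j != k -> i != k -> cycle3 i j k = cycle3 j k i.
Proof.
move=> ij jk ik; apply/permP => l.
have [->|li] := eqVneq l i; first by rewrite cycle3E1 // cycle3E3 1?eq_sym.
have [->|lj] := eqVneq l j; first by rewrite cycle3E2 // cycle3E1 // eq_sym.
have [->|lk] := eqVneq l k; first by rewrite cycle3E3 // cycle3E2.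
by rewrite !cycle3D.
Qed.

Lemma cycle3V i j k : i != j -> j != k -> i != k -> (cycle3 i j k)^-1 = cycle3 i k j.
Proof. by move=> ij jk ik; rewrite /cycle3 invMg !tpermV. Qed.

Variable H : {group {perm T}}.

Lemma cycle3J_mem i j k s :
  cycle3 i j k \in H -> s \in H -> cycle3 (s i) (s j) (s k) \in H.
Proof. by move=> Hc Hs; rewrite -cycle3J groupJ. Qed.

Lemma cycle3_memV i j k : i != j -> j != k -> i != k ->
  (cycle3 i k j \in H) = (cycle3 i j k \in H).
Proof. by move=> ij jk ik; rewrite -cycle3V // groupV. Qed.

Lemma cycle3_mem_rot i j k : i != j -> j != k -> i != k ->
  (cycle3 j k i \in H) = (cycle3 i j k \in H).
Proof. by move=> ij jk ik; rewrite -cycle3_rot. Qed.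

(* Membership in a common 3-cycle of [H]; it is an
   [H]-invariant equivalence relation. *)
Definition linked i j := (i == j) || [exists k, [&& i != j, i != k, j != k & cycle3 i j k \in H]].

Lemma linkedP i j : i != j -> linked i j -> exists k, [/\ i != k, j != k & cycle3 i j k \in H].
Proof.
move=> ij; rewrite /linked (negPf ij) /= => /existsP[k /and3P[ik jk Hc]].
by exists k.
Qed.

Lemma linkedI i j k : i != j -> i != k -> j != k -> cycle3 i j k \in H -> linked i j.
Proof.
by move=> ij ik jk Hc; apply/orP; right; apply/existsP; exists k; rewrite ij ik jk.
Qed.

Lemma linked_refl i : linked i i. Proof. by rewrite /linked eqxx. Qed.

Lemma linked_sym i j : linked i j -> linked j i.
Proof.
have [->//|ij] := eqVneq i j; case/(linkedP ij) => k [ik jk Hc].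
apply: (@linkedI j i k); rewrite // 1?eq_sym //.
by rewrite -cycle3_mem_rot // 1?eq_sym // cycle3_memV // 1?eq_sym.
Qed.

(** Conjugating [cycle3 i j k] by [cycle3 j l m], which fixes [i] and sends [j] to [l], gives a
    3-cycle through [i] and [l]. If [m = i], the second 3-cycle already contains both points. *)
Lemma linked_trans j i l : linked i j -> linked j l -> linked i l.
Proof.
have [->//|ij] := eqVneq i j; have [->//|jl] := eqVneq j l.
have [->|il] := eqVneq i l; first by rewrite linked_refl.
case/(linkedP ij) => k [ik jk Hc] /(linkedP jl)[m [jm lm Hd]].
have [mi|mi] := eqVneq m i.
  apply: linked_sym; apply: (@linkedI l i j); rewrite // 1?eq_sym //.
  by rewrite mi in Hd; rewrite cycle3_mem_rot // 1?eq_sym.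
set s := cycle3 j l m in Hd.
have si : s i = i by rewrite /s cycle3D // eq_sym.
have sj : s j = l by rewrite /s cycle3E1 // eq_sym.
have := cycle3J_mem Hc Hd; rewrite si sj => Hs.
apply: (linkedI il) Hs.
- by rewrite -[X in X != _]si (inj_eq perm_inj).
- by rewrite -[X in X != _]sj (inj_eq perm_inj).
Qed.

Lemma linked_perm s i j : s \in H -> linked i j -> linked (s i) (s j).
Proof.
move=> Hs; have [->|ij] := eqVneq i j; first by rewrite !linked_refl.
case/(linkedP ij) => k [ik jk Hc].
by apply: (@linkedI _ _ (s k)); rewrite ?(inj_eq perm_inj) // cycle3J_mem.
Qed.

(** If [cycle3 i j k] and [cycle3 k l m] lie in [H], conjugating the former by the latter replaces
    [k] by [l], provided that [m] is neither [i] nor [j]. In these two cases [H] contains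
    [cycle3 k j l]; conjugating by it gives [cycle3 i l j], the inverse of the 3-cycle sought. *)
Lemma all_linked_cycle3 :
  (forall i j, linked i j) ->
  forall i j l, i != j -> i != l -> j != l -> cycle3 i j l \in H.
Proof.
move=> allL i j l ij il jl.
have [k [ik jk Hx]] := linkedP ij (allL i j).
have [<-//|kl] := eqVneq k l.
have ji : j != i by rewrite eq_sym.
have ki : k != i by rewrite eq_sym.
have kj : k != j by rewrite eq_sym.
have li : l != i by rewrite eq_sym.
have lj : l != j by rewrite eq_sym.
have lk : l != k by rewrite eq_sym.
have [m [km lm Hy]] := linkedP kl (allL k l).
have [mi|mi] := eqVneq m i.
  rewrite mi in Hy.
  have Hz : cycle3 k j l \in H.
    by have := cycle3J_mem Hx Hy; rewrite cycle3E3 // cycle3E1 // cycle3D.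
  have := cycle3J_mem Hx Hz; rewrite cycle3E2 cycle3D // cycle3E1 //.
  by rewrite cycle3_memV.
have [mj|mj] := eqVneq m j.
  rewrite mj in Hy.
  have Hz : cycle3 k j l \in H by rewrite cycle3_memV.
  have := cycle3J_mem Hx Hz; rewrite cycle3E2 cycle3D // cycle3E1 //.
  by rewrite cycle3_memV.
have := cycle3J_mem Hx Hy.
by rewrite cycle3E1 // [_ i]cycle3D // 1?eq_sym // [_ j]cycle3D // 1?eq_sym.
Qed.

(** An even permutation is a product of pairs of transpositions, and inserting the square of
    [tperm b c] between [tperm a b] and [tperm c d] reduces to pairs of transpositions with a common
    point, whose product is [1] or a 3-cycle. *)
Lemma cycle3_Alt : (forall i j l, i != j -> i != l -> j != l -> cycle3 i j l \in H) ->
  'Alt_T \subset H.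
Proof.
move=> allH.
have two_adj a b c : a != b -> b != c -> tperm a b * tperm b c \in H.
  move=> ab bc; have [<-|ac] := eqVneq a c.
    by rewrite [tperm b a]tpermC tperm2 group1.
  by rewrite tpermC; apply: allH; rewrite // eq_sym.
have two a b c d : a != b -> c != d -> tperm a b * tperm c d \in H.
  move=> ab cd; have [bc|bc] := eqVneq b c; first by rewrite -bc two_adj // bc.
  have -> : tperm a b * tperm c d = (tperm a b * tperm b c) * (tperm b c * tperm c d).
    by rewrite mulgA -(mulgA (tperm a b)) tperm2 mulg1.
  by rewrite groupM // two_adj.
apply/subsetP => s; rewrite Alt_even; have [ts -> Dts] := prod_tpermP s.
rewrite odd_perm_prod //.
have [m] := ubnP (size ts); elim: m ts Dts => // m IH [|[a b] [|[c d] ts]] //=.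
  by rewrite big_nil group1.
move=> /andP[ab /andP[cd D]]; rewrite !ltnS !negbK => lt ev.
rewrite !big_cons mulgA groupM //; first exact: two.
by apply: IH => //; apply: ltnW.
Qed.

(** Parity excludes the only other possibility, a transposition of two points of [C]. *)
Lemma three_cycle_of_fixing s (C : {set T}) :
    s \in 'Alt_T -> s != 1 -> #|C| = 3 -> (forall i, i \notin C -> s i = i) ->
  exists i j k, [/\ i != j, i != k, j != k & s = cycle3 i j k].
Proof.
move=> As s1 C3 fixs.
have sC x : x \in C -> s x \in C.
  by move=> Cx; apply: contraLR Cx => nC; rewrite -(perm_inj (fixs _ nC)).
have [i si1] : exists i, s i != i.
  apply/existsP; apply: contraNT s1; rewrite negb_exists => /forallP h.
  by apply/eqP/permP => x; rewrite perm1; apply/eqP; have := h x; rewrite negbK.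
have Ci : i \in C by apply: contraNT si1 => /fixs->.
have Cj := sC i Ci; set j := s i in si1 Cj; have si : s i = j by [].
have ji := si1; have ij : i != j by rewrite eq_sym.
have /card_gt0P[k] : (0 < #|C :\ i :\ j|)%N.
  have := cardsD1 i C; rewrite Ci C3 add1n => -[E]; have := cardsD1 j (C :\ i).
  by rewrite !inE ji Cj -E add1n => -[<-].
rewrite !inE => /and3P[kj ki Ck].
have Cijk x : x \in C -> [|| x == i, x == j | x == k].
  move=> Cx; apply/negPn/negP; rewrite !negb_or => /and3P[xi xj xk].
  have : #|[set i; j; k; x]| = 4.
    rewrite -!setUA !cardsU1 cards1 !inE !negb_or ij 2![_ == x]eq_sym xi xj /= ![k == x]eq_sym xk.
    by rewrite eq_sym ki eq_sym kj.
  have sub4 : [set i; j; k; x] \subset C.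
    by apply/subsetP => y; rewrite !inE -!orbA => /or4P[] /eqP->.
  by have := subset_leq_card sub4; rewrite C3 => + E; rewrite E.
have sj : s j = k.
  have := Cijk _ (sC _ Cj); case/or3P => /eqP // E.
    suff : s = tperm i j.
      move=> Es; have := As.
      by rewrite Alt_even Es odd_tperm ij.
    apply/permP => x; case: tpermP => [->|->|xi xj] //.
    have [Cx|/fixs//] := boolP (x \in C).
    have := Cijk _ Cx; case/or3P => /eqP // ->.
    have := Cijk _ (sC _ Ck); case/or3P => /eqP // E2.
      by have := perm_inj (etrans E2 (esym E)) => /eqP; rewrite (negPf kj).
    by have := perm_inj (etrans E2 (esym si)) => /eqP; rewrite (negPf ki).
  by have := perm_inj (etrans E (esym si)) => /eqP; rewrite (negPf ji).
have sk : s k = i.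
  have := Cijk _ (sC _ Ck); case/or3P => /eqP // E.
    by have := perm_inj (etrans E (esym si)) => /eqP; rewrite (negPf ki).
  by have := perm_inj (etrans E (esym sj)) => /eqP; rewrite (negPf kj).
exists i, j, k; rewrite ij ![_ == k]eq_sym ki kj; split => //.
apply/permP => x; apply/esym; have [Cx|nC] := boolP (x \in C).
  have := Cijk _ Cx; case/or3P => /eqP -> .
  - by rewrite cycle3E1 // eq_sym.
  - by rewrite cycle3E2.
  - by rewrite cycle3E3 // eq_sym.
by rewrite fixs // cycle3D //; apply: contraNneq nC => ->.
Qed.

(** The classes of [linked] are permuted by the transitive group [H], hence have equal size, at
    least 3. A class therefore does not fit into the complement of [C1]: each point there is linked
    to a point of [C1], and moving this point with [D], which preserves the complement, links every
    point of [C1] to a point outside. So there are at most as many classes as points outside [C1].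
    If there were two, [#|T|] would be twice the size of a class, against the parity assumption. *)
Lemma eq_Alt_of_cluster (D : {group {perm T}}) (C1 C2 : {set T}) s0 :
    H \subset 'Alt_T -> D \subset H ->
    (forall i j, exists2 s, s \in H & s i = j) ->
    s0 \in H -> s0 != 1 -> #|C2| = 3 -> (forall i, i \notin C2 -> s0 i = i) ->
    (forall s, s \in D -> forall i, i \in C1 -> s i \in C1) ->
    {in C1 &, forall i j, exists2 s, s \in D & s i = j} ->
    (#|~: C1| = 1 \/ #|~: C1| = 2 /\ odd #|T|)%N ->
  H :=: 'Alt_T.
Proof.
move=> HA DH trH Hs0 s01 C23 fix2 st1 tr1 cC1.
apply/eqP; rewrite eqEsubset HA /=; apply: cycle3_Alt; apply: all_linked_cycle3.
have [a [b [c [ab ac bc Es0]]]] := three_cycle_of_fixing (subsetP HA _ Hs0) s01 C23 fix2.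
have Habc : cycle3 a b c \in H by rewrite -Es0.
pose cl i := [set j | linked i j].
have cl_card i j : #|cl i| = #|cl j|.
  have [s Hs <-] := trH i j; rewrite -(card_imset _ (@perm_inj _ s)).
  apply: eq_card => x; apply/imsetP/idP => [[y]|]; rewrite !inE.
    by move=> iy ->; apply: linked_perm.
  move=> L; exists (s^-1 x); last by rewrite permKV.
  rewrite inE -[i](permK s) linked_perm // groupV //.
have cl3 i : (3 <= #|cl i|)%N.
  rewrite (cl_card i a); have <- : #|[set a; b; c]| = 3.
    by rewrite -!setUA !cardsU1 cards1 !inE negb_or ab ac bc.
  apply: subset_leq_card; apply/subsetP => x; rewrite !inE -orbA => /or3P[]/eqP->.
  - exact: linked_refl.
  - exact: linkedI Habc.
  - apply: linked_sym; apply: (@linkedI c a b); rewrite // 1?eq_sym //.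
    by rewrite -cycle3_mem_rot // eq_sym.
have cC2 : (#|~: C1| <= 2)%N by case: cC1 => [->|[->]].
have meet x : x \notin C1 -> exists2 y, y \in C1 & linked x y.
  move=> xC; have : ~~ (cl x \subset ~: C1).
    apply/negP => /subset_leq_card h.
    by have := leq_trans (cl3 x) (leq_trans h cC2).
  case/subsetPn => y; rewrite !inE negbK => xy yC; by exists y.
have st1C s x : s \in D -> x \notin C1 -> s x \notin C1.
  move=> Ds; apply: contra => /(st1 s^-1)-/(_ (groupVr Ds)).
  by rewrite permK.
have reach y : exists2 x, x \notin C1 & linked x y.
  have [yC|yC] := boolP (y \in C1); last by exists y; rewrite ?linked_refl.
  have /card_gt0P[x] : (0 < #|~: C1|)%N by case: cC1 => [->|[->]].
  rewrite inE => xC; have [z zC xz] := meet x xC.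
  have [s Ds <-] := tr1 z y zC yC.
  by exists (s x); rewrite ?st1C // linked_perm // (subsetP DH).
suff [x allx] : exists x, forall y, linked x y; first move=> i j.
  exact: linked_trans (linked_sym (allx i)) (allx j).
case: cC1 => [/eqP/cards1P[x Cx] | [/eqP/cards2P[x [x' [xx' Cx]]] oddT]].
  exists x => y; have [z zC] := reach y.
  by have /set1P -> : z \in [set x] by rewrite -Cx inE.
exists x => y; have xory z : linked x z \/ linked x' z.
  have [w wC] := reach z; have : w \in [set x; x'] by rewrite -Cx inE.
  by case/set2P => ->; [left|right].
have [xx'L|nL] := boolP (linked x x').
  by case: (xory y) => // ?; apply: linked_trans xx'L _.
have : #|T| = (#|cl x| + #|cl x'|)%N.
  rewrite -cardsUI [_ :&: _](_ : _ = set0) ?cards0 ?addn0.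
    by rewrite -cardsT; apply: eq_card => z; rewrite !inE; apply/esym/orP/xory.
  apply/setP => z; rewrite !inE; apply/negP => /andP[xz x'z].
  by case/negP: nL; apply: linked_trans xz _; apply: linked_sym.
by rewrite (cl_card x' x) => E; rewrite E oddD addbb in oddT.
Qed.
End ThreeCycles.

From mathcomp Require Import boolp classical_sets.
Local Open Scope ring_scope.

(** * Maximal ideals of the ring of algebraic integers *)

Section Integers.
Variables (N : fieldExtType rat) (iota : {rmorphism N -> algC}).

Implicit Types x y : N.

Lemma algint_intr (z : int) : algebraic_integer (z%:~R : N). Proof. exact: integral_id. Qed.
Lemma algint0 : algebraic_integer (0 : N). Proof. exact: integral0. Qed.
Lemma algint1 : algebraic_integer (1 : N). Proof. exact: integral1. Qed.
Lemma algintD x y : algebraic_integer x -> algebraic_integer y -> algebraic_integer (x + y).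
Proof. exact: integral_add. Qed.
Lemma algintB x y : algebraic_integer x -> algebraic_integer y -> algebraic_integer (x - y).
Proof. exact: integral_sub. Qed.
Lemma algintN x : algebraic_integer x -> algebraic_integer (- x).
Proof. exact: integral_opp. Qed.
Lemma algintM x y : algebraic_integer x -> algebraic_integer y -> algebraic_integer (x * y).
Proof. exact: integral_mul. Qed.
Lemma algint_prod (I : finType) (P : pred I) (F : I -> N) :
  (forall i, P i -> algebraic_integer (F i)) -> algebraic_integer (\prod_(i | P i) F i).
Proof. by move=> h; elim/big_rec: _ => [|i x Pi]; [exact: algint1 | apply/algintM/h]. Qed.
Lemma algint_sum (I : finType) (P : pred I) (F : I -> N) :
  (forall i, P i -> algebraic_integer (F i)) -> algebraic_integer (\sum_(i | P i) F i).
Proof. by move=> h; elim/big_rec: _ => [|i x Pi]; [exact: algint0 | apply/algintD/h]. Qed.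
Lemma algint_horner (p : {poly int}) x : algebraic_integer x -> algebraic_integer (map_poly intr p).[x].
Proof.
move=> ix; apply: integral_horner => //; apply/integral_poly => i.
by rewrite coef_map; apply: algint_intr.
Qed.

Lemma algint_Aint x : algebraic_integer x -> iota x \in Aint.
Proof.
case=> p mp; rewrite -(fmorph_root iota) => px; apply: root_monic_Aint px _ _.
  by rewrite map_monic monic_map.
apply/polyOverP => i; rewrite !coef_map /= rmorph_int; exact: rpred_int.
Qed.

Lemma algint_rat (q : rat) : algebraic_integer (q%:A : N) -> exists z : int, q = z%:~R.
Proof.
move/algint_Aint; rewrite alg_num_field fmorph_rat => /(Cint_rat_Aint (Crat_rat _))/intrP[z Dz].
exists z; apply: (fmorph_inj (ratr : rat -> algC)).
by rewrite /= Dz rmorph_int.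
Qed.

Lemma algint_root (p : {poly int}) x : p \is monic -> root (map_poly intr p) x -> algebraic_integer x.
Proof. by move=> mp px; exists p. Qed.

Section MaximalIdeal.

(** A maximal ideal of the ring of integers of [N], as a subset of [N]. Maximality is stated in the
    form in which it is used: an integer outside [m] is invertible modulo [m]. *)
Record max_ideal (m : set N) : Prop := MaxIdeal {
  max_ideal_int : forall x, m x -> algebraic_integer x;
  max_idealD : forall x y, m x -> m y -> m (x + y);
  max_idealM : forall a x, algebraic_integer a -> m x -> m (a * x);
  max_ideal_proper : ~ m 1;
  max_idealI : forall x, algebraic_integer x -> ~ m x -> exists2 c, algebraic_integer c & m (1 - c * x) }.

Lemma exists_max_ideal (p : nat) : prime p -> exists2 m, max_ideal m & m p%:R.
Proof.
move=> p_pr.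
pose J (A : set N) := [/\ forall x, A x -> algebraic_integer x, forall x y, A x -> A y -> A (x + y),
  forall a x, algebraic_integer a -> A x -> A (a * x) & ~ A 1].
(* Zorn's lemma also asks for an upper bound of the empty chain, whose union is empty; hence [p] is
   required only of a nonempty [A]. *)
pose P (A : set N) := J A /\ ((exists x, A x) -> A p%:R).
pose pO : set N := fun x => exists2 y, algebraic_integer y & x = y * p%:R.
have pO_P : P pO.
  split; last by exists 1; [exact: algint1 | rewrite mul1r].
  split=> [x [y iy ->]|x y [x1 ix ->] [y1 iy ->]|a x ia [y iy ->]|].
  - apply: algintM => //; exact: integral_nat.
  - by exists (x1 + y1); [exact: algintD | rewrite mulrDl].
  - by exists (a * y); [exact: algintM | rewrite mulrA].
  (* If [1] were a multiple of [p], then [1/p] would be a rational algebraic integer. *)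
  - case=> y iy E; have [|z Dz] := @algint_rat (p%:R^-1).
      suff <- : y = (p%:R^-1)%:A by [].
      have np0 : p%:R != 0 :> N.
        by rewrite -(fmorph_eq0 iota) rmorph_nat pnatr_eq0 -lt0n prime_gt0.
      by rewrite -in_algE fmorphV rmorph_nat; apply: (mulIf np0); rewrite -E mulVf.
    have : z%:~R * p%:R = 1 :> rat.
      by rewrite -Dz mulVf // pnatr_eq0 -lt0n prime_gt0.
    rewrite -[p%:R]/(p%:Z%:~R) -intrM -[1]/(1%:~R) => /intr_inj/(congr1 absz).
    by rewrite abszM /= => /eqP; rewrite muln_eq1 => /andP[_ /eqP pE]; rewrite pE in p_pr.
have [|M [[[Mi MD MM M1] Mp] Mmax]] := @Zorn_bigcup _ P.
  move=> F FP totF; split; last first.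
    by case=> x [A FA Ax]; exists A => //; have [_] := FP A FA; apply; exists x.
  split=> [x [A FA Ax]|x y [A FA Ax] [B FB By]|a x ia [A FA Ax]|[A FA A1]].
  - by have [[+ _ _ _] _] := FP A FA; apply.
  - case: (totF A B FA FB) => AB.
      by exists B => //; have [[_ + _ _] _] := FP B FB; apply => //; apply: AB.
    by exists A => //; have [[_ + _ _] _] := FP A FA; apply => //; apply: AB.
  - by exists A => //; have [[_ _ + _] _] := FP A FA; apply.
  - by have [[_ _ _ +] _] := FP A FA; apply.
(* A maximal [M] without [p] would be empty, hence strictly contained in [pO]. *)
have Mp' : M p%:R.
  apply: contrapT => nMp; apply: (Mmax pO) pO_P; split.
    by move=> x Mx; case: nMp; apply: Mp; exists x.
  by move=> sub; apply: nMp; apply: sub; exists 1; [exact: algint1 | rewrite mul1r].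
exists M => //; split => // x ix nMx.
apply: contrapT => nC; pose B : set N := fun y => exists c z, [/\ algebraic_integer c, M z & y = c * x + z].
apply: (Mmax B).
  split=> [y My|]; first by exists 0, y; split=> //; [exact: algint0 | rewrite mul0r add0r].
  move=> sub; apply: nMx; apply: sub.
  exists 1, (0 * p%:R); split; [exact: algint1 | exact/MM/Mp'/algint0 | by rewrite mul0r addr0 mul1r].
split; last by move=> _; exists 0, p%:R; split=> //; [exact: algint0 | rewrite mul0r add0r].
split=> [y [c [z [ic Mz ->]]]|y y' [c [z [ic Mz ->]]] [c' [z' [ic' Mz' ->]]]|a y ia [c [z [ic Mz ->]]]|].
- by apply: algintD; [exact: algintM | exact: Mi].
- by exists (c + c'), (z + z'); split; [exact: algintD|exact: MD|rewrite mulrDl addrACA].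
- by exists (a * c), (a * z); split; [exact: algintM|exact: MM|rewrite mulrDr mulrA].
- case=> c [z [ic Mz E]]; apply: nC; exists c => //.
  by rewrite E [c * x + z]addrC addrK.
Qed.

Variables (m : set N) (mm : max_ideal m).

Lemma max_ideal0 : m 0.
Proof.
apply: contrapT => n0; have [c _] := max_idealI mm algint0 n0.
by rewrite mulr0 subr0; apply: max_ideal_proper.
Qed.

Lemma max_idealN x : m x -> m (- x).
Proof. by rewrite -mulN1r; apply: max_idealM => //; apply/algintN/algint1. Qed.

Lemma max_idealB x y : m x -> m y -> m (x - y).
Proof. by move=> mx /max_idealN; apply: max_idealD. Qed.

Lemma max_idealMr x a : algebraic_integer a -> m x -> m (x * a).
Proof. by rewrite mulrC; apply: max_idealM. Qed.

Lemma max_ideal_prime x y : algebraic_integer x -> algebraic_integer y -> m (x * y) -> m x \/ m y.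
Proof.
move=> ix iy mxy; have [mx|nx] := pselect (m x); [by left | right].
have [c ic mc] := max_idealI mm ix nx.
rewrite -[y](subrK (c * x * y)); apply: (max_idealD mm).
  by rewrite -{1}[y]mul1r -mulrBl; apply: max_idealMr.
by rewrite -mulrA; apply: (max_idealM mm).
Qed.

Lemma max_ideal_prod (I : finType) (P : pred I) (F : I -> N) :
  (forall i, P i -> algebraic_integer (F i)) -> (forall i, P i -> ~ m (F i)) ->
  ~ m (\prod_(i | P i) F i).
Proof.
move=> iF nF; suff [] : algebraic_integer (\prod_(i | P i) F i) /\ ~ m (\prod_(i | P i) F i) by [].
elim/big_rec: _ => [|i x Pi [ix nx]].
  by split; [exact: algint1 | exact: max_ideal_proper].
by split; [exact/algintM/ix/iF | case/max_ideal_prime => //; [exact: iF | exact: nF]].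
Qed.

Lemma max_ideal_prod_in (I : finType) (P : pred I) (F : I -> N) i :
  (forall i, P i -> algebraic_integer (F i)) -> P i -> m (F i) -> m (\prod_(i | P i) F i).
Proof.
move=> iF Pi mi; rewrite (bigD1 i) //=; apply: max_idealMr => //.
by apply: algint_prod => j /andP[Pj _]; apply: iF.
Qed.

Lemma max_ideal_prod1 (I : finType) (P : pred I) (F : I -> N) :
  (forall i, P i -> algebraic_integer (F i)) -> (forall i, P i -> m (1 - F i)) ->
  m (1 - \prod_(i | P i) F i).
Proof.
move=> iF mF; suff [] : algebraic_integer (\prod_(i | P i) F i) /\ m (1 - \prod_(i | P i) F i) by [].
elim/big_rec: _ => [|i x Pi [ix mx]].
  by rewrite subrr; split; [exact: algint1 | exact: max_ideal0].
split; first exact/algintM/ix/iF.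
rewrite -(subrK (F i) 1) -addrA -{2}[F i]mulr1 -mulrBr.
by apply: (max_idealD mm); [exact: mF | apply: (max_idealM mm) => //; exact: iF].
Qed.

Lemma max_ideal_1B x : m (1 - x) -> ~ m x.
Proof. by move=> m1 /(max_idealD mm m1); rewrite subrK; apply: max_ideal_proper. Qed.

Variables (p : nat) (p_pr : prime p) (mp : m p%:R).

Lemma max_ideal_intr (z : int) : m z%:~R <-> (p %| z)%Z.
Proof.
split; last first.
  case/dvdzP => k ->; rewrite rmorphM; apply: (max_idealM mm) => //.
  exact: algint_intr.
move=> mz; apply: contrapT => /negP npz.
have cop : coprimez p%:Z z by rewrite coprimezE prime_coprime //.
have /coprimezP[[u v] /= Euv] := cop.
apply: (max_ideal_proper mm).
rewrite -[1](rmorph1 (intr : int -> N)) -Euv rmorphD !rmorphM /=.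
apply: (max_idealD mm); apply: (max_idealM mm) => //; exact: algint_intr.
Qed.

Lemma horner_mod_ideal (f g h : {poly int}) x : algebraic_integer x ->
  f = g + p%:Z *: h -> m (map_poly intr f).[x] <-> m (map_poly intr g).[x].
Proof.
move=> ix ->; rewrite rmorphD /= map_polyZ hornerD hornerZ /=.
have mph : m (p%:~R * (map_poly intr h).[x]).
  by apply: max_idealMr => //; apply: algint_horner.
split=> [E|E]; last exact: (max_idealD mm).
by rewrite -[X in m X](addrK (p%:~R * (map_poly intr h).[x])); apply: max_idealB.
Qed.

(** Modulo [m] the product is [X^c] times a polynomial whose constant term, up to sign, is the
    product of the [x] outside [m]; so the order of vanishing at [0] modulo [m] counts the roots in
    [m]. *)
Lemma cluster_coef (s : seq N) : {in s, forall x, algebraic_integer x} ->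
  let c := count (fun x => `[< m x >]) s in
  let P := \prod_(x <- s) ('X - x%:P) in
  (forall k, algebraic_integer P`_k) /\ (forall k, (k < c)%N -> m P`_k) /\ ~ m P`_c.
Proof.
elim: s => [|x s IH] is_s /=.
  rewrite big_nil; split=> [k|]; last by rewrite coefC; split => //; exact: max_ideal_proper.
  by rewrite coefC; case: eqP => _; [exact: algint1 | exact: algint0].
have ix : algebraic_integer x by apply: is_s; rewrite mem_head.
have [|iP [lowP ncP]] := IH; first by move=> y sy; apply: is_s; rewrite inE sy orbT.
rewrite big_cons; set P := \prod_(x <- s) _ in iP lowP ncP *.
have E k : (('X - x%:P) * P)`_k = (if k is k'.+1 then P`_k' else 0) - x * P`_k.
  by rewrite mulrBl coefB coefXM coefCM; case: k.
split=> [[|k]|].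
- by rewrite E sub0r; apply/algintN/algintM.
- by rewrite E; apply: algintB => //; apply: algintM.
set c := count _ _ in lowP ncP *.
have [mx|nx] /= := asboolP (m x).
  rewrite add1n; split=> [[|k] kc|].
  - by rewrite E sub0r; apply/max_idealN/max_idealMr.
  - by rewrite E; apply: max_idealB; [exact: lowP | exact: max_idealMr].
  - rewrite E => mE; apply: ncP; rewrite -[X in m X](subrK (x * P`_c.+1)).
    by apply: (max_idealD mm) => //; apply: max_idealMr.
rewrite add0n; split=> [[|k] kc|].
- by rewrite E sub0r; apply/max_idealN/(max_idealM mm) => //; exact: lowP.
- rewrite E; apply: max_idealB; first exact/lowP/ltnW.
  by apply: (max_idealM mm) => //; exact: lowP.
rewrite E => mE; have mlow : m (if c is c'.+1 then P`_c' else 0).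
  by case: (c) lowP => [|c'] low; [exact: max_ideal0 | exact: low].
have : m (x * P`_c) by rewrite -[X in m X](subKr (if c is c'.+1 then P`_c' else 0)); apply: max_idealB.
by case/max_ideal_prime.
Qed.

(** After translation by [b], the order of vanishing at [0] modulo [m] is found in two ways:
    [cluster_coef] gives the number of roots congruent to [b], and the factorization modulo [p]
    gives [e]. *)
Lemma cluster_card n (alpha : 'I_n -> N) (f g h : {poly int}) (b : int) (e : nat) :
    (forall i, algebraic_integer (alpha i)) ->
    map_poly intr f = \prod_i ('X - (alpha i)%:P) ->
    f = ('X - b%:P) ^+ e * g + p%:Z *: h -> ~~ (p %| g.[b])%Z ->
  #|[set i | `[< m (alpha i - b%:~R) >]]| = e.
Proof.
move=> ia Df Ef ngb.
pose s := [seq alpha i - b%:~R | i <- enum 'I_n].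
have is_s : {in s, forall x, algebraic_integer x}.
  by move=> _ /mapP[i _ ->]; apply: algintB => //; apply: algint_intr.
have [iP [lowP ncP]] := cluster_coef is_s.
set P := \prod_(x <- s) _ in iP lowP ncP; set c := count _ _ in lowP ncP.
have -> : #|[set i | `[< m (alpha i - b%:~R) >]]| = c.
  rewrite /c /s count_map -size_filter cardE {1}/enum_mem -enumT; congr size.
  by apply: eq_filter => i; rewrite !inE.
have EP : P = map_poly intr (f \Po ('X + b%:P)).
  rewrite map_comp_poly Df /P /s big_map big_enum /= rmorph_prod rmorphD /= map_polyX map_polyC /=.
  apply: eq_bigr => i _; rewrite comp_polyB comp_polyX comp_polyC.
  by rewrite polyCB opprB addrA.
have EPk k : exists y, algebraic_integer y /\
    P`_k = (if (k < e)%N then 0 else ((g \Po ('X + b%:P))`_(k - e))%:~R) + p%:R * y.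
  exists ((h \Po ('X + b%:P))`_k)%:~R; split; first exact: algint_intr.
  rewrite EP Ef rmorphD rmorphM rmorphXn /= comp_polyB comp_polyX comp_polyC addrK comp_polyZ.
  rewrite coef_map coefD coefZ coefXnM /= intrD intrM; congr (_ + _).
  by case: ifP; rewrite ?rmorph0.
case: (ltngtP c e) => // lt.
  case: ncP; have [y [iy ->]] := EPk c; rewrite lt add0r.
  exact: max_idealMr.
have [y [iy E]] := EPk e; have := lowP _ lt; rewrite E ltnn subnn => me.
have : m (g.[b])%:~R.
  have -> : g.[b] = (g \Po ('X + b%:P))`_0.
    by rewrite -horner_coef0 horner_comp !hornerE.
  rewrite -[X in m X](addrK (p%:R * y)); apply: max_idealB => //.
  exact: max_idealMr.
by move/max_ideal_intr => gb; rewrite gb in ngb.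
Qed.
End MaximalIdeal.
End Integers.

Lemma map_intr_rmorph (V W : nzRingType) (g : {rmorphism V -> W}) (q : {poly int}) :
  map_poly g (map_poly intr q) = map_poly intr q.
Proof. by rewrite -map_poly_comp; apply: eq_map_poly => z /=; rewrite rmorph_int. Qed.

Lemma horner_intr_rmorph (V W : nzRingType) (g : {rmorphism V -> W}) (q : {poly int}) x :
  (map_poly intr q).[g x] = g (map_poly intr q).[x].
Proof. by rewrite -horner_map map_intr_rmorph. Qed.

Lemma root_intr_rmorph (V W : fieldType) (g : {rmorphism V -> W}) (q : {poly int}) x :
  root (map_poly intr q) (g x) = root (map_poly intr q) x.
Proof. by rewrite -(fmorph_root g) map_intr_rmorph. Qed.

Lemma algint_rmorph (L V : fieldExtType rat) (s : {rmorphism L -> V}) (x : L) :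
  algebraic_integer x -> algebraic_integer (s x).
Proof.
case=> p mp px; exists p => //; move: px; rewrite -(fmorph_root s) -map_poly_comp.
by congr root; apply: eq_map_poly => z /=; rewrite rmorph_int.
Qed.

(** * Decomposition and inertia *)

Section Decomposition.
Variables (N : splittingFieldType rat) (iota : {rmorphism N -> algC}).
Hypothesis galN : galois 1 {:N}.
Local Notation G := 'Gal({:N} / 1)%g.
Implicit Type s t : gal_of {:N}.

Lemma gal_int s x : algebraic_integer x -> algebraic_integer (s x).
Proof. exact: algint_rmorph. Qed.

Lemma galMf s t x : (s * t)%g x = t (s x).
Proof. by rewrite galM ?memvf. Qed.

Lemma galVK s x : (s^-1)%g (s x) = x.
Proof. by rewrite -galMf mulgV gal_id. Qed.

Lemma galKV s x : s ((s^-1)%g x) = x.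
Proof. by rewrite -galMf mulVg gal_id. Qed.

Lemma gal_fixed_rat x : (forall s, s \in G -> s x = x) -> exists q : rat, x = q%:A.
Proof.
move=> fx; have : x \in fixedField G by apply/fixedFieldP; rewrite ?memvf.
by have /galois_fixedField -> := galN; move/vlineP.
Qed.

Lemma gal_fixed_int x : algebraic_integer x -> (forall s, s \in G -> s x = x) ->
  exists z : int, x = z%:~R.
Proof.
move=> ix /gal_fixed_rat[q Dq]; rewrite {}Dq in ix *.
have [z ->] := algint_rat iota ix; exists z.
by rewrite -in_algE rmorph_int.
Qed.

Lemma gal_intr s (z : int) : s z%:~R = z%:~R.
Proof. exact: rmorph_int. Qed.

Variables (m : set N) (mm : max_ideal m) (p : nat) (p_pr : prime p) (mp : m p%:R).

Definition decomp : {set gal_of {:N}} := [set s in G | `[< forall x, m x -> m (s x) >]].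

Lemma decompP s : reflect (s \in G /\ forall x, m x -> m (s x)) (s \in decomp).
Proof. by rewrite inE; apply: (iffP andP) => -[Gs /asboolP]. Qed.

Fact decomp_group_set : group_set decomp.
Proof.
apply/group_setP; split=> [|s t /decompP[Gs ms] /decompP[Gt mt]].
  by apply/decompP; split=> [|x]; rewrite ?group1 ?gal_id.
by apply/decompP; split=> [|x mx]; rewrite ?groupM // galMf; apply/mt/ms.
Qed.
Canonical decomp_group := Group decomp_group_set.

Lemma decomp_sub : decomp \subset G.
Proof. by apply/fintype.subsetP => s /decompP[]. Qed.

Lemma decomp_mem s x : s \in decomp -> m (s x) <-> m x.
Proof.
move=> Ds; split=> [|mx]; last by have /decompP[_] := Ds; apply.
by have /decompP[_ h] := groupVr Ds; move/h; rewrite galVK.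
Qed.

(** This plays the part of the Chinese remainder theorem for the conjugates of [m]. If [s] is not in
    the decomposition group, neither is its inverse, so some integer outside [m] is sent into [m] by
    [s]. The product of these integers works for all such [s] at once, and its norm over the
    decomposition group is moreover invariant. *)
Lemma decomp_separator : exists eps, [/\ algebraic_integer eps, ~ m eps,
  forall s, s \in decomp -> s eps = eps & forall s, s \in G -> s \notin decomp -> m (s eps)].
Proof.
have sep s : exists e, (s \in G :\: decomp)%g -> [/\ algebraic_integer e, ~ m e & m (s e)].
  have [/setDP[Gs nDs]|] := boolP (s \in G :\: decomp); last by exists 0.
  have /decompP nDV : (s^-1)%g \notin decomp by rewrite groupV.
  have : ~ forall x, m x -> m ((s^-1)%g x) by move=> h; apply: nDV; rewrite groupV.
  move/existsNP => [x /not_implyP[mx nmx]]; exists ((s^-1)%g x) => _.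
  by split; rewrite ?galKV //; apply/gal_int/(max_ideal_int mm).
have [e He] := choice sep.
pose e0 := \prod_(s in G :\: decomp) e s.
have ie0 : algebraic_integer e0 by apply: algint_prod => s /He[].
have ne0 : ~ m e0 by apply: (max_ideal_prod mm) => s /He[].
exists (\prod_(s in decomp) s e0); split.
- by apply: algint_prod => s _; apply: gal_int.
- by apply: (max_ideal_prod mm) => s Ds; [exact: gal_int | rewrite decomp_mem].
- move=> s Ds; rewrite rmorph_prod (reindex_inj (mulIg s^-1)%g) /=.
  apply: eq_big => [t|t Dt]; first by rewrite groupMr ?groupV.
  by rewrite -galMf mulgKV.
move=> s Gs nDs; rewrite rmorph_prod; apply: (max_ideal_prod_in mm (i := 1%g)) => //.
  by move=> t _; do 2 apply: gal_int.
rewrite gal_id rmorph_prod; apply: (max_ideal_prod_in mm (i := s)) => /=.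
- by move=> t /He[it _ _]; apply: gal_int.
- by rewrite inE nDs.
- by have [|_ _] := He s; rewrite // inE nDs.
Qed.

(* The norm of [z] from the fixed field of the decomposition group down to the rationals is
   an integer in [m], hence divisible by [p], and its other factors are units at [m]. *)
Lemma decomp_norm z : algebraic_integer z -> (forall s, s \in decomp -> s z = z) -> m z ->
  (forall s, s \in G -> s \notin decomp -> m (1 - s z)) ->
  exists u (k : int), [/\ algebraic_integer u, ~ m u & z * u = p%:R * k%:~R].
Proof.
move=> iz fz mz m1.
(* Products of automorphisms act from left to right, so for [z] fixed by [decomp] the value [s z]
   depends only on the right coset of [s]. *)
pose F (A : {set gal_of {:N}}) := (repr A) z.
have FE s t : s \in (decomp :* t)%g -> s z = F (decomp :* t)%g.
  move=> st; rewrite /F; have := mem_repr s st.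
  case/rcosetP => d Dd ->; case/rcosetP: st => d' Dd' ->.
  by rewrite !galMf (fz d') // (fz d).
have F_rep s : s \in G -> F (decomp :* s)%g = s z by move=> _; rewrite -(FE s s) ?rcoset_refl.
pose nz := \prod_(A in rcosets decomp G) F A.
have [k Dk] : exists k : int, nz = k%:~R.
  apply: gal_fixed_int => [|s Gs]; first by apply: algint_prod => A _; apply: gal_int.
  rewrite /nz rmorph_prod /=.
  rewrite [RHS](reindex_onto (fun A => A :* s)%g (fun A => A :* s^-1)%g) /=; last first.
    by move=> A _; rewrite -rcosetM mulVg rcoset1.
  apply: eq_big => [A|A /rcosetsP[t Gt ->]]; last first.
    by rewrite -rcosetM !F_rep ?groupM // galMf.
  rewrite -rcosetM mulgV rcoset1 eqxx andbT.
  apply/rcosetsP/rcosetsP => -[t Gt E].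
    by exists (t * s)%g; rewrite ?groupM // E rcosetM.
  exists (t * s^-1)%g; first by rewrite groupM ?groupV.
  by rewrite rcosetM -E -rcosetM mulgV rcoset1.
have DG : (decomp : {set gal_of {:N}}) \in rcosets decomp G.
  by apply/rcosetsP; exists 1%g; rewrite ?group1 ?rcoset1.
have FD : F decomp = z by rewrite -[decomp](rcoset1 decomp) F_rep ?group1 // gal_id.
have intF A : algebraic_integer (F A) by apply: gal_int.
have Ek : k%:~R = z * \prod_(A in rcosets decomp G | A != decomp) F A.
  by rewrite -Dk /nz (bigD1 _ DG) /= FD.
have mk : m k%:~R.
  by rewrite Ek; apply: (max_idealMr mm) => //; apply: algint_prod.
have /dvdzP[k' Dk'] : (p %| k)%Z by apply/(max_ideal_intr mm p_pr mp).
exists (\prod_(A in rcosets decomp G | A != decomp) F A), k'; split.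
- exact: algint_prod.
- apply: (max_ideal_1B mm); apply: (max_ideal_prod1 mm) => // A /andP[/rcosetsP[s Gs ->] nD].
  rewrite F_rep //; apply: m1 => //; apply: contraNN nD => Ds.
  by rewrite rcoset_id.
- by rewrite -Ek Dk' mulrC rmorphM.
Qed.

(* That is, [p] is a uniformizer, at [m], of the fixed field of the decomposition group. *)
Lemma decomp_unramified w : algebraic_integer w -> (forall s, s \in decomp -> s w = w) -> m w ->
  exists u y, [/\ algebraic_integer u, ~ m u, algebraic_integer y & w * u = p%:R * y].
Proof.
move=> iw fw mw; have [eps [ie ne fe mse]] := decomp_separator.
have [c ic mc] := max_idealI mm ie ne.
(* [delta] is in [m] because of its factor at [s = 1], and becomes [1] modulo [m] under every [s]
   outside [decomp], because such [s] send all the conjugates of [eps] involved into [m]. *)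
pose delta := \prod_(s in decomp) s (1 - c * eps).
have i1 : algebraic_integer (1 - c * eps) by apply/algintB/algintM; first exact: algint1.
have idl : algebraic_integer delta by apply: algint_prod => s _; apply: gal_int.
have fdl s : s \in decomp -> s delta = delta.
  move=> Ds; rewrite rmorph_prod [RHS](reindex_inj (mulIg s)) /=.
  apply: eq_big => [t|t Dt]; first by rewrite groupMr.
  by rewrite galMf.
have mdl : m delta.
  by apply: (max_ideal_prod_in mm (i := 1%g)); rewrite ?group1 ?gal_id // => s _; apply: gal_int.
have m1dl s : s \in G -> s \notin decomp -> m (1 - s delta).
  move=> Gs nDs; rewrite rmorph_prod; apply: (max_ideal_prod1 mm) => t Dt.
    by do 2 apply: gal_int.
  rewrite rmorphB rmorph1 rmorphB rmorph1 /= opprB addrC subrK !rmorphM /= -!galMf.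
  apply: (max_idealM mm); first exact: gal_int.
  have Gt : t \in G by have /decompP[] := Dt.
  by apply: mse; [exact: groupM | rewrite groupMl].
have [u1 [k1 [iu1 nu1 E1]]] := decomp_norm idl fdl mdl m1dl.
(* Both [delta] and [eps * w + delta] satisfy the hypotheses of [decomp_norm]; subtracting the two
   relations leaves one for [eps * w], where [eps] is outside [m]. *)
have iz : algebraic_integer (eps * w + delta) by apply/algintD/idl/algintM.
have fz s : s \in decomp -> s (eps * w + delta) = eps * w + delta.
  by move=> Ds; rewrite rmorphD rmorphM /= fe // fw // fdl.
have mz : m (eps * w + delta) by apply: (max_idealD mm) => //; apply: (max_idealM mm).
have m1z s : s \in G -> s \notin decomp -> m (1 - s (eps * w + delta)).
  move=> Gs nDs; rewrite rmorphD rmorphM /= opprD addrCA addrC.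
  apply: (max_idealB mm); first exact: m1dl.
  by apply: (max_idealMr mm); [exact: gal_int | exact: mse].
have [u2 [k2 [iu2 nu2 E2]]] := decomp_norm iz fz mz m1z.
exists (eps * u1 * u2), (k2%:~R * u1 - k1%:~R * u2); split.
- by do 2 apply: algintM => //.
- by case/(max_ideal_prime mm) => //; [exact: algintM | case/(max_ideal_prime mm)].
- by apply: algintB; apply: algintM => //; apply: algint_intr.
have -> : w * (eps * u1 * u2) = (eps * w + delta) * u2 * u1 - delta * u1 * u2.
  by rewrite mulrDl mulrDl [delta * u2 * u1]mulrAC addrK; rewrite [eps * w]mulrC -!mulrA [u2 * u1]mulrC.
by rewrite E1 E2 mulrBr !mulrA.
Qed.

(** At [m], each of [w1] and [w2] is divisible by [p], so [p] would divide [k] there, although [k]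
    is not in [m]. *)
Lemma no_double_divisor (k : int) (w1 w2 w3 u1 u2 y1 y2 : N) : ~~ (p %| k)%Z ->
  p%:R * k%:~R = w1 * (w2 * w3) -> w1 * u1 = p%:R * y1 -> w2 * u2 = p%:R * y2 ->
  algebraic_integer u1 -> ~ m u1 -> algebraic_integer u2 -> ~ m u2 ->
  algebraic_integer y1 -> algebraic_integer y2 -> algebraic_integer w3 -> False.
Proof.
move=> npk Ef E1 E2 iu1 nu1 iu2 nu2 iy1 iy2 iw3.
have np0 : p%:R != 0 :> N.
  by rewrite -(fmorph_eq0 iota) rmorph_nat pnatr_eq0 -lt0n prime_gt0.
have E : k%:~R * (u1 * u2) = p%:R * (y1 * y2 * w3).
  apply: (mulfI np0); rewrite [LHS]mulrA Ef.
  have -> : w1 * (w2 * w3) * (u1 * u2) = (w1 * u1) * (w2 * u2) * w3 by ring.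
  by rewrite E1 E2; ring.
have : m (k%:~R * (u1 * u2)).
  by rewrite E; apply: (max_idealMr mm) => //; do 2 apply: algintM => //.
case/(max_ideal_prime mm); [exact: algint_intr|exact: algintM| |].
  by move/(max_ideal_intr mm p_pr mp) => pk; rewrite pk in npk.
by case/(max_ideal_prime mm).
Qed.

(* With [e(t) = \prod_(s != 1) (s w_s - t w_s)], which vanishes for [t != 1] and has
   [e(1)] outside [m], expanding the product expresses [x * e(1)] through traces
   over the decomposition group, to which [decomp_unramified] applies. *)
Lemma unramified_divides x :
  (forall s, s \in G -> s != 1%g -> exists2 w, algebraic_integer w & ~ m (s w - w)) ->
  algebraic_integer x -> m x -> exists u y, [/\ algebraic_integer u, ~ m u, algebraic_integer y & x * u = p%:R * y].
Proof.
move=> triv ix mx.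
have /choice[w wP] s : exists w, s \in G -> s != 1%g -> algebraic_integer w /\ ~ m (s w - w).
  have [Gs|] := boolP (s \in G); last by exists 0.
  have [->|s1] := eqVneq s 1%g; first by exists 0.
  by have [w iw nw] := triv s Gs s1; exists w.
pose S := (decomp :\ 1%g)%SET.
have SP s : s \in S -> [/\ s \in decomp, algebraic_integer (w s) & ~ m (s (w s) - w s)].
  by rewrite !inE => /andP[s1 /andP[Gs Ds]]; have [] := wP s Gs s1; rewrite Gs.
pose e t := \prod_(s in S) (s (w s) - t (w s)).
(* [A] selects one of the two terms in each factor of [e t]. Off [S] the factor [(A s)%:R] leaves
   only the value [true], so that each selection is counted once in the sum over all [A]. *)
pose a (A : {ffun gal_of {:N} -> bool}) :=
  \prod_s (if s \in S then (if A s then s (w s) else -1) else (A s)%:R).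
pose y (A : {ffun gal_of {:N} -> bool}) := \prod_s (if (s \in S) && ~~ A s then w s else 1).
have iy A : algebraic_integer (y A).
  by apply: algint_prod => s _; case: ifP => [/andP[/SP[]]|_] //; exact: algint1.
have ia A : algebraic_integer (a A).
  apply: algint_prod => s _; case: ifP => [/SP[_ iw _]|_]; case: (A s) => //=.
  - exact: gal_int.
  - exact/algintN/algint1.
  - exact: algint1.
  - exact: algint0.
have eE t : e t = \sum_A a A * t (y A).
  rewrite /e big_mkcond /=.
  transitivity (\prod_s \sum_(c : bool)
      (if s \in S then (if c then s (w s) else - t (w s)) else c%:R)).
    by apply: eq_bigr => s _; rewrite big_bool /=; case: (s \in S); rewrite //= addr0.
  rewrite bigA_distr_bigA; apply: eq_bigr => A _; rewrite /a /y rmorph_prod -big_split /=.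
  apply: eq_bigr => s _; case: (s \in S); case: (A s); rewrite ?rmorph1 ?mulr1 //=.
  by rewrite mulN1r.
have e1 : ~ m (e 1%g).
  apply: (max_ideal_prod mm) => s /SP[_ iw nw]; rewrite gal_id //.
  by apply: algintB => //; exact: gal_int.
have e0 t : t \in decomp -> t != 1%g -> e t = 0.
  move=> Dt t1; have tS : t \in S by apply/setD1P.
  by rewrite /e (bigD1 t) //= subrr mul0r.
pose tr z := \sum_(t in decomp) t z.
have itr z : algebraic_integer z -> algebraic_integer (tr z) by move=> iz; apply: algint_sum => t _; apply: gal_int.
have mtr z : m z -> m (tr z).
  move=> mz; rewrite /tr; elim/big_rec: _ => [|t z' Dt]; first exact: max_ideal0.
  by apply: (max_idealD mm); apply/(decomp_mem _ Dt).
have ftr z s : s \in decomp -> s (tr z) = tr z.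
  move=> Ds; rewrite rmorph_sum [RHS](reindex_inj (mulIg s)) /=.
  by apply: eq_big => [t|t Dt]; rewrite ?groupMr // galMf.
have E : x * e 1%g = \sum_A a A * tr (x * y A).
  transitivity (\sum_(t in decomp) t x * e t).
    rewrite (bigD1 1%g) ?group1 //= gal_id big1 ?addr0 // => t /andP[Dt t1].
    by rewrite e0 ?mulr0.
  under eq_bigr => t _ do rewrite eE mulr_sumr.
  rewrite exchange_big; apply: eq_bigr => A _; rewrite mulr_sumr.
  by apply: eq_bigr => t _; rewrite rmorphM /= mulrCA.
have [u [z [iu nu iz Ez]]] : exists u z, [/\ algebraic_integer u, ~ m u, algebraic_integer z &
    (\sum_A a A * tr (x * y A)) * u = p%:R * z].
  elim/big_rec: _ => [|A r _ [u [z [iu nu iz Ez]]]].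
    exists 1, 0; split; [exact: algint1|exact: max_ideal_proper|exact: algint0|].
    by rewrite mul0r mulr0.
  have [u' [z' [iu' nu' iz' Ez']]] := decomp_unramified (itr _ (algintM ix (iy A))) (ftr _)
    (mtr _ (max_idealMr mm (iy A) mx)).
  exists (u * u'), (z * u' + a A * z' * u); split.
  - exact: algintM.
  - by case/(max_ideal_prime mm).
  - by apply: algintD; [exact: algintM | apply: algintM => //; exact: algintM].
  - have -> : (a A * tr (x * y A) + r) * (u * u') = a A * u * (tr (x * y A) * u') + r * u * u' by ring.
    by rewrite Ez Ez'; ring.
exists (e 1%g * u), z; split => //.
- apply: algintM => //; apply: algint_prod => s /SP[_ iw _]; apply: algintB; exact: gal_int.
- case/(max_ideal_prime mm) => //.
  by apply: algint_prod => s /SP[_ iw _]; apply: algintB; exact: gal_int.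
- by rewrite mulrA E.
Qed.

Section Roots.
Variables (n : nat) (alpha : 'I_n -> N) (rho : gal_of {:N} -> {perm 'I_n}) (f : {poly int}).
Hypothesis alpha_inj : injective alpha.
Hypothesis alpha_int : forall i, algebraic_integer (alpha i).
Hypothesis rhoE : forall s i, s \in G -> alpha (rho s i) = s (alpha i).
Hypothesis fE : map_poly intr f = \prod_i ('X - (alpha i)%:P).

Definition cluster (b : int) : {set 'I_n} := [set i | `[< m (alpha i - b%:~R) >]].

Lemma clusterP b i : reflect (m (alpha i - b%:~R)) (i \in cluster b).
Proof. by rewrite inE; apply: asboolP. Qed.

Lemma cluster_stable b s i : s \in decomp -> (rho s i \in cluster b) = (i \in cluster b).
Proof.
move=> Ds; have Gs : s \in G by have /decompP[] := Ds.
have E : alpha (rho s i) - b%:~R = s (alpha i - b%:~R) by rewrite rmorphB /= gal_intr rhoE.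
apply/clusterP/clusterP; rewrite E; first by move/(decomp_mem _ Ds).
by move=> h; apply/(decomp_mem _ Ds).
Qed.

(* Otherwise [f(b)] has two factors in [m] which are fixed by the decomposition group, namely
   the products of [b - alpha l] over an orbit in the cluster and over its complement there. *)
Lemma cluster_trans b (k : int) : f.[b] = p%:Z * k -> ~~ (p %| k)%Z ->
  {in cluster b &, forall i j, exists2 s, s \in decomp & rho s i = j}.
Proof.
move=> fb npk i j Ci Cj.
pose Om := [set rho s i | s in decomp].
have [/imsetP[s Ds ->]|nj] := boolP (j \in Om); first by exists s.
exfalso.
have intb l : algebraic_integer (b%:~R - alpha l) by apply: algintB => //; apply: algint_intr.
have mC l : l \in cluster b -> m (b%:~R - alpha l).
  by move/clusterP/(max_idealN mm); rewrite opprB.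
have OmC l : l \in Om -> l \in cluster b.
  by case/imsetP => s Ds ->; rewrite cluster_stable.
have OmD s l : s \in decomp -> (rho s l \in Om) = (l \in Om).
  have aux t l' : t \in decomp -> l' \in Om -> rho t l' \in Om.
    move=> Dt /imsetP[r Dr ->]; apply/imsetP; exists (r * t)%g; rewrite ?groupM //.
    have /decompP[Gt _] := Dt; have /decompP[Gr _] := Dr.
    by apply: alpha_inj; rewrite !rhoE ?groupM // galMf.
  move=> Ds; apply/idP/idP; last exact: aux.
  have DsV : (s^-1)%g \in decomp by rewrite groupV.
  move/(aux _ _ DsV); suff -> : rho (s^-1)%g (rho s l) = l by []; apply: alpha_inj.
  have /decompP[Gs _] := Ds.
  by rewrite !rhoE ?groupV // galVK.
pose W (P : pred 'I_n) := \prod_(l | P l) (b%:~R - alpha l).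
have fixW (P : pred 'I_n) s : (forall l, P (rho s l) = P l) -> s \in decomp -> s (W P) = W P.
  move=> PD Ds; have /decompP[Gs _] := Ds.
  rewrite /W rmorph_prod [RHS](reindex_inj (@perm_inj _ (rho s))) /=.
  apply: eq_big => [l|l _]; first by rewrite PD.
  by rewrite rmorphB /= gal_intr rhoE.
have intW P : algebraic_integer (W P) by apply: algint_prod.
pose P1 := [pred l | l \in Om]; pose P2 := [pred l | (l \notin Om) && (l \in cluster b)].
pose P3 := [pred l | (l \notin Om) && (l \notin cluster b)].
have [|s Ds||u1 [y1 [iu1 nu1 iy1 E1]]] := @decomp_unramified (W P1) => //.
- by apply: fixW => // l; rewrite /= OmD.
- apply: (max_ideal_prod_in mm (i := i)) => //=; last exact: mC.
  apply/imsetP; exists 1%g; rewrite ?group1 //; apply: alpha_inj.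
  by rewrite rhoE ?group1 // gal_id.
have [|s Ds||u2 [y2 [iu2 nu2 iy2 E2]]] := @decomp_unramified (W P2) => //.
- by apply: fixW => // l; rewrite /= OmD // cluster_stable.
- by apply: (max_ideal_prod_in mm (i := j)) => //=; [rewrite nj Cj | exact: mC].
have nW3 : ~ m (W P3).
  apply: (max_ideal_prod mm) => // l /andP[_ nC] ml; case/clusterP: nC.
  by rewrite -opprB; apply: (max_idealN mm).
have Ef : p%:R * k%:~R = W P1 * (W P2 * W P3).
  have -> : p%:R * k%:~R = (f.[b])%:~R :> N by rewrite fb rmorphM.
  rewrite -horner_map fE horner_prod /W (bigID (mem Om)) /=; congr (_ * _).
    by apply: eq_bigr => l _; rewrite !hornerE.
  rewrite (bigID (mem (cluster b))) /=; congr (_ * _); apply: eq_bigr => l _; rewrite !hornerE //.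
exact: (no_double_divisor npk Ef E1 E2).
Qed.

(** With trivial inertia, [unramified_divides] would make every element of [m] divisible by [p] at
    [m]. Two roots congruent to [b] would then contribute two factors [p] to [f.[b]], which has only
    one. *)
Lemma inertia_nontrivial b (k : int) : f.[b] = p%:Z * k -> ~~ (p %| k)%Z ->
  (1 < #|cluster b|)%N ->
  exists s, [/\ s \in G, s != 1%g & forall x, algebraic_integer x -> m (s x - x)].
Proof.
move=> fb npk C1; apply: contrapT => nI.
have triv s : s \in G -> s != 1%g -> exists2 x, algebraic_integer x & ~ m (s x - x).
  move=> Gs s1; apply: contrapT => h; apply: nI; exists s; split=> // x ix.
  by apply: contrapT => nx; apply: h; exists x.
have [i Ci [j Cj ij]] : exists2 i, i \in cluster b & exists2 j, j \in cluster b & i != j.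
  have /card_gt1P[i [j [Ci Cj ij]]] := C1.
  by exists i => //; exists j.
have intb l : algebraic_integer (b%:~R - alpha l) by apply: algintB => //; apply: algint_intr.
have mC l : l \in cluster b -> m (b%:~R - alpha l).
  by move/clusterP/(max_idealN mm); rewrite opprB.
have [u1 [y1 [iu1 nu1 iy1 E1]]] := unramified_divides triv (intb i) (mC i Ci).
have [u2 [y2 [iu2 nu2 iy2 E2]]] := unramified_divides triv (intb j) (mC j Cj).
pose W := \prod_(l | (l != i) && (l != j)) (b%:~R - alpha l).
have iW : algebraic_integer W by apply: algint_prod.
have Ef : p%:R * k%:~R = (b%:~R - alpha i) * ((b%:~R - alpha j) * W).
  have -> : p%:R * k%:~R = (f.[b])%:~R :> N by rewrite fb rmorphM.
  rewrite -horner_map fE horner_prod (bigD1 i) //= hornerXsubC (bigD1 j) /=; last by rewrite eq_sym.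
  by rewrite hornerXsubC; congr (_ * (_ * _)); apply: eq_bigr => l _; rewrite hornerXsubC.
exact: (no_double_divisor npk Ef E1 E2).
Qed.

(** If [s] moved [alpha i] to another root, the two roots would be congruent modulo [m], and [f]
    would have a double root there. As [alpha i - b] is a unit modulo [m], the double root belongs
    to [g], and the Bezout relation puts [d] into [m]. *)
Lemma inertia_fixes b e (g h u v : {poly int}) (d : int) s i :
    f = ('X - b%:P) ^+ e * g + p%:Z *: h -> u * g + v * g^`() = d%:P -> ~~ (p %| d)%Z ->
    s \in G -> (forall x, algebraic_integer x -> m (s x - x)) -> i \notin cluster b ->
  rho s i = i.
Proof.
move=> Ef Eg npd Gs Is iC; set j := rho s i; have [//|ji] := eqVneq j i.
exfalso; move/negP: npd; apply; apply/(max_ideal_intr mm p_pr mp).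
have ii := alpha_int i.
have iib : algebraic_integer (alpha i - b%:~R) by apply: algintB => //; apply: algint_intr.
have nb : ~ m (alpha i - b%:~R) by move/clusterP => h1; rewrite h1 in iC.
have nbX k : ~ m ((alpha i - b%:~R) ^+ k).
  elim: k => [|k IH]; first exact: max_ideal_proper.
  rewrite exprS => /(max_ideal_prime mm iib)[||//]//.
  by elim: (k) => [|k' ik]; [exact: algint1 | rewrite exprS; exact: algintM].
have iX k : algebraic_integer ((alpha i - b%:~R) ^+ k).
  by elim: k => [|k' ik]; [exact: algint1 | rewrite exprS; exact: algintM].
have ev (q : {poly int}) : algebraic_integer (map_poly intr q).[alpha i] by exact: algint_horner.
have fi : (map_poly intr f).[alpha i] = 0.
  by rewrite fE horner_prod (bigD1 i) //= hornerXsubC subrr mul0r.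
have mg : m (map_poly intr g).[alpha i].
  have : m (map_poly intr (('X - b%:P) ^+ e * g)).[alpha i].
    by apply/(horner_mod_ideal mm mp ii Ef); rewrite fi; exact: max_ideal0.
  rewrite rmorphM rmorphXn rmorphB /= map_polyX map_polyC hornerM horner_exp hornerXsubC.
  by case/(max_ideal_prime mm (iX e) (ev g)) => // /nbX.
have mf' : m (map_poly intr f^`()).[alpha i].
  rewrite -deriv_map fE (bigD1 i) //= derivM hornerD !hornerM hornerXsubC subrr mul0r addr0.
  rewrite derivXsubC hornerC mul1r horner_prod; apply: (max_ideal_prod_in mm (i := j)) => //.
    by move=> l _; rewrite hornerXsubC; apply: algintB.
  by rewrite hornerXsubC -opprB rhoE //; apply/(max_idealN mm)/Is.
have mg' : m (map_poly intr g^`()).[alpha i].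
  have E' : f^`() = (('X - b%:P) ^+ e)^`() * g + ('X - b%:P) ^+ e * g^`() + p%:Z *: h^`().
    by rewrite Ef derivD derivM derivZ.
  have := (horner_mod_ideal mm mp ii E').1 mf'.
  rewrite rmorphD !rmorphM hornerD !hornerM /= => mD.
  have : m ((map_poly intr (('X - b%:P) ^+ e)).[alpha i] * (map_poly intr g^`()).[alpha i]).
    rewrite -[X in m X](addKr ((map_poly intr (('X - b%:P) ^+ e)^`()).[alpha i] * (map_poly intr g).[alpha i])).
    by rewrite addrC; apply: (max_idealB mm) => //; apply: (max_idealM mm).
  rewrite rmorphXn rmorphB /= map_polyX map_polyC horner_exp hornerXsubC.
  by case/(max_ideal_prime mm (iX e) (ev _)) => // /nbX.
have -> : d%:~R = (map_poly intr (d%:P)).[alpha i] :> N by rewrite map_polyC hornerC.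
rewrite -Eg rmorphD !rmorphM hornerD !hornerM /=.
by apply: (max_idealD mm); apply: (max_idealM mm).
Qed.

End Roots.
End Decomposition.

(** * Integral bases and discriminants *)

Section Discriminant.
Variables (L N : fieldExtType rat) (iota : {rmorphism N -> algC}).
Local Notation d := (\dim {:L}).
Variables (sigma : 'I_d -> {rmorphism L -> N}) (theta : L).
Hypothesis theta_int : algebraic_integer theta.
Hypothesis sigma_theta_inj : injective (fun j => sigma j theta).

Lemma rmorph_scale (f : {rmorphism L -> N}) (a : rat) x : f (a *: x) = a *: f x.
Proof. by rewrite (fmorph_numZ f). Qed.

Definition conj_mx (b : d.-tuple L) : 'M[N]_d := \matrix_(k, j) sigma j (tnth b k).

Definition power_tuple : d.-tuple L := [tuple theta ^+ i | i < d].

Lemma det_power_tuple :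
  \det (conj_mx power_tuple) =
  \prod_(i < d) \prod_(j < d | (i < j)%N) (sigma j theta - sigma i theta).
Proof.
transitivity (\det (Vandermonde d (\row_j sigma j theta))).
  congr (\det _); apply/matrixP => i j; rewrite !mxE tnth_mktuple rmorphXn //.
by rewrite det_Vandermonde; apply: eq_bigr => i _; apply: eq_bigr => j _; rewrite !mxE.
Qed.

Lemma det_power_tuple_neq0 : \det (conj_mx power_tuple) != 0.
Proof.
rewrite det_power_tuple; apply/prodf_neq0 => i _; apply/prodf_neq0 => j ij.
by rewrite subr_eq0 (inj_eq sigma_theta_inj) -val_eqE gtn_eqF.
Qed.

Lemma conj_mx_coord (b : d.-tuple L) : basis_of {:L} b -> forall c : d.-tuple L,
  conj_mx c = map_mx (in_alg N) (\matrix_(k, l) coord b l (tnth c k)) *m conj_mx b.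
Proof.
move=> bb c; apply/matrixP => k j; rewrite !mxE.
rewrite {1}(coord_basis bb (memvf (tnth c k))) rmorph_sum /=.
by apply: eq_bigr => l _; rewrite !mxE rmorph_scale !(tnth_nth 0) /= -scalerAl mul1r.
Qed.

Lemma det_conj_basis (b : d.-tuple L) : basis_of {:L} b -> \det (conj_mx b) != 0.
Proof.
move=> bb; have := det_power_tuple_neq0; rewrite (conj_mx_coord bb) det_mulmx.
by rewrite mulf_eq0 negb_or => /andP[].
Qed.

Lemma basis_of_det (b : d.-tuple L) : \det (conj_mx b) != 0 -> basis_of {:L} b.
Proof.
move=> nz; rewrite basisEfree subvf size_tuple leqnn !andbT.
apply/freeP => c c0 i.
have : (\row_k in_alg N (c k)) *m conj_mx b = 0.
  apply/rowP => j; rewrite !mxE; transitivity (sigma j (\sum_(k < d) c k *: b`_k)); last by rewrite c0 rmorph0.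
  rewrite rmorph_sum /=.
  by apply: eq_bigr => k _; rewrite !mxE rmorph_scale (tnth_nth 0) /= -scalerAl mul1r.
move/(congr1 (mulmx^~ (invmx (conj_mx b)))); rewrite mulmxK ?mul0mx; last by rewrite unitmxE unitfE.
by move/rowP/(_ i); rewrite !mxE => /eqP; rewrite fmorph_eq0 => /eqP.
Qed.

(** The matrix [conj_mx] of a basis, invertible because the conjugates of [theta] are distinct,
    diagonalizes multiplication by [x], with the conjugates of [x] on the diagonal. *)
Lemma trace_conj x : (field_trace x)%:A = \sum_j sigma j x.
Proof.
set b := vbasis {:L}; have bb : basis_of {:L} b := vbasisP {:L}.
pose M := passmx.mxof b b (amulr x).
have E : map_mx (in_alg N) M *m conj_mx b = conj_mx b *m diag_mx (\row_j sigma j x).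
  apply/matrixP => k j; rewrite mul_mx_diag !mxE -rmorphM.
  have -> : tnth b k * x = \sum_l M k l *: b`_l.
    have -> : tnth b k * x = amulr x (tnth b k) by rewrite lfunE.
    rewrite -[tnth b k](passmx.rVofK bb) (passmx.hom_vecof b bb) (tnth_nth 0) (passmx.rVofE bb).
    rewrite -rowE; apply: eq_bigr => l _; by rewrite mxE.
  rewrite rmorph_sum; apply: eq_bigr => l _.
  by rewrite !mxE rmorph_scale (tnth_nth 0) /= -scalerAl mul1r.
have U : conj_mx b \in unitmx by rewrite unitmxE unitfE det_conj_basis.
have EM : map_mx (in_alg N) M = conj_mx b *m diag_mx (\row_j sigma j x) *m invmx (conj_mx b).
  by rewrite -E mulmxK.
rewrite -in_algE /field_trace -/b -/M -trace_map_mx EM mxtrace_mulC mulmxA mulVmx // mul1mx.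
by rewrite mxtrace_diag; apply: eq_bigr => j _; rewrite mxE.
Qed.

Definition gram_det (b : d.-tuple L) : rat :=
  \det (\matrix_(i, j) field_trace (tnth b i * tnth b j)).

Lemma gram_det_conj b : (gram_det b)%:A = \det (conj_mx b) ^+ 2.
Proof.
rewrite -in_algE /gram_det -det_map_mx expr2 -[X in _ * X]det_tr -det_mulmx; congr (\det _).
apply/matrixP => i j; rewrite !mxE; apply: etrans (trace_conj _) _; apply: eq_bigr => k _.
by rewrite !mxE rmorphM.
Qed.

Lemma gram_det_eq0 b : (gram_det b == 0) = (\det (conj_mx b) == 0).
Proof. by rewrite -(fmorph_eq0 (in_alg N)) /= gram_det_conj expf_eq0. Qed.

Definition int_tuple (b : d.-tuple L) := forall i, algebraic_integer (tnth b i).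

Lemma gram_det_int b : int_tuple b -> exists z : int, gram_det b = z%:~R.
Proof.
move=> ib; apply: (algint_rat iota); rewrite gram_det_conj.
have idet : algebraic_integer (\det (conj_mx b)).
  rewrite /determinant; apply: algint_sum => s _; apply: algintM.
    by rewrite -signr_odd; case: odd; [exact/algintN/algint1 | exact: algint1].
  by apply: algint_prod => i _; rewrite mxE; apply: algint_rmorph.
by rewrite expr2; apply: algintM.
Qed.

Lemma power_tuple_int : int_tuple power_tuple.
Proof.
move=> i; rewrite tnth_mktuple; elim: (i : nat) => [|k IH]; first exact: algint1.
by rewrite exprS; apply: algintM.
Qed.

Lemma gram_det_replace (b : d.-tuple L) (bb : basis_of {:L} b) k x :
  let b' := [tuple if i == k then x else tnth b i | i < d] in
  gram_det b' = coord b k x ^+ 2 * gram_det b.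
Proof.
move=> b'; apply: (fmorph_inj (in_alg N)); rewrite rmorphM rmorphXn /=.
rewrite !gram_det_conj (conj_mx_coord bb) det_mulmx exprMn det_map_mx; rewrite /=; congr (_%:A ^+ 2 * _).
set A := \matrix_(_, _) _.
rewrite (expand_det_col _ k) (bigD1 k) //= big1 ?addr0 => [|i ik]; last first.
  rewrite mxE tnth_mktuple (negPf ik) (tnth_nth 0) coord_free ?(basis_free bb) //.
  by rewrite (negPf ik) mul0r.
rewrite mxE tnth_mktuple eqxx; rewrite /cofactor addnn -signr_odd odd_double mul1r.
rewrite [row' _ _](_ : _ = 1%:M) ?det1 ?mulr1 //.
apply/matrixP => i j; rewrite !mxE tnth_mktuple eq_sym (negPf (neq_lift _ _)).
rewrite (tnth_nth 0) coord_free ?(basis_free bb) // (inj_eq lift_inj).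
by [].
Qed.

(** Take a basis of integers whose [gram_det] is nonzero and minimal in absolute value. If an
    integer had a non-integral coordinate, replacing the basis vector by the integer with this
    coordinate reduced to its fractional part [r] would multiply [gram_det] by [r ^+ 2 < 1]. The
    powers of [theta] are a competitor, which gives the bound. *)
Lemma exists_integral_basis :
  exists b, [/\ integral_basis b & `|gram_det b| <= `|gram_det power_tuple| ].
Proof.
pose P k := `[< exists b, [/\ int_tuple b, gram_det b != 0 & `|gram_det b| = k%:R ] >].
have Pint b : int_tuple b -> gram_det b != 0 -> exists2 k, P k & `|gram_det b| = k%:R.
  move=> ib nb; have [z Dz] := gram_det_int ib.
  have E : `|gram_det b| = `|z|%N%:R by rewrite Dz -intr_norm -abszE.
  by exists `|z|%N => //; apply/asboolP; exists b.
have np : gram_det power_tuple != 0 by rewrite gram_det_eq0 det_power_tuple_neq0.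
have [k0 Pk0 Ek0] := Pint _ power_tuple_int np.
have exP : exists k, P k by exists k0.
case: (ex_minnP exP) => k /asboolP[b [ib nb Ek]] mink.
have bb : basis_of {:L} b by apply: basis_of_det; rewrite -gram_det_eq0.
exists b; split; last by rewrite Ek Ek0 ler_nat mink.
split=> // x; split=> [ix|[z ->]]; last first.
  by apply: algint_sum => i _; rewrite -mulrzl; apply: algintM (ib i); apply: algint_intr.
suff intc i : coord b i x \in Num.int.
  exists (fun i => Num.floor (coord b i x)).
  rewrite {1}(coord_basis bb (memvf x)); apply: eq_bigr => i _.
  by rewrite (tnth_nth 0) -scaler_int floorK.
apply: contrapT => /negP nint; pose c := coord b i x; pose r := c - (Num.floor c)%:~R.
pose y := x - tnth b i *~ Num.floor c.
have cy : coord b i y = r.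
  rewrite /y -scaler_int linearB linearZ /= (tnth_nth 0) coord_free ?(basis_free bb) //.
  by rewrite eqxx mulr1.
have r0 : 0 < r.
  rewrite lt_neqAle subr_ge0 floor_le andbT eq_sym subr_eq0.
  by apply: contraNneq nint => E; rewrite -/c E rpred_int.
have r1 : r < 1 by rewrite ltrBlDr addrC -[1]/(1%:~R) -intrD floorD1_gt.
pose b' := [tuple if j == i then y else tnth b j | j < d].
have ib' : int_tuple b'.
  move=> j; rewrite tnth_mktuple; case: eqP => // _.
  by apply: algintB => //; rewrite -mulrzl; apply: algintM (ib i); apply: algint_intr.
have Eb' : gram_det b' = r ^+ 2 * gram_det b by rewrite gram_det_replace // cy.
have nb' : gram_det b' != 0 by rewrite Eb' mulf_neq0 // expf_neq0 // gt_eqF.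
have [k' Pk' Ek'] := Pint _ ib' nb'.
have := mink _ Pk'; rewrite -(ler_nat rat) -Ek' -Ek Eb' normrM => le.
have : `|r ^+ 2| < 1 by rewrite ger0_norm ?exprn_ge0 ?ltW // expr_lt1 // ltW.
have : 0 < `|gram_det b| by rewrite normr_gt0.
by nra.
Qed.

Lemma has_discriminant_bound : exists2 r : rat, has_discriminant L r &
  ratr `|r| <= `|iota (\det (conj_mx power_tuple))| ^+ 2 :> algC.
Proof.
have [b [bi le]] := exists_integral_basis.
exists (gram_det b); first by exists b.
rewrite -normrX -rmorphXn -gram_det_conj /= alg_num_field fmorph_rat -ratr_norm.
by rewrite ler_rat.
Qed.

End Discriminant.

Lemma discriminant_bound (L N : fieldExtType rat) (iota : {rmorphism N -> algC})
    (n : nat) (dimL : \dim {:L} = n) (sigma : 'I_n -> {rmorphism L -> N}) (theta : L) :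
    algebraic_integer theta -> injective (fun j => sigma j theta) ->
  exists2 r : rat, has_discriminant L r &
    ratr `|r| <= `|iota (\prod_(i < n) \prod_(j < n | (i < j)%N)
                         (sigma j theta - sigma i theta))| ^+ 2 :> algC.
Proof.
case: n / dimL sigma => sigma it inj.
have [r hr le] := has_discriminant_bound iota it inj.
by exists r; rewrite // -det_power_tuple.
Qed.

(** * The field generated by a root *)

Section GaloisRoots.
Variables (N : splittingFieldType rat) (iota : {rmorphism N -> algC}).
Variables (n : nat) (alpha : 'I_n -> N) (f : {poly int}).
Hypothesis f_monic : f \is monic.
Hypothesis alpha_inj : injective alpha.
Hypothesis fE : map_poly intr f = \prod_i ('X - (alpha i)%:P).
Hypothesis gen_alpha : <<1 & codom alpha>>%VS = fullv.
Local Notation G := 'Gal({:N} / 1)%g.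

Lemma root_fE x : root (map_poly intr f) x = [exists i, alpha i == x].
Proof.
rewrite fE; apply/idP/existsP => [|[i /eqP <-]].
  rewrite /root horner_prod prodf_seq_eq0 => /hasP[i _]; rewrite hornerXsubC subr_eq0 /=.
  by rewrite eq_sym; exists i.
by rewrite /root horner_prod (bigD1 i) //= hornerXsubC subrr mul0r.
Qed.

Lemma alpha_int i : algebraic_integer (alpha i).
Proof. by apply: algint_root f_monic _; rewrite root_fE; apply/existsP; exists i. Qed.

Lemma roots_galois : galois 1 {:N}.
Proof.
apply/splitting_galoisField; exists (map_poly intr f); split.
- by apply/polyOverP => i; rewrite coef_map /= rpred_int.
- rewrite fE -(big_map alpha xpredT (fun x => 'X - x%:P)) separable_prod_XsubC.
  by rewrite map_inj_uniq // /index_enum -enumT enum_uniq.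
- exists (codom alpha); last exact: gen_alpha.
  by rewrite fE /codom /image_mem big_map big_enum /= eqpxx.
Qed.
Let galN := roots_galois.

Lemma gal_root (s : gal_of {:N}) i : exists j, alpha j == s (alpha i).
Proof.
apply/existsP; rewrite -root_fE.
have : root (map_poly intr f) (alpha i) by rewrite root_fE; apply/existsP; exists i.
rewrite -(fmorph_root s) -map_poly_comp; congr root.
by apply: eq_map_poly => z; apply: gal_intr.
Qed.

Definition root_fun (s : gal_of {:N}) i : 'I_n := sval (sigW (gal_root s i)).

Lemma root_funE s i : alpha (root_fun s i) = s (alpha i).
Proof. by rewrite /root_fun; case: sigW => j /= /eqP. Qed.

Lemma root_fun_inj s : injective (root_fun s).
Proof. by move=> i j /(congr1 alpha); rewrite !root_funE => /fmorph_inj/alpha_inj. Qed.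

Definition root_perm s : {perm 'I_n} := perm (@root_fun_inj s).

Lemma root_permE s i : alpha (root_perm s i) = s (alpha i).
Proof. by rewrite permE root_funE. Qed.

Lemma root_permM : {in G &, {morph root_perm : s t / (s * t)%g}}.
Proof.
move=> s t _ _; apply/permP => i; apply: alpha_inj.
by rewrite permM !root_permE galMf.
Qed.
Canonical root_perm_morphism := Morphism root_permM.

Lemma fixed_alpha_id (V : fieldExtType rat) (g h : {rmorphism N -> V}) :
  (forall i, g (alpha i) = h (alpha i)) -> g =1 h.
Proof.
move=> gh x; have : x \in <<1 & codom alpha>>%VS by rewrite gen_alpha memvf.
have : {in codom alpha, g =1 h} by move=> _ /codomP[i ->].
elim/last_ind: (codom alpha) x => [|r y IH] x ghr.
  by rewrite Fadjoin_nil => /vlineP[q ->]; rewrite !rmorphZ_num !rmorph1.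
rewrite adjoin_rcons => /Fadjoin_polyP[q qr ->].
rewrite -!horner_map /= ghr ?mem_rcons ?mem_head //; congr _.[_].
apply/polyP => i; rewrite !coef_map; apply: IH; last exact: (polyOverP qr).
by move=> z rz; apply: ghr; rewrite mem_rcons inE rz orbT.
Qed.

Lemma root_perm_injm : ('injm root_perm_morphism)%g.
Proof.
apply/injmP => s t _ _ E; apply/eqP/gal_eqP => x _.
apply: fixed_alpha_id => i; transitivity (alpha (root_perm s i)); first by rewrite root_permE.
by rewrite [root_perm s]E root_permE.
Qed.

Definition root_vdm : N := \prod_(i < n) \prod_(j < n | (i < j)%N) (alpha j - alpha i).

Lemma root_vdm_neq0 : root_vdm != 0.
Proof.
apply/prodf_neq0 => i _; apply/prodf_neq0 => j ij.
by rewrite subr_eq0 (inj_eq alpha_inj) -val_eqE gtn_eqF.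
Qed.

Lemma gal_root_vdm (s : gal_of {:N}) : s root_vdm = (-1) ^+ root_perm s * root_vdm.
Proof.
pose V := Vandermonde n (\row_j alpha j).
have DV : root_vdm = \det V.
  by rewrite det_Vandermonde; apply: eq_bigr => i _; apply: eq_bigr => j _; rewrite !mxE.
rewrite DV -det_map_mx.
have -> : map_mx s V = col_perm (root_perm s) V.
  by apply/matrixP => i j; rewrite !mxE rmorphXn root_permE.
by rewrite col_permE det_mulmx det_perm odd_permV mulrC.
Qed.

(** The Galois group multiplies [root_vdm] by the sign of the permutation and fixes it when it is
    rational. *)
Lemma root_perm_Alt (q : rat) : root_vdm ^+ 2 = q%:A ^+ 2 ->
  (root_perm_morphism @* G \subset 'Alt_('I_n))%g.
Proof.
move=> E; have [e De] : exists e : rat, root_vdm = e%:A.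
  have /eqP := E; rewrite -subr_eq0 subr_sqr mulf_eq0 subr_eq0 addr_eq0 => /orP[]/eqP->.
    by exists q.
  by exists (- q); rewrite scaleNr.
apply/fintype.subsetP => _ /morphimP[s _ _ ->]; rewrite Alt_even.
have := gal_root_vdm s; rewrite {1}De -in_algE.
have -> : s (in_alg N e) = root_vdm by rewrite /= rmorphZ_num rmorph1 De -alg_num_field mulr1.
rewrite -[LHS]mul1r => /(mulIf root_vdm_neq0)/eqP; case: (odd_perm _) => //=.
rewrite expr1 => /eqP/(congr1 iota)/eqP.
by rewrite rmorphN rmorph1 -subr_eq0 opprK -(natrD _ 1 1) pnatr_eq0.
Qed.

Lemma orbit_prod_int (Om : {set 'I_n}) (q : {poly int}) :
  (forall s i, s \in G -> (root_perm s i \in Om) = (i \in Om)) ->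
  exists z : int, \prod_(i in Om) (map_poly intr q).[alpha i] = z%:~R.
Proof.
move=> st; apply: (gal_fixed_int iota galN) => [|s Gs].
  by apply: algint_prod => i _; apply/algint_horner/alpha_int.
rewrite rmorph_prod [RHS](reindex_inj (@perm_inj _ (root_perm s))) /=.
apply: eq_big => [i|i _]; first by rewrite st.
rewrite -horner_map root_permE -map_poly_comp /=; congr _.[_].
by apply: eq_map_poly => z; apply: gal_intr.
Qed.

Section RootField.
Hypothesis trans : forall i j, exists2 s, s \in G & root_perm s i = j.
Variable i0 : 'I_n.

Definition root_gal i : gal_of {:N} := sval (sig2_eqW (trans i0 i)).

Lemma root_galP i : root_gal i \in G /\ root_gal i (alpha i0) = alpha i.
Proof. by rewrite /root_gal; case: sig2_eqW => s /= Gs <-; rewrite root_permE. Qed.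

Lemma minPoly_root : minPoly 1 (alpha i0) = map_poly intr f.
Proof.
apply/eqP; rewrite -eqp_monic ?monic_minPoly ?monic_map //; apply/andP; split.
  apply: minPoly_dvdp; last by rewrite root_fE; apply/existsP; exists i0.
  by apply/polyOverP => i; rewrite coef_map /= rpred_int.
rewrite fE -(big_map alpha xpredT (fun x => 'X - x%:P)).
apply: uniq_roots_dvdp; last first.
  by rewrite uniq_rootsE map_inj_uniq // /index_enum -enumT enum_uniq.
apply/allP => _ /mapP[i _ ->]; have [Gs <-] := root_galP i.
by apply: root_minPoly_gal => //; [exact: sub1v | exact: memvf].
Qed.

Definition root_field : fieldExtType rat := subvs_of <<1; alpha i0>>%AS.

Lemma dim_root_field : \dim {:root_field} = n.
Proof.
rewrite dimvf; transitivity (\dim <<1; alpha i0>>); first by [].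
rewrite dim_Fadjoin dimv1 muln1; apply: succn_inj.
rewrite -size_minPoly minPoly_root fE -(big_map alpha xpredT (fun x => 'X - x%:P)).
by rewrite size_prod_XsubC size_map /index_enum -enumT size_enum_ord.
Qed.

Definition root_gen : root_field := Subvs (memv_adjoin 1 (alpha i0)).

Lemma root_field_horner (x : root_field) :
  exists q : {poly rat}, x = (map_poly (in_alg root_field) q).[root_gen].
Proof.
have /Fadjoin_polyP[q q1 Dx] := valP x.
have /(_ _)/sig_eqW a_ i : exists a : rat, q`_i = a%:A by apply/vlineP/(polyOverP q1).
exists (\poly_(i < size q) sval (a_ i)); apply: val_inj; rewrite /= Dx.
rewrite -[RHS]/((vsval : {rmorphism root_field -> N}) _) -horner_map /=.
congr _.[_]; apply/polyP => i; rewrite !coef_map coef_poly /=.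
case: ltnP => [_|le]; last by rewrite nth_default // scale0r.
by rewrite algid1; case: (a_ i).
Qed.

Lemma root_field_ext (V : fieldExtType rat) (g h : {rmorphism root_field -> V}) :
  g root_gen = h root_gen -> g =1 h.
Proof.
move=> gh x; have [q ->] := root_field_horner x.
rewrite -!horner_map /= gh -!map_poly_comp; congr _.[_]; apply: eq_map_poly => a /=.
by rewrite !rmorphZ_num !rmorph1.
Qed.

Definition root_incl : 'AHom(root_field, N) := linfun_ahom (vsval : {lrmorphism root_field -> N}).

Definition root_emb i : 'AHom(root_field, N) := comp_ahom (root_gal i) root_incl.

Lemma root_embE i x : root_emb i x = root_gal i (vsval x).
Proof. by rewrite comp_lfunE; congr (_ _); rewrite lfunE. Qed.

Lemma root_emb_gen i : root_emb i root_gen = alpha i.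
Proof. by rewrite root_embE; have [_] := root_galP i. Qed.

Lemma root_emb_bij : bijective root_emb.
Proof.
have surj (g : 'AHom(root_field, N)) : exists i, root_emb i == g.
  have : root (map_poly intr f) (g root_gen).
    have : root (map_poly intr f) root_gen.
      rewrite -(fmorph_root (vsval : {rmorphism root_field -> N})) -map_poly_comp.
      rewrite [map_poly _ _](_ : _ = map_poly intr f); last first.
        by apply: eq_map_poly => z /=; rewrite rmorph_int.
      by rewrite root_fE; apply/existsP; exists i0.
    rewrite -(fmorph_root g) -map_poly_comp; congr root.
    by apply: eq_map_poly => z /=; rewrite rmorph_int.
  rewrite root_fE => /existsP[i /eqP Ei]; exists i; apply/eqP/val_inj/lfunP => x.
  by apply: root_field_ext; exact: etrans (root_emb_gen i) Ei.
exists (fun g => sval (sigW (surj g))) => [i|g]; last by case: sigW => i /= /eqP.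
by case: sigW => j /= /eqP E; apply: alpha_inj; rewrite -!root_emb_gen E.
Qed.

Lemma root_emb_perm s i x : s \in G -> root_emb (root_perm s i) x = s (root_emb i x).
Proof.
move=> Gs; pose h : 'AHom(root_field, N) := comp_ahom s (root_emb i).
have -> : s (root_emb i x) = h x by exact/esym/comp_lfunE.
apply: root_field_ext; rewrite [LHS]root_emb_gen root_permE.
by apply: esym; apply: etrans (comp_lfunE _ _ _) _; congr (s _); exact: root_emb_gen.
Qed.

Lemma root_galois_closure : is_galois_closure root_field N.
Proof.
exists (root_emb i0); split=> // F sF gF; apply: val_inj => /=.
apply/eqP; rewrite eqEsubv subvf -gen_alpha; apply/Fadjoin_seqP; split; first exact: sub1v.
move=> _ /codomP[i ->].
have aF : alpha i0 \in F by apply: (subvP sF); rewrite -root_emb_gen memv_img ?memvf.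
have /and3P[_ _ /normalFieldP/(_ _ aF)[r /allP rF Er]] := gF.
apply: rF; rewrite -root_prod_XsubC -Er minPoly_root root_fE; apply/existsP; by exists i.
Qed.

Lemma root_permisom : (root_perm_morphism @* G = 'Alt_('I_n))%g ->
  galois_group_permisom 'Alt_('I_n)%G root_field.
Proof.
move=> imG; exists N; split; first exact: root_galois_closure.
exists root_emb; split; first exact: root_emb_bij.
exists root_perm_morphism; split; last by move=> g Gg i x; apply: root_emb_perm.
by apply/isomP; split; [exact: root_perm_injm | exact: imG].
Qed.

Lemma root_gen_int : algebraic_integer root_gen.
Proof.
exists f => //; rewrite -(fmorph_root (vsval : {rmorphism root_field -> N})) -map_poly_comp.
rewrite [map_poly _ _](_ : _ = map_poly intr f); last first.
  by apply: eq_map_poly => z /=; rewrite rmorph_int.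
by rewrite root_fE; apply/existsP; exists i0.
Qed.

Lemma root_discriminant : exists2 r : rat, has_discriminant root_field r &
  ratr `|r| <= `|iota root_vdm| ^+ 2 :> algC.
Proof.
have [|r hr le] := @discriminant_bound root_field N iota n dim_root_field root_emb root_gen root_gen_int.
  by move=> i j /=; rewrite !root_emb_gen => /alpha_inj.
exists r => //; apply: le_trans le _; rewrite le_eqVlt; apply/orP; left; apply/eqP.
congr (`|iota _| ^+ 2); apply: eq_bigr => i _; apply: eq_bigr => j _.
by congr (_ - _); exact: root_emb_gen.
Qed.

(** The Galois group permutes the factors, so the coefficients are rational algebraic integers. This
    is the second half of [conj_datum]. *)
Lemma root_emb_charpoly x : algebraic_integer x ->
  exists q : {poly int}, \prod_i ('X - (iota (root_emb i x))%:P) = map_poly intr q.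
Proof.
move=> ix; pose P : {poly N} := \prod_i ('X - (root_emb i x)%:P).
have iP k : algebraic_integer P`_k.
  rewrite /P; elim/big_rec: _ k => [|i p _ ip] k.
    by rewrite coefC; case: eqP => _; [exact: algint1 | exact: algint0].
  rewrite mulrBl coefB coefXM coefCM; apply: algintB.
    by case: eqP => _; [exact: algint0 | exact: ip].
  by apply: algintM (ip k); apply: algint_rmorph.
have fP s : s \in G -> map_poly s P = P.
  move=> Gs; rewrite /P rmorph_prod [RHS](reindex_inj (@perm_inj _ (root_perm s))) /=.
  apply: eq_bigr => i _; rewrite rmorphB /= map_polyX map_polyC /=.
  by rewrite -root_emb_perm.
have /choice[q_ Dq] (k : nat) : exists z : int, P`_k = z%:~R.
  apply: (gal_fixed_int iota galN) => // s Gs.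
  by rewrite -[in RHS](fP s Gs) coef_map.
exists (\poly_(k < size P) q_ k).
have -> : \prod_i ('X - (iota (root_emb i x))%:P) = map_poly iota P.
  by rewrite rmorph_prod; apply: eq_bigr => i _; rewrite rmorphB /= map_polyX map_polyC.
apply/polyP => k; rewrite !coef_map coef_poly /=; case: ltnP => [_|le].
  by rewrite Dq rmorph_int.
by rewrite nth_default // rmorph0.
Qed.

End RootField.
End GaloisRoots.

(** * Members of a pencil with the same field *)

Lemma Aint_algint (L : fieldExtType rat) (iota : {rmorphism L -> algC}) x :
  iota x \in Aint -> algebraic_integer x.
Proof.
rewrite unfold_in => /floorpP[q Dq]; exists q.
  have := minCpoly_monic (iota x); rewrite Dq !monicE lead_coef_map_inj ?rmorph0 //.
    by rewrite -[1]/(1%:~R) eqr_int.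
  exact: intr_inj.
have := root_minCpoly (iota x); rewrite Dq.
rewrite -(fmorph_root iota) -map_poly_comp; congr root.
by apply: eq_map_poly => z /=; rewrite rmorph_int.
Qed.

Lemma coef_prod_XsubC_le (R : numDomainType) (I : Type) (r : seq I) (z : I -> R) (b : R) :
  0 <= b -> (forall i, `|z i| <= b) ->
  forall k, `|(\prod_(i <- r) ('X - (z i)%:P))`_k| <= (1 + b) ^+ size r.
Proof.
move=> b0 zb; elim: r => [|i r IH] k.
  by rewrite big_nil coefC expr0; case: eqP => _; rewrite ?normr1 ?normr0 ?ler01.
rewrite big_cons mulrBl coefB coefXM coefCM exprS mulrDl mul1r.
apply: le_trans (ler_normB _ _) _; apply: lerD.
  by case: eqP => // _; rewrite normr0 exprn_ge0 ?addr_ge0 ?ler01.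
by rewrite normrM ler_pM.
Qed.

Lemma bounded_coef_roots (n b : nat) : exists Xi : seq algC,
  forall (q : {poly int}) x, q != 0 -> (size q <= n)%N -> (forall k, `|q`_k| <= b%:Z) ->
    root (map_poly intr q) x -> x \in Xi.
Proof.
pose T := {ffun 'I_n -> 'I_(b + b).+1}.
(* A value [g i] between [0] and [2b] encodes the coefficient [g i - b]. *)
pose pol (g : T) : {poly int} := \poly_(k < n) (if insub k is Some i then (g i)%:Z - b%:Z else 0).
pose rts (q : {poly int}) := sval (closed_field_poly_normal (map_poly intr q : {poly algC})).
exists (flatten [seq rts (pol g) | g <- enum T]) => q x q0 sq qb qx.
pose g : T := [ffun i : 'I_n => inord `|(q`_i + b%:Z)%R|%N].
have Eq : pol g = q.
  apply/polyP => k; rewrite coef_poly; case: ltnP => [kn|nk]; last first.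
    by rewrite nth_default // (leq_trans sq).
  rewrite insubT ffunE inordK /=; have := qb k; move: (q`_k) => a; lia.
apply/flatten_mapP; exists g; first by rewrite mem_enum.
rewrite Eq /rts; case: closed_field_poly_normal => rs /= Ers.
have nz : lead_coef (map_poly intr q : {poly algC}) != 0.
  by rewrite lead_coef_map_inj ?intr_eq0 ?lead_coef_eq0 //; exact: intr_inj.
by move: qx; rewrite Ers rootZ // root_prod_XsubC.
Qed.

(** The integer parts lie in the same interval from [2^t] to [2^(t+1)], where [t] is the common
    logarithm; as the upper end is an integer not attained, it also bounds [x]. *)
Lemma truncn_log_ratio (x y : algC) : 1 <= x -> 1 <= y ->
  trunc_log 2 (Num.truncn x) = trunc_log 2 (Num.truncn y) -> x <= 2%:R * y.
Proof.
move=> x1 y1 E; have x0 : 0 <= x by apply: le_trans x1; rewrite ler01.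
have y0 : 0 <= y by apply: le_trans y1; rewrite ler01.
have tx : (0 < Num.truncn x)%N by rewrite truncn_gt0.
have ty : (0 < Num.truncn y)%N by rewrite truncn_gt0.
have /andP[_ ux] := truncn_itv x0; have /andP[ly _] := truncn_itv y0.
have lex : ((Num.truncn x).+1 <= 2 ^ (trunc_log 2 (Num.truncn x)).+1)%N by apply: trunc_log_ltn.
have ley : (2 ^ (trunc_log 2 (Num.truncn y)) <= Num.truncn y)%N by apply: trunc_logP.
apply: le_trans (ltW ux) _; apply: (@le_trans _ _ (2 * Num.truncn y)%N%:R).
  rewrite ler_nat; apply: leq_trans lex _; rewrite E expnS.
  by rewrite leq_mul2l ley orbT.
by rewrite natrM ler_pM2l ?ltr0n.
Qed.

Lemma card_fibre_le (T : finType) (A : eqType) (s : seq A) (g : A -> T) (m : nat) :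
  (forall t, (count (fun a => g a == t) s <= m)%N) -> (size s <= #|T| * m)%N.
Proof.
move=> h; have -> : size s = \sum_(t : T) count (fun a => g a == t) s.
  elim: s {h} => [|a s IH] /=; first by rewrite big1.
  rewrite big_split /= -IH (bigD1 (g a)) //= eqxx big1 ?addn0 ?add1n // => t.
  by rewrite eq_sym => /negPf->.
apply: (@leq_trans (\sum_(t : T) m)); last by rewrite sum_nat_const.
by apply: leq_sum => t _; exact: h.
Qed.

Section Fibre.
Variables (n : nat) (P Q : {poly int}) (c B : int).
Hypotheses (c0 : c != 0) (P_monic : P \is monic) (sizeP : size P = n.+1)
  (sizeQ1 : (1 < size Q)%N) (sizeQn : (size Q <= n)%N) (B0 : B != 0).

Definition family (s : nat) : {poly int} := P + (c * (s ^ 2)%:Z) *: Q.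

Local Notation evQ := (fun a : algC => (map_poly intr Q).[a]).

(** The consequence of the constant norm that is used for the fibres: the inverse of [Q(a)] becomes
    integral after multiplication by [B]. *)
Definition divides_norm := forall s (a : algC), root (map_poly intr (family s)) a ->
  exists2 b, b \in Aint & evQ a * b = B%:~R.

(** What is needed of the conjugates of [L], detached from the Galois closure: the given embedding
    is one of them, and the characteristic polynomial of an integer is integral. *)
Definition conj_datum (L : fieldExtType rat) (iota : {rmorphism L -> algC})
    (tau : 'I_n -> {rmorphism L -> algC}) :=
  (exists i, tau i =1 iota) /\
  forall x, algebraic_integer x -> exists q : {poly int}, \prod_i ('X - (tau i x)%:P) = map_poly intr q.

Lemma size_family s : size (family s) = n.+1.
Proof.
by rewrite size_polyDl sizeP // ltnS; apply: leq_trans (size_scale_leq _ _) sizeQn.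
Qed.

Lemma family_monic s : family s \is monic.
Proof.
rewrite monicE lead_coefDl -?monicE // sizeP ltnS.
exact: leq_trans (size_scale_leq _ _) sizeQn.
Qed.

Lemma family_inj s r (a : algC) : evQ a != 0 ->
  root (map_poly intr (family s)) a -> root (map_poly intr (family r)) a -> s = r.
Proof.
move=> nz /rootP; rewrite /family rmorphD /= map_polyZ hornerD hornerZ => Es.
move/rootP; rewrite rmorphD /= map_polyZ hornerD hornerZ -Es => /addrI/(mulIf nz)/intr_inj.
move/(mulfI c0)/eqP; rewrite eqz_nat => /eqP E; apply/eqP; rewrite eq_sym.
by rewrite -(@eqn_exp2r r s 2) // E.
Qed.

(** The constant [C] is the same for all fields. For members with the same vector of dyadic sizes,
    the quotient of two values of [Q], times [B], has a characteristic polynomial of bounded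
    coefficients, hence lies in a list [Xi] depending only on [n] and [B]. It determines [Q] at the
    root, thus the root up to fewer than [n] choices, and the root determines [s] by
    [family_inj]. *)
Lemma fibre_bound : divides_norm -> exists C : nat, forall (M : nat) (F : seq nat)
    (L : fieldExtType rat) (iota : {rmorphism L -> algC}) tau,
  conj_datum iota tau -> uniq F -> (0 < M)%N ->
  (forall s, s \in F -> exists x : L, root (map_poly intr (family s)) (iota x)) ->
  (forall s a, s \in F -> root (map_poly intr (family s)) a -> `|evQ a| <= M%:R) ->
  (size F <= (trunc_log 2 (M ^ n.+1)).+1 ^ n * C)%N.
Proof.
move=> dvB; pose b1 := (2 * `|B|)%N.
have [Xi XiP] := bounded_coef_roots n.+1 (b1.+1 ^ n).
exists (size Xi * n)%N => M F L iota tau [[i0 tau0] chp] uF M0 rF leM.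
have /choice[x xP] s : exists x : L, s \in F -> root (map_poly intr (family s)) (iota x).
  by have [/rF[x rx]|] := boolP (s \in F); [exists x | exists 0].
pose y s : L := (map_poly intr Q).[x s].
have xL s : s \in F -> root (map_poly intr (family s)) (x s).
  by move/xP; rewrite root_intr_rmorph.
have tauQ i s : tau i (y s) = evQ (tau i (x s)) by rewrite horner_intr_rmorph.
have tau_root i s : s \in F -> root (map_poly intr (family s)) (tau i (x s)).
  by move/xL; rewrite root_intr_rmorph.
have int_y s : s \in F -> algebraic_integer (y s).
  by move=> Fs; apply: algint_horner; exact: algint_root (family_monic s) (xL s Fs).
have nz i s : s \in F -> tau i (y s) != 0.
  move=> Fs; have [b _] := dvB s _ (tau_root i s Fs); rewrite -tauQ => E.
  by apply: contra_neq B0 => z; apply/eqP; rewrite -(intr_eq0 algC) -E z mul0r.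
have leMy i s : s \in F -> `|tau i (y s)| <= M%:R.
  by move=> Fs; rewrite tauQ; apply: (leM s) => //; exact: tau_root.
have M1 : 1 <= M%:R :> algC by rewrite ler1n.
(* The norm of [y s] is a nonzero integer and no conjugate exceeds [M], so the factor [W] brings the
   absolute values of all conjugates between [1] and [M^(n+1)]. *)
pose W : algC := (M ^ n)%:R.
have geW i s : s \in F -> 1 <= `|tau i (y s)| * W.
  move=> Fs; have [q Eq] := chp _ (int_y s Fs).
  have E : \prod_j `|tau j (y s)| = (absz q`_0)%:R.
    rewrite -normr_prod.
    have := congr1 (fun p : {poly algC} => p.[0]) Eq; rewrite horner_prod.
    have -> : (map_poly intr q).[0] = (q`_0)%:~R :> algC.
      by rewrite horner_coef0 coef_map.
    have -> : \prod_j ('X - (tau j (y s))%:P).[0] = \prod_j - tau j (y s).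
      by apply: eq_bigr => j _; rewrite hornerXsubC sub0r.
    rewrite prodrN => Ec; have := congr1 (@Num.norm _ _) Ec; rewrite normrM normrX normrN1 expr1n mul1r.
    by move=> ->; rewrite -intr_norm -abszE.
  have q1 : 1 <= \prod_j `|tau j (y s)|.
    rewrite E ler1n lt0n -(pnatr_eq0 algC) -E.
    by apply/prodf_neq0 => j _; rewrite normr_eq0 nz.
  apply: le_trans q1 _; rewrite (bigD1 i) //= ler_wpM2l //.
  rewrite big_mkcond /=; apply: (@le_trans _ _ (\prod_(j < n) M%:R)); last first.
    by rewrite prodr_const card_ord -natrX lexx.
  by apply: ler_prod => j _; case: ifP => _; rewrite ?ler01 //= normr_ge0 leMy.
have leW i s : s \in F -> `|tau i (y s)| * W <= (M ^ n.+1)%:R.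
  by move=> Fs; rewrite expnS natrM ler_pM ?ler0n // leMy.
pose q := trunc_log 2 (M ^ n.+1).
pose g s : {ffun 'I_n -> 'I_q.+1} :=
  [ffun i => inord (trunc_log 2 (Num.truncn (`|tau i (y s)| * W)))].
have -> : (q.+1 ^ n)%N = #|{ffun 'I_n -> 'I_q.+1}| by rewrite card_ffun !card_ord.
apply: (@card_fibre_le _ _ F g) => t; rewrite -size_filter.
set Ft := filter _ F; case DFt : Ft => [//|s' Ft']; rewrite -DFt.
have FtP s : s \in Ft -> s \in F /\ g s = t.
  by rewrite mem_filter => /andP[/eqP].
have [Fs' gs'] : s' \in F /\ g s' = t by apply: FtP; rewrite DFt mem_head.
have ratio i s : s \in Ft -> `|tau i (y s)| <= 2%:R * `|tau i (y s')|.
  move=> /FtP[Fs gs]; have W0 : 0 < W by rewrite ltr0n expn_gt0 M0.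
  rewrite -(ler_pM2r W0) -mulrA; apply: truncn_log_ratio; [exact: geW|exact: geW|].
  have bq r : r \in F -> (trunc_log 2 (Num.truncn (`|tau i (y r)| * W)) < q.+1)%N.
    move=> Fr; rewrite ltnS; apply: leq_trunc_log.
    by have := le_truncn (leW i r Fr); rewrite natrK.
  have := congr1 (fun h : {ffun 'I_n -> 'I_q.+1} => h i : nat) (etrans gs (esym gs')).
  by rewrite /= !ffunE !inordK ?bq.
have [beta bA Ebeta] := dvB s' _ (xP s' Fs').
rewrite horner_intr_rmorph -/(y s') in Ebeta.
have ny' : iota (y s') != 0 by rewrite -tau0 nz.
(* [xi s] is integral, being [y s] times the cofactor [beta] of [y s'] in [B], and its conjugates
   are at most [2 |B|] because the dyadic sizes agree. *)
pose xi s := B%:~R * y s / y s' : L.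
have xiE s : iota (xi s) = iota (y s) * beta.
  rewrite /xi fmorph_div rmorphM rmorph_int -Ebeta.
  by rewrite mulrAC [iota (y s') * beta]mulrC mulfK // mulrC.
have xiXi s : s \in Ft -> iota (xi s) \in Xi.
  move=> Fts; have [Fs _] := FtP s Fts.
  have ixi : algebraic_integer (xi s).
    by apply: (@Aint_algint _ iota); rewrite xiE; apply: rpredM bA; exact/algint_Aint/int_y.
  have [p Ep] := chp _ ixi.
  have pm : p \is monic.
    have : map_poly intr p \is @monic algC by rewrite -Ep monic_prod_XsubC.
    rewrite !monicE lead_coef_map_inj ?rmorph0 //; last exact: intr_inj.
    by rewrite -[1]/(1%:~R) eqr_int.
  apply: (XiP p); first exact: monic_neq0.
  - have <- : size (map_poly intr p : {poly algC}) = size p.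
      by apply: size_map_inj_poly; [exact: intr_inj | rewrite rmorph0].
    by rewrite -Ep size_prod_XsubC /index_enum -enumT size_enum_ord.
  - have xib i : `|tau i (xi s)| <= b1%:R.
      rewrite fmorph_div rmorphM rmorph_int normrM normrM normfV.
      have eB : `|B%:~R| = (absz B)%:R :> algC by rewrite -intr_norm -abszE.
      rewrite ler_pdivrMr ?normr_gt0 ?nz // eB /b1 natrM -mulrA mulrCA.
      by rewrite ler_wpM2l ?ler0n // ratio.
    move=> k; have := coef_prod_XsubC_le (index_enum 'I_n) (ler0n _ _) xib k.
    rewrite Ep coef_map /= /index_enum -enumT size_enum_ord -(natrD _ 1 b1) add1n -natrX.
    by rewrite -intr_norm pmulrn ler_int.
  - by rewrite -Ep -tau0 /root horner_prod (bigD1 i0) //= hornerXsubC subrr mul0r.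
pose rts (p : {poly algC}) := sval (closed_field_poly_normal p).
(* The candidates for the root of a member: the solutions of [Q(x) = z y(s') / B] for [z] in
   [Xi]. *)
pose Lst := flatten [seq rts (map_poly intr Q - (z * iota (y s') / B%:~R)%:P) | z <- Xi].
have BC : B%:~R != 0 :> algC by rewrite intr_eq0.
have sizeQC : size (map_poly intr Q : {poly algC}) = size Q.
  by apply: size_map_inj_poly; [exact: intr_inj | rewrite rmorph0].
have sz z : size (map_poly intr Q - z%:P : {poly algC}) = size Q.
  rewrite size_polyDl sizeQC // size_polyN size_polyC.
  by apply: leq_ltn_trans (leq_b1 _) sizeQ1.
have nzp z : map_poly intr Q - z%:P != 0 :> {poly algC}.
  by rewrite -size_poly_gt0 sz; apply: leq_trans sizeQ1.
have rtsP (p : {poly algC}) a : p != 0 -> root p a -> a \in rts p.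
  move=> p0; rewrite /rts; case: closed_field_poly_normal => r /= {1}->.
  by rewrite rootZ ?lead_coef_eq0 // root_prod_XsubC.
have sz_rts (p : {poly algC}) : p != 0 -> size (rts p) = (size p).-1.
  move=> p0; rewrite /rts; case: closed_field_poly_normal => r /= ->.
  by rewrite size_scale ?lead_coef_eq0 // size_prod_XsubC.
have szL : (size Lst <= size Xi * n)%N.
  rewrite size_flatten /shape -map_comp sumnE big_map.
  elim: (Xi) => [|z r IH]; first by rewrite big_nil.
  rewrite big_cons /= mulSn leq_add // sz_rts // sz.
  by apply: leq_trans (leq_pred _) sizeQn.
apply: leq_trans szL; rewrite -(size_map (fun s => iota (x s)) Ft).
apply: uniq_leq_size.
  rewrite map_inj_in_uniq ?filter_uniq // => s r /FtP[Fs _] /FtP[Fr _] E.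
  apply: (@family_inj _ _ (iota (x s))); [|exact: xP|by rewrite E; exact: xP].
  by rewrite horner_intr_rmorph -/(y s) -tau0 nz.
move=> _ /mapP[s Fts ->]; apply/flatten_mapP; exists (iota (xi s)); first exact: xiXi.
apply: rtsP; first exact: nzp.
rewrite rootE hornerD hornerN hornerC horner_intr_rmorph -/(y s) xiE.
by rewrite -[_ * beta * _]mulrA [beta * _]mulrC Ebeta mulfK // subrr.
Qed.
End Fibre.

(** * Galois groups of the members of a good pencil *)

Lemma splitting_data n (f : {poly int}) : f \is monic -> size f = n.+1 ->
  (forall x : algC, root (map_poly intr f) x -> (map_poly intr f^`()).[x] != 0) ->
  exists (N : splittingFieldType rat) (iota : {rmorphism N -> algC}) (alpha : 'I_n -> N),
    [/\ injective alpha, map_poly intr f = \prod_i ('X - (alpha i)%:P) &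
        <<1 & codom alpha>>%VS = fullv].
Proof.
move=> mf sf sep.
have mfC : map_poly intr f \is @monic algC by rewrite monic_map.
have [rs Ers] := closed_field_poly_normal (map_poly intr f : {poly algC}).
rewrite (monicP mfC) scale1r in Ers.
have urs : uniq rs.
  rewrite -separable_prod_XsubC -Ers unlock; apply: Pdiv.ClosedField.root_coprimep => x rx.
  by rewrite deriv_map; apply: sep.
have [Qs [QsC [s1 Es1 gen1]]] := num_field_exists rs.
have Ef : map_poly intr f = \prod_(z <- s1) ('X - z%:P) :> {poly Qs}.
  apply: (map_poly_inj QsC); rewrite map_intr_rmorph Ers -Es1 big_map rmorph_prod.
  by apply: eq_bigr => z _; rewrite rmorphB /= map_polyX map_polyC.
have ax : SplittingField.axiom Qs.
  exists (map_poly intr f); first by apply/polyOverP => i; rewrite coef_map /= rpred_int.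
  by exists s1; rewrite // Ef eqpxx.
pose NM := FieldExt_isSplittingField.Build rat Qs ax.
pose N : splittingFieldType rat := HB.pack Qs NM.
have ss : size s1 = n.
  apply: succn_inj; rewrite -sf -[RHS](size_map_inj_poly (f := intr : int -> Qs)) ?rmorph0 //.
    by rewrite Ef size_prod_XsubC.
  by move=> x y /(congr1 QsC); rewrite !rmorph_int => /intr_inj.
exists N, QsC, (fun i : 'I_n => s1`_i); split.
- move=> i j; move/eqP; rewrite nth_uniq ?ss //; last by rewrite -(map_inj_uniq (fmorph_inj QsC)) Es1.
  by move/eqP/val_inj.
- by rewrite [LHS]Ef (big_nth 0) ss big_mkord.
- rewrite -[RHS]gen1; congr (<<1 & _>>%VS).
  rewrite /codom /image_mem -[RHS](mkseq_nth (0 : Qs)) ss /mkseq -val_enum_ord -map_comp.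
  by rewrite enumT.
Qed.

(** For the roots [z] of a monic polynomial the left side is the product of the values of its
    derivative at them; the sign comes from reversing the differences with [i < j]. *)
Lemma prod_offdiag_vdm (R : comNzRingType) n (z : 'I_n -> R) :
  \prod_i \prod_(j | j != i) (z i - z j) =
  (-1) ^+ 'C(n, 2) * (\prod_(i < n) \prod_(j < n | (i < j)%N) (z j - z i)) ^+ 2.
Proof.
set D := \prod_(i < n) _.
transitivity ((\prod_(i < n) \prod_(j < n | (i < j)%N) (z i - z j)) *
              (\prod_(i < n) \prod_(j < n | (j < i)%N) (z i - z j))).
  rewrite -big_split /=; apply: eq_bigr => i _.
  rewrite (bigID (fun j : 'I_n => (i < j)%N)) /=; congr (_ * _); apply: eq_bigl => j.
    by rewrite neq_ltn; case: ltngtP.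
  by rewrite -val_eqE /=; case: ltngtP.
have -> : \prod_(i < n) \prod_(j < n | (j < i)%N) (z i - z j) = D.
  by rewrite (exchange_big_dep predT).
rewrite expr2 mulrA; congr (_ * _).
transitivity (\prod_(i < n) ((-1) ^+ (n - i.+1) * \prod_(j < n | (i < j)%N) (z j - z i))).
  apply: eq_bigr => i _; rewrite -[(n - i.+1)%N](_ : #|[pred j : 'I_n | (i < j)%N]| = _).
    by rewrite -prodr_const -big_split /=; apply: eq_bigr => j _; rewrite mulN1r opprB.
  rewrite -sum1_card (eq_bigl (fun j : 'I_n => (i < j)%N)) // -(big_mkord (fun j => (i < j)%N) (fun=> 1%N)).
  rewrite (@big_cat_nat _ _ _ i.+1) //= big_nat_cond big1 => [|j /andP[/andP[_ ji] ij]]; last by lia.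
  rewrite add0n big_nat_cond (eq_bigl (fun j => (i < j < n)%N)) => [|j]; last by lia.
  by rewrite -big_nat sum_nat_const_nat muln1.
rewrite big_split /= prodrXr; congr (_ ^+ _ * _).
rewrite -triangular_sum big_mkord (reindex_inj rev_ord_inj) /=; apply: eq_bigr => i _.
by rewrite subnSK ?ltn_ord // subKn // ltnW.
Qed.

(* [0], [b] and [a] are the critical points of [P/Q], [- g1], [- g2] and [0] the critical values;
   [B] is the constant norm of [Q(theta)], and [w^2] the value that makes [disc f_s] a square. *)
Record good_family (n : nat) (P Q : {poly int}) (c lam a b B w g1 g2 d : int) (e : nat)
    (A1 A2 U V : {poly int}) : Prop := GoodFamily {
  gf_monic : P \is monic;
  gf_size : size P = n.+1;
  gf_Q1 : (1 < size Q)%N;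
  gf_Qn : (size Q <= n)%N;
  gf_c : c != 0;
  gf_ode : P^`() * Q - P * Q^`() = lam *: (('X^e * ('X - b%:P)) ^+ 2 * ('X - a%:P));
  gf_a : P.[a] = 0;
  gf_norm : forall s (alpha : 'I_n -> algC),
    map_poly intr (family P Q c s) = \prod_i ('X - (alpha i)%:P) ->
    \prod_i (map_poly intr Q).[alpha i] = B%:~R;
  gf_B : B != 0;
  gf_square : (-1) ^+ 'C(n, 2) * lam ^+ n * ((-1) ^+ n * c * Q.[a]) * B = w ^+ 2;
  gf_w : w != 0;
  gf_1 : P + g1 *: Q = 'X^(e.*2.+1) * A1;
  gf_g1 : g1 != 0;
  gf_Q0 : Q.[0] != 0;
  gf_A1 : A1.[0] != 0;
  gf_2 : P + g2 *: Q = ('X - b%:P) ^+ 3 * A2;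
  gf_g2 : g2 != 0;
  gf_Qb : Q.[b] != 0;
  gf_A2 : A2.[b] != 0;
  gf_sep : U * A2 + V * A2^`() = d%:P;
  gf_d : d != 0;
  gf_par : n = e.*2.+2 \/ n = e.*2.+3 /\ exists r, Q = 'X - r%:P }.

Definition exact_div (p : nat) (z : int) : Prop := exists2 k : int, z = p%:Z * k & ~~ (p %| k)%Z.

Lemma exact_div_neq0 p z : prime p -> exact_div p z -> z != 0.
Proof.
move=> p_pr [k -> nk]; rewrite mulf_neq0 //; first by rewrite eqz_nat -lt0n prime_gt0.
by apply: contraNneq nk => ->; rewrite dvdz0.
Qed.

Lemma exact_divM p z y : prime p -> exact_div p z -> ~~ (p %| y)%Z -> exact_div p (z * y).
Proof.
move=> p_pr [k -> nk] ny; exists (k * y); first by rewrite mulrA.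
by rewrite dvdzE abszM /= Euclid_dvdM // negb_or; apply/andP; split; [exact: nk | exact: ny].
Qed.

Section PencilMember.
Variables (n : nat) (P Q : {poly int}) (c lam a b B w g1 g2 d : int) (e : nat).
Variables (A1 A2 U V : {poly int}).
Hypothesis gf : good_family n P Q c lam a b B w g1 g2 d e A1 A2 U V.
Local Notation fam := (family P Q c).

(* What excludes a proper factor of [f_s]: its roots would have a norm of [Q] dividing [B]. *)
Definition isolated (s : nat) : Prop :=
  (n = e.*2.+2 -> forall x : int, (fam s).[x] = 0 -> (absz Q.[x] <= absz B)%N -> False) /\
  (n = e.*2.+3 -> forall x y : algC, root (map_poly intr (fam s)) x ->
     root (map_poly intr (fam s)) y -> `|(map_poly intr Q).[x]| <= (absz B)%:R ->
     `|(map_poly intr Q).[y]| <= (absz B)%:R -> x = y).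

Lemma fam_horner (V0 : nzRingType) s (x : V0) :
  (map_poly intr (fam s)).[x] = (map_poly intr P).[x] + (c * (s ^ 2)%:Z)%:~R * (map_poly intr Q).[x].
Proof. by rewrite rmorphD /= map_polyZ hornerD hornerZ. Qed.

(** Adding a multiple of [Q] to [P] does not change the Wronskian, so all members share it. *)
Lemma fam_ode s : (fam s)^`() * Q - fam s * Q^`() =
  lam *: (('X^e * ('X - b%:P)) ^+ 2 * ('X - a%:P)).
Proof.
rewrite -(gf_ode gf) /family derivD derivZ !mulrDl opprD addrACA.
by rewrite -!scalerAl [Q * _]mulrC subrr addr0.
Qed.

Lemma fam_shift s g : fam s = (P + g *: Q) + (c * (s ^ 2)%:Z - g) *: Q.
Proof. by rewrite -addrA -scalerDl [g + _]addrC subrK. Qed.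

Lemma fam0 s : (fam s).[0] = (c * (s ^ 2)%:Z - g1) * Q.[0].
Proof. by rewrite (fam_shift s g1) (gf_1 gf) hornerD hornerM hornerXn expr0n mul0r add0r hornerZ. Qed.

Lemma famb s : (fam s).[b] = (c * (s ^ 2)%:Z - g2) * Q.[b].
Proof.
rewrite (fam_shift s g2) (gf_2 gf) hornerD hornerM horner_exp hornerXsubC subrr expr0n mul0r.
by rewrite add0r hornerZ.
Qed.

Lemma fama s : (fam s).[a] = c * (s ^ 2)%:Z * Q.[a].
Proof. by rewrite hornerD (gf_a gf) add0r hornerZ. Qed.

Lemma lam_neq0 : lam != 0.
Proof.
have := gf_w gf; apply: contraNneq => l0; rewrite -sqrf_eq0 -(gf_square gf) l0.
have n0 : (0 < n)%N by have := gf_Q1 gf; have := gf_Qn gf; lia.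
by rewrite expr0n (gtn_eqF n0) mulr0 !mul0r.
Qed.

Lemma Qa_neq0 : Q.[a] != 0.
Proof.
have := gf_w gf; apply: contraNneq => l0; rewrite -sqrf_eq0 -(gf_square gf) l0.
by rewrite mulr0 mulr0 mul0r.
Qed.

Section Fixed.
Variables (s : nat) (p1 p2 : nat).
Hypotheses (s0 : (0 < s)%N) (p1_pr : prime p1) (p2_pr : prime p2).
Hypotheses (ex1 : exact_div p1 (c * (s ^ 2)%:Z - g1)) (ex2 : exact_div p2 (c * (s ^ 2)%:Z - g2)).
Hypotheses (p1Q : ~~ (p1 %| Q.[0])%Z) (p1A : ~~ (p1 %| A1.[0])%Z).
Hypotheses (p2Q : ~~ (p2 %| Q.[b])%Z) (p2A : ~~ (p2 %| A2.[b])%Z) (p2d : ~~ (p2 %| d)%Z).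
Hypothesis iso : isolated s.

(** A double root is a zero of the Wronskian, hence [0], [b] or [a], and the member vanishes at none
    of these. *)
Lemma fam_separable (x : algC) : root (map_poly intr (fam s)) x ->
  (map_poly intr (fam s)^`()).[x] != 0.
Proof.
move=> /rootP rx; apply/negP => /eqP dx.
have := congr1 (fun q : {poly int} => (map_poly intr q).[x]) (fam_ode s).
rewrite !(map_polyZ, rmorphB, rmorphM, rmorphXn, map_polyX, map_polyC, map_polyXn) /=.
rewrite hornerD hornerN hornerM [(_ * _).[x]]hornerM rx dx !mul0r subr0 => /esym/eqP.
rewrite !(map_polyX, map_polyC) /= hornerZ !(hornerM, horner_exp, hornerX, hornerXsubC).
rewrite !mulf_eq0 intr_eq0 (negPf lam_neq0) orbb /=.
have nzint (z : int) : (fam s).[z] != 0 -> x != z%:~R.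
  move=> nz; apply: contraNneq nz => xz; move: rx.
  by rewrite xz horner_map /= => /eqP; rewrite intr_eq0.
rewrite expf_eq0 !subr_eq0 => /orP[/orP[/andP[_]|]|]; apply/negP.
- rewrite -[0]/(0%:~R); apply: nzint; rewrite fam0 mulf_neq0 ?(gf_Q0 gf) //.
  exact: exact_div_neq0 ex1.
- apply: nzint; rewrite famb mulf_neq0 ?(gf_Qb gf) //; exact: exact_div_neq0 ex2.
- apply: nzint; rewrite fama !mulf_neq0 ?(gf_c gf) ?Qa_neq0 //.
  by rewrite eqz_nat expn_eq0 (gtn_eqF s0).
Qed.


Variables (N : splittingFieldType rat) (iota : {rmorphism N -> algC}) (alpha : 'I_n -> N).
Hypothesis alpha_inj : injective alpha.
Hypothesis fE : map_poly intr (fam s) = \prod_i ('X - (alpha i)%:P).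
Hypothesis gen_alpha : <<1 & codom alpha>>%VS = fullv.

Lemma fam_monic : fam s \is monic.
Proof. exact: (family_monic _ (gf_monic gf) (gf_size gf) (gf_Qn gf)). Qed.

Lemma fam_eval (z : int) : ((fam s).[z])%:~R = \prod_i (z%:~R - alpha i).
Proof. by rewrite -horner_map fE horner_prod; apply: eq_bigr => i _; rewrite hornerXsubC. Qed.

Lemma fam_eval_opp (z : int) : \prod_i (alpha i - z%:~R) = (-1) ^+ n * ((fam s).[z])%:~R.
Proof.
rewrite fam_eval -[X in (-1) ^+ X](card_ord n) -prodrN.
by apply: eq_bigr => i _; rewrite opprB.
Qed.

Lemma fam_norm : \prod_i (map_poly intr Q).[alpha i] = B%:~R.
Proof.
apply: (fmorph_inj iota); rewrite rmorph_prod rmorph_int.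
rewrite -(gf_norm gf (s := s) (alpha := iota \o alpha)).
  by apply: eq_bigr => i _; rewrite -horner_intr_rmorph.
rewrite -(map_intr_rmorph iota) fE rmorph_prod; apply: eq_bigr => i _.
by rewrite rmorphB /= map_polyX map_polyC.
Qed.

(* By [gf_ode], [disc f_s] is [(w s disc_root)^2 / B^2]. *)
Definition disc_root : int := (fam s).[0] ^+ e * (fam s).[b].

(** Multiply [fam_ode] over all roots. The left side becomes the discriminant, up to sign, times
    [B]; the right side becomes, up to sign, [lam ^+ n] times the square of [disc_root] times the
    value at [a], which is [c s^2 Q(a)]. The factors that are not visibly squares are those of
    [gf_square]. *)
Lemma fam_vdm : root_vdm alpha ^+ 2 * B%:~R ^+ 2 = (w * s%:Z * disc_root)%:~R ^+ 2.
Proof.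
have Eode i : (map_poly intr (fam s)^`()).[alpha i] * (map_poly intr Q).[alpha i] =
    lam%:~R * ((alpha i ^+ e * (alpha i - b%:~R)) ^+ 2 * (alpha i - a%:~R)).
  have fi : (map_poly intr (fam s)).[alpha i] = 0.
    by rewrite fE horner_prod (bigD1 i) //= hornerXsubC subrr mul0r.
  have := congr1 (fun q : {poly int} => (map_poly intr q).[alpha i]) (fam_ode s).
  rewrite !(map_polyZ, rmorphB, rmorphM, rmorphXn, map_polyX, map_polyC, map_polyXn) /=.
  rewrite hornerD hornerN hornerM [(map_poly intr (fam s) * _).[_]]hornerM fi mul0r subr0 => ->.
  by rewrite !(map_polyX, map_polyC) /= hornerZ !(hornerM, horner_exp, hornerX, hornerXsubC) expr2.
have Ed : \prod_i (map_poly intr (fam s)^`()).[alpha i] = (-1) ^+ 'C(n, 2) * root_vdm alpha ^+ 2.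
  rewrite -prod_offdiag_vdm; apply: eq_bigr => i _.
  rewrite -deriv_map fE (bigD1 i) //= derivM hornerD !hornerM hornerXsubC subrr mul0r addr0.
  by rewrite derivXsubC hornerC mul1r horner_prod; apply: eq_bigr => j _; rewrite hornerXsubC.
have E : (-1) ^+ 'C(n, 2) * root_vdm alpha ^+ 2 * B%:~R =
    lam%:~R ^+ n * (((-1) ^+ n * ((fam s).[0])%:~R) ^+ e * ((-1) ^+ n * ((fam s).[b])%:~R)) ^+ 2
    * ((-1) ^+ n * ((fam s).[a])%:~R).
  rewrite -Ed -fam_norm -big_split /= (eq_bigr _ (fun i _ => Eode i)) big_split /=.
  rewrite prodr_const card_ord -mulrA -!fam_eval_opp; congr (_ * _).
  rewrite big_split /= prodrXl big_split /= prodrXl; congr (((_ ^+ _) * _) ^+ _ * _).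
  by apply: eq_bigr => i _; rewrite subr0.
(* The second factor [B] is the one that [gf_square] asks for. *)
have -> : root_vdm alpha ^+ 2 * B%:~R ^+ 2 =
    (-1) ^+ 'C(n, 2) * B%:~R * ((-1) ^+ 'C(n, 2) * root_vdm alpha ^+ 2 * B%:~R) :> N.
  rewrite [RHS](_ : _ = ((-1) ^+ 'C(n, 2)) ^+ 2 * (root_vdm alpha ^+ 2 * B%:~R ^+ 2)); last by ring.
  by rewrite -exprM mulnC exprM sqrrN expr1n expr1n mul1r.
rewrite E fama /disc_root.
have sgn2 k : ((-1) ^+ k) ^+ 2 = 1 :> N by rewrite -exprM mulnC exprM sqrrN expr1n expr1n.
have Ew : ((-1) ^+ 'C(n, 2) * lam ^+ n * ((-1) ^+ n * c * Q.[a]) * B)%:~R = (w ^+ 2)%:~R :> N.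
  by rewrite (gf_square gf).
rewrite !(rmorphM, rmorphXn, rmorphN1) /= -?[w%:~R * w%:~R]expr2 in Ew.
rewrite !(rmorphM, rmorphXn) /= !exprMn -Ew.
have -> : ((((-1) ^+ n) ^+ e) ^+ 2 : N) = 1 by rewrite exprAC sgn2 expr1n.
rewrite sgn2; ring.
Qed.
End Fixed.
End PencilMember.

Section MemberGalois.
Variables (n : nat) (P Q : {poly int}) (c lam a b B w g1 g2 d : int) (e : nat).
Variables (A1 A2 U V : {poly int}).
Hypothesis gf : good_family n P Q c lam a b B w g1 g2 d e A1 A2 U V.
Local Notation fam := (family P Q c).
Variables (s : nat) (p1 p2 : nat).
Hypotheses (s0 : (0 < s)%N) (p1_pr : prime p1) (p2_pr : prime p2).
Hypotheses (ex1 : exact_div p1 (c * (s ^ 2)%:Z - g1)) (ex2 : exact_div p2 (c * (s ^ 2)%:Z - g2)).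
Hypotheses (p1Q : ~~ (p1 %| Q.[0%R])%Z) (p1A : ~~ (p1 %| A1.[0%R])%Z).
Hypotheses (p2Q : ~~ (p2 %| Q.[b])%Z) (p2A : ~~ (p2 %| A2.[b])%Z) (p2d : ~~ (p2 %| d)%Z).
Hypothesis iso : isolated n P Q c B e s.

Variables (N : splittingFieldType rat) (iota : {rmorphism N -> algC}) (alpha : 'I_n -> N).
Hypothesis alpha_inj : injective alpha.
Hypothesis fE : map_poly intr (fam s) = \prod_i ('X - (alpha i)%:P).
Hypothesis gen_alpha : <<1 & codom alpha>>%VS = fullv.
Local Notation G := 'Gal({:N} / 1)%g.
Local Notation rho := (root_perm alpha_inj fE).
Local Notation fm := (fam_monic gf s).

Let galN : galois 1 {:N}. Proof. exact: (roots_galois alpha_inj fE gen_alpha). Qed.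
Let aint i : algebraic_integer (alpha i). Proof. exact: (alpha_int fm fE). Qed.
Let rhoE t i : t \in G -> alpha (rho t i) = t (alpha i). Proof. by rewrite root_permE. Qed.

Lemma member_sub_Alt : (root_perm_morphism alpha_inj fE @* G \subset 'Alt_('I_n))%g.
Proof.
apply: (root_perm_Alt iota alpha_inj fE (q := (w * s%:Z * disc_root P Q c b e s)%:~R / B%:~R)).
have B0 : (B%:~R : N) ^+ 2 != 0.
  by rewrite expf_neq0 // -(fmorph_eq0 iota) rmorph_int intr_eq0 (gf_B gf).
apply: (mulIf B0); rewrite (fam_vdm gf iota fE).
rewrite -exprMn; congr (_ ^+ 2); rewrite -in_algE fmorph_div !rmorph_int divfK //.
by move: B0; rewrite expf_eq0.
Qed.

Lemma member_disc_le : `|iota (root_vdm alpha)| ^+ 2 <= ((w * s%:Z * disc_root P Q c b e s) ^+ 2)%:~R.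
Proof.
have := congr1 (fun x => `|iota x|) (fam_vdm gf iota fE).
rewrite rmorphM !rmorphXn !rmorph_int normrM !normrX => E.
have B1 : 1 <= `|(B%:~R : algC)| ^+ 2.
  rewrite exprn_ege1 // -intr_norm -[1]/(1%:~R) ler_int.
  by rewrite -gtz0_ge1 normr_gt0 (gf_B gf).
apply: (@le_trans _ _ (`|iota (root_vdm alpha)| ^+ 2 * `|B%:~R| ^+ 2)).
  by rewrite ler_peMr // exprn_ge0.
by rewrite E -normrX -rmorphXn /= ger0_norm // ler0z sqr_ge0.
Qed.

Definition stable (Om : {set 'I_n}) := forall t i, t \in G -> (rho t i \in Om) = (i \in Om).

(** The partial norms of [Q] over a stable set and over its complement are integers with product
    [B]. *)
Lemma stable_prod Om : stable Om -> exists2 z : int,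
  \prod_(i in Om) (map_poly intr Q).[alpha i] = z%:~R & (0 < absz z <= absz B)%N.
Proof.
move=> st; have [z Dz] := orbit_prod_int iota fm gen_alpha Q st.
have [z' Dz'] : exists z' : int, \prod_(i in ~: Om) (map_poly intr Q).[alpha i] = z'%:~R.
  apply: (orbit_prod_int iota fm gen_alpha Q (alpha_inj := alpha_inj) (fE := fE)) => t i Gt.
  by rewrite !inE st.
exists z => //; have E : z * z' = B.
  have EN : z%:~R * z'%:~R = B%:~R :> N.
    rewrite -(fam_norm gf iota fE) -Dz -Dz' [RHS](bigID (mem Om)) /=; congr (_ * _).
    by apply: eq_bigl => i; rewrite finset.in_setC.
  by apply: (@intr_inj algC); rewrite intrM -(rmorph_int iota z) -(rmorph_int iota z') -(rmorph_int iota B) -EN rmorphM.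
have := gf_B gf; rewrite -E abszM mulf_eq0 negb_or => /andP[z0 z'0].
by rewrite absz_gt0 z0 leq_pmulr // absz_gt0.
Qed.

(** [D] is the decomposition group of a maximal ideal above [p1], and [C1] the cluster at [0]:
    modulo [p1] the member is [X^(2e+1)] times [A1]. *)
Lemma member_cluster1 : exists (D : {group gal_of {:N}}) (C1 : {set 'I_n}),
  [/\ D \subset G, #|C1| = e.*2.+1,
      forall t, t \in D -> forall i, i \in C1 -> rho t i \in C1 &
      {in C1 &, forall i j, exists2 t, t \in D & rho t i = j}].
Proof.
have [m mm mp] := exists_max_ideal iota p1_pr.
exists (decomp_group m), (cluster m alpha 0).
have [k Ek nk] := exact_divM p1_pr ex1 p1Q.
have [k' Ek' _] := ex1.
split.
- exact: decomp_sub.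
- apply: (cluster_card mm p1_pr mp aint fE (g := A1) (h := k' *: Q)) => //.
  by rewrite polyC0 subr0 (fam_shift P Q c s g1) (gf_1 gf) Ek' scalerA.
- by move=> t Dt i Ci; rewrite (cluster_stable rhoE).
- apply: (cluster_trans iota galN mm p1_pr mp alpha_inj aint rhoE fE _ nk).
  by rewrite (fam0 gf) Ek.
Qed.

Lemma member_inertia : exists t (C2 : {set 'I_n}),
  [/\ t \in G, t != 1%g, #|C2| = 3 & forall i, i \notin C2 -> rho t i = i].
Proof.
have [m mm mp] := exists_max_ideal iota p2_pr.
have [k Ek nk] := exact_divM p2_pr ex2 p2Q.
have [k' Ek' _] := ex2.
have Ef : fam s = ('X - b%:P) ^+ 3 * A2 + p2%:Z *: (k' *: Q).
  by rewrite (fam_shift P Q c s g2) (gf_2 gf) Ek' scalerA.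
have fb : (fam s).[b] = p2%:Z * k by rewrite (famb gf) Ek.
have C3 : #|cluster m alpha b| = 3 by apply: (cluster_card mm p2_pr mp aint fE Ef).
have [|t [Gt t1 It]] := inertia_nontrivial iota galN mm p2_pr mp aint fE fb nk.
  by rewrite C3.
exists t, (cluster m alpha b); split=> // i.
exact: (inertia_fixes mm p2_pr mp aint rhoE fE Ef (gf_sep gf) p2d Gt It).
Qed.

Lemma stable_orbit i : stable [set rho t i | t in G].
Proof.
have aux t j : t \in G -> j \in [set rho t i | t in G] -> rho t j \in [set rho t i | t in G].
  move=> Gt /imsetP[r Gr ->]; apply/imsetP; exists (r * t)%g; first by rewrite groupM.
  by rewrite (root_permM alpha_inj fE Gr Gt) permM.
move=> t j Gt; apply/idP/idP; last exact: aux.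
have GtV : (t^-1)%g \in G by rewrite groupV.
move/(aux _ _ GtV); suff -> : rho (t^-1)%g (rho t j) = j by [].
by apply: alpha_inj; rewrite !rhoE // galVK.
Qed.

(** If the orbit of [i] were proper, it and its complement would each contain a root where [Q] is at
    most [|B|]. For odd [n], [isolated] identifies the two roots. For even [n], all roots but one
    form the cluster [C1], on which [D] is transitive, so one of the two stable sets is a single
    point; its root is a rational integer, which [isolated] excludes. *)
Lemma member_trans i j : exists2 t, t \in G & rho t i = j.
Proof.
set Om := [set rho t i | t in G]; have stOm : stable Om := stable_orbit i.
have stC : stable (~: Om) by move=> t l Gt; rewrite !inE stOm.
have iOm : i \in Om.
  by apply/imsetP; exists 1%g; rewrite ?group1 //; apply: alpha_inj; rewrite rhoE ?group1 // gal_id.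
have [/imsetP[t Gt ->]|jOm] := boolP (j \in Om); first by exists t.
exfalso; have jC : j \in ~: Om by rewrite inE.
have famroot l : root (map_poly intr (fam s)) (iota (alpha l)).
  by rewrite root_intr_rmorph /root fE horner_prod (bigD1 l) //= hornerXsubC subrr mul0r.
(* If [|Q|] exceeded [|B|] at all roots of a nonempty stable set, so would the product over the set,
   since [|B| >= 1], against [stable_prod]. *)
have small Om' l0 : stable Om' -> l0 \in Om' -> exists2 l, l \in Om' &
    `|(map_poly intr Q).[iota (alpha l)]| <= (absz B)%:R :> algC.
  move=> st Ol0; have [z Dz /andP[z0 zB]] := stable_prod st.
  apply: contrapT => nl.
  have big l : l \in Om' -> (absz B)%:R <= `|(map_poly intr Q).[iota (alpha l)]|.
    move=> Ol; case: real_leP; rewrite ?ger0_real ?ler0n ?normr_ge0 // => lt.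
    by case: nl; exists l => //; exact: ltW.
  have B1 : 1 <= (absz B)%:R :> algC by rewrite ler1n absz_gt0 (gf_B gf).
  have strict : (absz B)%:R < `|(map_poly intr Q).[iota (alpha l0)]|.
    rewrite real_ltNge ?ger0_real ?ler0n ?normr_ge0 //; apply/negP => le.
    by case: nl; exists l0.
  have : (absz B)%:R < `|iota z%:~R|.
    rewrite -Dz rmorph_prod normr_prod (bigD1 l0) //=.
    apply: lt_le_trans strict _; rewrite horner_intr_rmorph ler_peMr ?normr_ge0 //.
    elim/big_rec: _ => // l x /andP[Ol _] x1.
    rewrite -[1]mulr1 ler_pM ?ler01 //; apply: le_trans B1 _.
    by rewrite -horner_intr_rmorph big.
  rewrite rmorph_int -intr_norm -[X in _ < X]/(_%:~R) -abszE ltr_nat.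
  by rewrite ltnNge zB.
have [En|[En [r Er]]] := gf_par gf; last first.
  have [l Ol sl] := small _ _ stOm iOm; have [l' Cl' sl'] := small _ _ stC jC.
  have [_ /(_ En)/(_ _ _ (famroot l) (famroot l') sl sl')] := iso.
  by move=> /fmorph_inj/alpha_inj E; move: Cl'; rewrite -E inE Ol.
have [D [C1 [DG cC1 stC1 trC1]]] := member_cluster1.
have DG' t : t \in D -> t \in G by apply: (fintype.subsetP DG).
have cC : #|~: C1| = 1%N.
  by have := cardsC C1; rewrite cC1 card_ord; move: En; clear; lia.
have /eqP/cards1P[x Cx] := cC.
have C1x l : (l \in C1) = (l != x).
  by rewrite -[C1]finset.setCK Cx !inE.
(* an orbit meeting C1 contains it, so one of the two stable sets is [set x] *)
have only Om' : stable Om' -> x \in Om' -> (exists l, l \notin Om') -> Om' = [set x].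
  move=> st Ox [l nl]; apply/setP => y; rewrite inE; apply/idP/eqP => [Oy|->//].
  have lx : l != x by apply: contraNneq nl => ->.
  apply/eqP; apply: contraNT nl => yx.
  have yC : y \in C1 by rewrite C1x.
  have lC : l \in C1 by rewrite C1x.
  have [t Dt <-] := trC1 y l yC lC.
  by rewrite st ?DG'.
have st1 : stable [set x].
  have [xO|xO] := boolP (x \in Om).
    by rewrite -(only Om) //; exists j.
  rewrite -(only (~: Om)) ?inE //; by exists i; rewrite inE negbK.
have [z Dz] : exists z : int, alpha x = z%:~R.
  apply: (gal_fixed_int iota galN) => // t Gt.
  by rewrite -rhoE //; congr (alpha _); apply/set1P; rewrite st1 // inE.
have [y Dy /andP[_ yB]] := stable_prod st1.
have Ey : Q.[z] = y.
  apply: (@intr_inj algC); rewrite -(rmorph_int iota y) -Dy big_set1 Dz.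
  by rewrite horner_map rmorph_int.
have [/(_ En z) + _] := iso; apply; last by rewrite Ey.
by have := famroot x; rewrite Dz rmorph_int /root horner_map /= intr_eq0 => /eqP.
Qed.

Lemma member_Alt : (root_perm_morphism alpha_inj fE @* G = 'Alt_('I_n))%g.
Proof.
have [D [C1 [DG cC1 stC1 trC1]]] := member_cluster1.
have [t [C2 [Gt t1 cC2 fixC2]]] := member_inertia.
have mem_im r (A : {set gal_of {:N}}) : A \subset G -> r \in A ->
    rho r \in (root_perm_morphism alpha_inj fE @* A)%g.
  by move=> AG Ar; apply: mem_morphim => //; apply: (fintype.subsetP AG).
apply: (@eq_Alt_of_cluster _ (morphim_group _ _) (root_perm_morphism alpha_inj fE @* D)%G C1 C2 (rho t)).
- exact: member_sub_Alt.
- exact: morphimS.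
- by move=> i j; have [r Gr <-] := member_trans i j; exists (rho r) => //; apply: mem_im.
- exact: mem_im.
- apply: contraNneq t1 => E; rewrite -(morph_injm_eq1 (root_perm_injm alpha_inj fE gen_alpha)) //.
  by rewrite [X in X == _]E.
- exact: cC2.
- exact: fixC2.
- by move=> _ /morphimP[r _ Dr ->]; apply: stC1.
- move=> i j Ci Cj; have [r Dr <-] := trC1 i j Ci Cj; exists (rho r) => //; exact: mem_im.
- have := cardsC C1; rewrite cC1 card_ord.
  have [En|[En _]] := gf_par gf => Ec; first by left; move: En Ec; clear; lia.
  right; split; first by move: En Ec; clear; lia.
  by rewrite En /= odd_double.
Qed.

End MemberGalois.

Definition alternating_member (n : nat) (f : {poly int}) (D : int) : Prop :=
  exists (L : fieldExtType rat) (iota : {rmorphism L -> algC})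
         (tau : 'I_n -> {rmorphism L -> algC}),
  [/\ \dim {:L} = n, galois_group_permisom 'Alt_('I_n)%G L,
      exists2 r : rat, has_discriminant L r & ratr `|r| <= D%:~R :> algC,
      conj_datum iota tau & exists x : L, root (map_poly intr f) (iota x)].

Lemma poly_lipschitz (R : numFieldType) (p : {poly R}) (M : R) : 0 <= M ->
  exists2 K, 0 <= K & forall x y, `|x| <= M -> `|y| <= M -> `|p.[x] - p.[y]| <= K * `|x - y|.
Proof.
move=> M0; elim/poly_ind: p => [|p k [K K0 IH]].
  by exists 0 => // x y _ _; rewrite !horner0 subrr normr0 mul0r.
have [ub ubP] := poly_disk_bound p M.
have ub0 : 0 <= ub by apply: le_trans (ubP 0 _); rewrite ?normr0.
exists (ub + M * K) => [|x y xM yM]; first by rewrite addr_ge0 // mulr_ge0.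
rewrite !hornerMXaddC opprD addrACA subrr addr0.
have -> : p.[x] * x - p.[y] * y = p.[x] * (x - y) + y * (p.[x] - p.[y]).
  by rewrite !mulrBr [y * p.[x]]mulrC addrA subrK [y * _]mulrC.
apply: le_trans (ler_normD _ _) _; rewrite mulrDl lerD // normrM.
  by rewrite ler_wpM2r // ubP.
by rewrite -mulrA ler_pM // IH.
Qed.

Section GoodMember.
Variables (n : nat) (P Q : {poly int}) (c lam a b B w g1 g2 d : int) (e : nat).
Variables (A1 A2 U V : {poly int}).
Hypothesis gf : good_family n P Q c lam a b B w g1 g2 d e A1 A2 U V.
Local Notation fam := (family P Q c).

Lemma good_member (s p1 p2 : nat) : (0 < s)%N -> prime p1 -> prime p2 ->
    exact_div p1 (c * (s ^ 2)%:Z - g1) -> exact_div p2 (c * (s ^ 2)%:Z - g2) ->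
    ~~ (p1 %| Q.[0%R])%Z -> ~~ (p2 %| Q.[b])%Z -> ~~ (p2 %| A2.[b])%Z ->
    ~~ (p1 %| A1.[0%R])%Z -> ~~ (p2 %| d)%Z -> isolated n P Q c B e s ->
  alternating_member n (fam s) ((w * s%:Z * disc_root P Q c b e s) ^+ 2).
Proof.
move=> s0 p1_pr p2_pr ex1 ex2 p1Q p2Q p2A p1A p2d iso.
have n0 : (0 < n)%N by have := gf_Q1 gf; have := gf_Qn gf; clear; lia.
have [N [iota [alpha [ainj fE gen]]]] := splitting_data (fam_monic gf s)
  (size_family c (gf_size gf) (gf_Qn gf) s) (fam_separable gf s0 p1_pr p2_pr ex1 ex2).
have tr := member_trans gf p1_pr ex1 p1Q p1A iso iota ainj fE gen.
have imA := member_Alt gf p1_pr p2_pr ex1 ex2 p1Q p1A p2Q p2A p2d iso iota ainj fE gen.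
pose i0 := Ordinal n0; have fm := fam_monic gf s.
pose L := root_field alpha i0.
pose incl : {rmorphism L -> N} := (vsval : {rmorphism root_field alpha i0 -> N}).
exists L, (iota \o incl : {rmorphism L -> algC}).
exists (fun i => iota \o root_emb tr i0 i : {rmorphism L -> algC}); split.
- exact: (dim_root_field fm tr i0).
- exact: (root_permisom fm gen tr i0 imA).
- have [r hr le] := root_discriminant iota fm tr i0.
  by exists r => //; apply: le_trans le (member_disc_le gf iota fE).
- split; last by move=> x ix; apply: (root_emb_charpoly iota gen tr ix).
  exists i0 => x /=; congr (iota _).
  apply: (root_field_ext (g := root_emb tr i0 i0) (h := incl)).
  exact: (root_emb_gen tr i0 i0).
- exists (root_gen alpha i0); rewrite root_intr_rmorph -(root_intr_rmorph incl).
  by rewrite (root_fE fE); apply/existsP; exists i0.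
Qed.

Lemma good_divides_norm : divides_norm P Q c B.
Proof.
move=> s x rx.
have [rs Ers] := closed_field_poly_normal (map_poly intr (fam s) : {poly algC}).
have mfC : map_poly intr (fam s) \is @monic algC by rewrite monic_map // (fam_monic gf).
rewrite (monicP mfC) scale1r in Ers.
have srs : size rs = n.
  apply: succn_inj; rewrite -(size_family c (gf_size gf) (gf_Qn gf) s).
  rewrite -[RHS](size_map_inj_poly (f := intr : int -> algC)) ?rmorph0 //; last exact: intr_inj.
  by rewrite Ers size_prod_XsubC.
have Eal : map_poly intr (fam s) = \prod_(i < n) ('X - (rs`_i)%:P).
  by rewrite Ers (big_nth 0) srs big_mkord.
have [i Ei] : exists i : 'I_n, x = rs`_i.
  move: rx; rewrite Ers root_prod_XsubC => /(nthP 0)[k ks <-].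
  by rewrite srs in ks; exists (Ordinal ks).
exists (\prod_(j < n | j != i) (map_poly intr Q).[rs`_j]).
  apply: rpred_prod => j _; apply: rpred_horner.
    by apply/polyOverP => k; rewrite coef_map /= Aint_int.
  apply: (@root_monic_Aint (map_poly intr (fam s))) => //.
    by rewrite Eal /root horner_prod (bigD1 j) //= hornerXsubC subrr mul0r.
  by apply/polyOverP => k; rewrite coef_map /= rpred_int.
by rewrite -(gf_norm gf (s := s) (alpha := fun i : 'I_n => rs`_i)) // [RHS](bigD1 i) //= Ei.
Qed.

(** By [family_inj], a number at which [Q] does not vanish is a root of at most one member. *)
Lemma avoid_roots (Lst : seq algC) : exists smin, forall s, (smin <= s)%N ->
  forall x, x \in Lst -> (map_poly intr Q).[x] != 0 -> ~~ root (map_poly intr (fam s)) x.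
Proof.
elim: Lst => [|y r [smin IH]]; first by exists 0.
have [[s1 [r1 nz]]|no] := pselect (exists s1, root (map_poly intr (fam s1)) y /\ (map_poly intr Q).[y] != 0).
  exists (maxn smin s1.+1) => s; rewrite geq_max => /andP[ls l1] x.
  rewrite inE => /predU1P[->|xr] nzx; last exact: IH.
  apply/negP => rs; have := family_inj (gf_c gf) nz rs r1.
  by move=> E; rewrite E ltnn in l1.
exists smin => s ls x; rewrite inE => /predU1P[->|xr] nzx; last exact: IH.
by apply/negP => rs; apply: no; exists s.
Qed.

(** For even [n], the integers where [|Q|] is at most [|B|] belong to a finite list, avoided by all
    large members. For odd [n], [Q] is [X - r], so two roots [x], [y] as in [isolated] lie in a
    fixed disk, and subtracting their equations gives [P(x) - P(y) = - c s^2 (x - y)]; for large [s]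
    this contradicts the Lipschitz bound of [P] unless [x = y]. *)
Lemma eventually_isolated : exists smin, forall s, (smin <= s)%N -> isolated n P Q c B e s.
Proof.
have [En|[En [r Er]]] := gf_par gf.
  pose rts (p : {poly algC}) := sval (closed_field_poly_normal p).
  (* The solutions of [Q(x) = z] for the integers [z] from [-|B|] to [|B|]; the index [t] is
     [z + |B|]. *)
  pose Lst := flatten [seq rts (map_poly intr Q - ((t : nat)%:Z - `|B|)%:~R%:P) | t <- iota 0 (absz B + absz B).+1].
  have [smin H] := avoid_roots Lst.
  exists (maxn smin 1) => s; rewrite geq_max => /andP[ls s0]; split; last first.
    by rewrite En => /eqP; rewrite eqn_leq ltnn andbF.
  move=> _ x fx Qx.
  have rx : root (map_poly intr (fam s)) (x%:~R : algC) by rewrite /root horner_map /= fx.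
  have Qx0 : (map_poly intr Q).[x%:~R : algC] != 0.
    have [y _ E] := good_divides_norm rx; apply: contraNneq (gf_B gf) => Q0.
    by rewrite -(intr_eq0 algC) -E Q0 mul0r.
  suff xL : x%:~R \in Lst by have := H s ls _ xL Qx0; rewrite rx.
  apply/flatten_mapP; exists (absz (Q.[x] + `|B|)).
    rewrite mem_iota; move: Qx; clear; lia.
  rewrite gez0_abs; last by move: Qx; clear; lia.
  rewrite addrK /rts; case: closed_field_poly_normal => rs /= Ers.
  have : root (map_poly intr Q - (Q.[x])%:~R%:P) (x%:~R : algC).
    by rewrite /root hornerD hornerN hornerC horner_map subrr.
  have sizeQC : size (map_poly intr Q : {poly algC}) = size Q.
    by apply: size_map_inj_poly; [exact: intr_inj | rewrite rmorph0].
  have szz (z : algC) : size (map_poly intr Q - z%:P) = size Q.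
    rewrite size_polyDl sizeQC // size_polyN size_polyC.
    exact: leq_ltn_trans (leq_b1 _) (gf_Q1 gf).
  rewrite Ers rootZ ?root_prod_XsubC // lead_coef_eq0 -size_poly_gt0 szz.
  exact: ltnW (gf_Q1 gf).
have QE (x : algC) : (map_poly intr Q).[x] = x - r%:~R.
  by rewrite Er rmorphB /= map_polyX map_polyC hornerXsubC.
pose M : algC := (absz r + absz B)%:R.
have [K K0 KP] := poly_lipschitz (map_poly intr P) (ler0n _ _ : 0 <= M).
have Ktr := truncn_itv K0.
exists (Num.truncn K).+1 => s ls; split.
  by rewrite En => /eqP; rewrite eqn_leq ltnn.
move=> _ x y rx ry; rewrite !QE => xB yB; apply/eqP/negPn/negP => xy.
have leM z : `|z - r%:~R| <= (absz B)%:R :> algC -> `|z| <= M.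
  move=> zB; rewrite -[z](subrK r%:~R); apply: le_trans (ler_normD _ _) _.
  by rewrite /M natrD addrC lerD // -intr_norm -abszE.
move: rx ry; rewrite /root !fam_horner !QE => /eqP Ex /eqP Ey.
have Exy : (map_poly intr P).[x] - (map_poly intr P).[y] = - ((c * (s ^ 2)%:Z)%:~R * (x - y)).
  apply/eqP; rewrite -subr_eq0; apply/eqP.
  rewrite -[RHS](subrr (0 : algC)) -{1}Ex -Ey; ring.
have := KP x y (leM x xB) (leM y yB); rewrite Exy normrN normrM.
rewrite ler_pM2r ?normr_gt0 ?subr_eq0 // => leK.
have : (s%:R : algC) <= K.
  apply: le_trans leK; rewrite -intr_norm pmulrn ler_int normrM.
  rewrite (_ : s%:Z = 1 * s%:Z) ?mul1r // -[s%:Z]mul1r ler_pM //.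
    by rewrite -gtz0_ge1 normr_gt0 (gf_c gf).
  by rewrite ger0_norm // lez_nat expnS leq_pmulr // expn_gt0; case: (s) ls.
move/le_truncn; rewrite natrK => le; by have := leq_trans ls le; rewrite ltnn.
Qed.

End GoodMember.

(** * Counting fields *)

Lemma leq_abszD (x y : int) : (absz (x + y)%R <= `|x| + `|y|)%N.
Proof. by lia. Qed.

Lemma exact_div_mod (p s s0 : nat) (c g : int) : prime p ->
  exact_div p (c * (s0 ^ 2)%:Z - g) -> s = s0 %[mod p ^ 2] -> exact_div p (c * (s ^ 2)%:Z - g).
Proof.
move=> p_pr [k Ek nk] Es.
have /dvdzP[t Et] : ((p ^ 2)%:Z %| s%:Z - s0%:Z)%Z.
  by rewrite -eqz_mod_dvd !modz_nat Es.
pose y := c * t * (s%:Z + s0%:Z).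
exists (k + p%:Z * y).
  have -> : c * (s ^ 2)%:Z - g = (c * (s0 ^ 2)%:Z - g) + c * ((s%:Z - s0%:Z) * (s%:Z + s0%:Z)).
    by rewrite !PoszM; ring.
  by rewrite Ek Et PoszM /y; ring.
by rewrite rpredDr // dvdz_mulr.
Qed.

Lemma exists_exact_prime (c g : int) (K : nat) : c != 0 -> g != 0 ->
  exists p s0, [/\ prime p, (K < p)%N & exact_div p (c * (s0 ^ 2)%:Z - g)].
Proof.
(* [K1] is chosen so that a prime above it exceeds [K] and divides none of [2], [c] and [g]. *)
move=> c0 g0; pose K1 := (K + `|c| + `|g|).+2%N.
pose m := (K1`! * `|g|)%N.
(* c m^2 - g = g (c g (K1!)^2 - 1), and the cofactor is prime to K1! *)
pose z := c * g * (K1`! ^ 2)%:Z - 1.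
have Ez : c * (m ^ 2)%:Z - g = g * z.
  rewrite /m expnMn PoszM /z mulrBr mulr1; congr (_ - _).
  have -> : (`|g| ^ 2)%N%:Z = g ^+ 2 by rewrite -abszX abszE ger0_norm ?sqr_ge0.
  by ring.
have K1_gt : (2 < K1`!)%N.
  by apply: leq_trans (fact_geq _); rewrite /K1 !ltnS addn_gt0 absz_gt0 g0 orbT.
have z1 : (1 < absz z)%N.
  have : (9 <= absz (c * g * (K1`! ^ 2)%:Z)%R)%N.
    rewrite !abszM /= -[9%N]mul1n leq_mul ?muln_gt0 ?absz_gt0 ?c0 //.
    by rewrite (@leq_exp2r 3 _ 2).
  by rewrite /z; move: (c * g * _)%R; clear; lia.
pose p := pdiv (absz z); have p_pr : prime p by apply: pdiv_prime.
have pz : (p %| z)%Z by rewrite dvdzE; apply: pdiv_dvd.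
have pK : (K1 < p)%N.
  rewrite ltnNge; apply/negP => pK1; have pf : (p %| K1`!)%N by rewrite dvdn_fact // prime_gt0.
  have : (p %| 1)%Z.
    have -> : 1%:Z = c * g * (K1`! ^ 2)%:Z - z by rewrite /z; ring.
    by rewrite rpredB // dvdz_mull // dvdzE /= dvdn_exp.
  by rewrite dvdz1 /= => /eqP p1; rewrite p1 in p_pr.
have np (x : int) : x != 0 -> (absz x < p)%N -> ~~ (p %| x)%Z.
  by move=> x0 xp; rewrite dvdzE /= gtnNdvd // absz_gt0.
have pg : ~~ (p %| g)%Z by apply: np => //; move: pK; rewrite /K1; clear; lia.
have pc : ~~ (p %| c)%Z by apply: np => //; move: pK; rewrite /K1; clear; lia.
have p2 : (2 < p)%N by move: pK; rewrite /K1; clear; lia.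
have pM (x y : int) : (p %| x * y)%Z = (p %| x)%Z || (p %| y)%Z.
  by rewrite !dvdzE abszM Euclid_dvdM.
have pv : (p %| c * (m ^ 2)%:Z - g)%Z by rewrite Ez dvdz_mull.
have pm : ~~ (p %| m%:Z)%Z.
  apply: contra pg => pm.
  have -> : g = c * (m ^ 2)%:Z - (c * (m ^ 2)%:Z - g) by ring.
  by rewrite rpredB // dvdz_mull // PoszM dvdz_mulr.
have Kp : (K < p)%N by move: pK; rewrite /K1; clear; lia.
have p0 : p%:Z != 0 by rewrite eqz_nat -lt0n prime_gt0.
have /dvdzP[k Ek] := pv; have [pk|npk] := boolP (p %| k)%Z; last first.
  by exists p, m; split=> //; exists k; rewrite // Ek mulrC.
(* If the square of [p] divides the value at [m], pass to [m + p]: the value changes by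
   [p c (2m + p)], and [p] does not divide [2 c m]. *)
exists p, (m + p)%N; split=> //; exists (k + c * (2%:Z * m%:Z + p%:Z)).
  have -> : c * ((m + p) ^ 2)%:Z - g = (c * (m ^ 2)%:Z - g) + p%:Z * (c * (2%:Z * m%:Z + p%:Z)).
    by move: (m) (p) => m1 p1; rewrite -!mulnn !PoszM !PoszD; ring.
  by rewrite Ek; ring.
rewrite rpredDl // pM negb_or pc /=.
rewrite rpredDr ?dvdzz // pM negb_or pm andbT.
by rewrite dvdzE /= gtnNdvd.
Qed.

(** Cauchy's bound: if [|x| > 1], solve the equation for [x^m] and divide by [x^(m-1)]. *)
Lemma monic_root_le (R : numDomainType) (p : {poly R}) m (x : R) : p \is monic -> size p = m.+1 ->
  root p x -> `|x| <= 1 + \sum_(i < m) `|p`_i|.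
Proof.
move=> mp sp /rootP px; have S0 : 0 <= \sum_(i < m) `|p`_i| by apply: sumr_ge0.
have [x1|x1] := real_leP (normr_real x) (real1 R); first by rewrite (le_trans x1) // lerDl.
have xm0 : 0 < `|x| ^+ m.-1 by rewrite exprn_gt0 // (lt_trans ltr01).
apply: (@le_trans _ _ (\sum_(i < m) `|p`_i|)); last by rewrite lerDr.
move: px; rewrite horner_coef sp big_ord_recr /=.
have -> : p`_m = 1 by rewrite -(monicP mp) lead_coefE sp.
rewrite mul1r => /eqP; rewrite addrC addr_eq0 => /eqP xm.
have m0 : (0 < m)%N.
  by case: (m) xm => //; rewrite big_ord0 expr0 oppr0 => /eqP; rewrite oner_eq0.
rewrite -(ler_pM2r xm0) -exprS prednK //  -[leLHS]normrX xm normrN mulr_suml.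
apply: le_trans (ler_norm_sum _ _ _) _; apply: ler_sum => i _.
rewrite normrM ler_wpM2l // normrX ler_weXn2l ?(ltW x1) //.
by rewrite -ltnS prednK.
Qed.

Section GoodPencil.
Variables (n : nat) (P Q : {poly int}) (c lam a b B w g1 g2 d : int) (e : nat).
Variables (A1 A2 U V : {poly int}).
Hypothesis gf : good_family n P Q c lam a b B w g1 g2 d e A1 A2 U V.
Hypothesis n3 : (3 <= n)%N.
Local Notation fam := (family P Q c).

Lemma good_progression : exists M s1, [/\ (0 < M)%N, (0 < s1)%N & forall j,
  alternating_member n (fam (s1 + M * j)) ((w * (s1 + M * j)%:Z * disc_root P Q c b e (s1 + M * j)) ^+ 2)].
Proof.
pose K := (`|Q.[0%R]| + `|Q.[b]| + `|A2.[b]| + `|A1.[0%R]| + `|d|)%N.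
have [p1 [t1 [p1_pr Kp1 ex1]]] := exists_exact_prime K (gf_c gf) (gf_g1 gf).
(* Taking [p2] beyond [p1] makes the moduli coprime. *)
have [p2 [t2 [p2_pr Kp2 ex2]]] := exists_exact_prime (K + p1) (gf_c gf) (gf_g2 gf).
have [K1 K2 K3 K4 K5] : [/\ absz Q.[0%R] <= K, absz Q.[b] <= K, absz A2.[b] <= K, absz A1.[0%R] <= K & absz d <= K]%N.
  rewrite /K; move: (absz Q.[0%R]) (absz Q.[b]) (absz A2.[b]) (absz A1.[0%R]) (absz d) => k1 k2 k3 k4 k5.
  by clear; split; lia.
have np p (x : int) : (K < p)%N -> x != 0 -> (absz x <= K)%N -> ~~ (p %| x)%Z.
  by move=> Kp x0 xK; rewrite dvdzE /= gtnNdvd // ?absz_gt0 //; apply: leq_ltn_trans xK Kp.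
have Kp2' : (K < p2)%N by apply: leq_ltn_trans Kp2; rewrite leq_addr.
have cop : coprime (p1 ^ 2) (p2 ^ 2).
  rewrite coprimeXl // coprimeXr // prime_coprime // dvdn_prime2 //.
  by rewrite neq_ltn (leq_ltn_trans _ Kp2) // leq_addl.
have [smin iso] := eventually_isolated gf.
pose M := (p1 ^ 2 * p2 ^ 2)%N.
have M0 : (0 < M)%N by rewrite muln_gt0 !expn_gt0 !prime_gt0.
(* The added multiple of [M] puts the whole progression beyond [smin] and makes it positive. *)
pose s1 := (chinese (p1 ^ 2) (p2 ^ 2) t1 t2 + M * smin.+1)%N.
exists M, s1; split=> //; first by rewrite /s1 addn_gt0 muln_gt0 M0 orbT.
move=> j; set s := (s1 + M * j)%N.
have Es : s = (chinese (p1 ^ 2) (p2 ^ 2) t1 t2 + M * (smin.+1 + j))%N.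
  by rewrite /s /s1 -addnA -mulnDr.
have E1 : s = t1 %[mod p1 ^ 2].
  by rewrite Es /M -mulnA addnC mulnC modnMDl chinese_modl.
have E2 : s = t2 %[mod p2 ^ 2].
  by rewrite Es /M -mulnA mulnCA addnC mulnC modnMDl chinese_modr.
have smin_s : (smin <= s)%N.
  rewrite Es; apply: leq_trans (leq_addl _ _); apply: (@leq_trans (smin.+1 + j)%N).
    by rewrite addSn ltnW // ltnS leq_addr.
  by rewrite leq_pmull.
apply: (good_member gf (p1 := p1) (p2 := p2)) => //.
- by apply: leq_trans _ (leq_addr _ _); rewrite addn_gt0 muln_gt0 M0 orbT.
- exact: exact_div_mod ex1 E1.
- exact: exact_div_mod ex2 E2.
- exact: np (gf_Q0 gf) _.
- exact: np (gf_Qb gf) _.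
- exact: np (gf_A2 gf) _.
- exact: np (gf_A1 gf) _.
- exact: np (gf_d gf) _.
- exact: iso.
Qed.

(** The quantity squared has order [s^(2e+3)], and [4e + 6 <= 4n - 4] for both relations between [n]
    and [e], since [n >= 3]. *)
Lemma disc_root_le : exists C : nat, forall s, (0 < s)%N ->
  (absz ((w * s%:Z * disc_root P Q c b e s) ^+ 2) <= C * s ^ (4 * n - 4))%N.
Proof.
pose C0 := ((`|c| + `|g1|) * `|Q.[0%R]|)%N; pose Cb := ((`|c| + `|g2|) * `|Q.[b]|)%N.
exists ((`|w| * (C0 ^ e * Cb)) ^ 2)%N => s s0.
have h g : (absz (c * (s ^ 2)%:Z - g)%R <= (`|c| + `|g|) * s ^ 2)%N.
  apply: (@leq_trans (`|c| * s ^ 2 + `|g|)%N); first by rewrite -[`|g|%N]abszN -[(s ^ 2)%N]/(absz (s ^ 2)%:Z) -abszM leq_abszD.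
  by rewrite mulnDl leq_add2l leq_pmulr // expn_gt0 s0.
rewrite /disc_root (fam0 gf) (famb gf) abszX.
apply: (@leq_trans ((`|w| * s * ((C0 * s ^ 2) ^ e * (Cb * s ^ 2))) ^ 2)%N).
  rewrite leq_exp2r // !abszM abszX abszM /= leq_mul // leq_mul //.
    by case: (e) => [|e']; rewrite ?expn0 // leq_exp2r // /C0 mulnAC leq_mul.
  by rewrite /Cb mulnAC leq_mul.
have -> : (`|w| * s * ((C0 * s ^ 2) ^ e * (Cb * s ^ 2)) = (`|w| * (C0 ^ e * Cb)) * s ^ (e.*2 + 3))%N.
  by rewrite expnMn -expnM mul2n !expnD; ring.
rewrite expnMn leq_mul // -expnM leq_pexp2l //.
by case: (gf_par gf) n3 => [->|[-> _]]; clear; lia.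
Qed.

(** [monic_root_le] bounds the root by a multiple of [s^2], hence [Q] by a power of [s]. Only the
    logarithm of this bound enters the size of a fibre. *)
Lemma root_bound : exists C k : nat, (0 < C)%N /\ forall s (x : algC), (0 < s)%N ->
  root (map_poly intr (fam s)) x -> `|(map_poly intr Q).[x]| <= (C * s ^ k)%:R.
Proof.
pose H := (1 + \sum_(i < n) (absz (P`_i)%R + `|c| * absz (Q`_i)%R))%N.
pose S := (\sum_(i < size Q) absz (Q`_i)%R)%N.
exists (S.+1 * H ^ n)%N, (2 * n)%N; split; first by rewrite muln_gt0 expn_gt0.
move=> s x s0 rx.
have H1 : 1 <= (H * s ^ 2)%:R :> algC.
  by rewrite ler1n muln_gt0 expn_gt0 s0.
have xH : `|x| <= (H * s ^ 2)%:R.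
  have mfC : map_poly intr (fam s) \is @monic algC by rewrite monic_map // (fam_monic gf).
  have sfC : size (map_poly intr (fam s) : {poly algC}) = n.+1.
    rewrite -(size_family c (gf_size gf) (gf_Qn gf) s).
    by apply: size_map_inj_poly; [exact: intr_inj | rewrite rmorph0].
  apply: le_trans (monic_root_le mfC sfC rx) _.
  rewrite /H mulnDl mul1n natrD lerD ?ler1n ?expn_gt0 ?s0 // big_distrl natr_sum.
  apply: ler_sum => i _; rewrite coef_map /= -intr_norm -abszE -pmulrn ler_nat.
  rewrite coefD coefZ mulnDl.
  apply: (@leq_trans (absz (P`_i)%R + absz (c * (s ^ 2)%:Z * Q`_i)%R)%N); first exact: leq_abszD.
  rewrite !abszM /= leq_add //; first by rewrite leq_pmulr // expn_gt0 s0.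
  by rewrite mulnAC.
rewrite horner_coef; apply: le_trans (ler_norm_sum _ _ _) _.
have -> : size (map_poly intr Q : {poly algC}) = size Q.
  by apply: size_map_inj_poly; [exact: intr_inj | rewrite rmorph0].
apply: (@le_trans _ _ (\sum_(i < size Q) (absz (Q`_i)%R * (H * s ^ 2) ^ n)%N%:R)).
  apply: ler_sum => i _; rewrite natrM coef_map normrM /= -intr_norm -abszE -pmulrn.
  rewrite ler_wpM2l ?ler0n // normrX natrX.
  apply: (@le_trans _ _ ((H * s ^ 2)%:R ^+ i)); first by rewrite lerXn2r ?nnegrE ?ler0n.
  by rewrite ler_weXn2l // ltnW // (leq_trans (ltn_ord i) (gf_Qn gf)).
rewrite -natr_sum ler_nat -big_distrl /= -/S expnMn -expnM mulnA.
by rewrite leq_mul // leq_mul // leqnSn.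
Qed.
End GoodPencil.

From mathcomp Require Import cardinality reals constructive_ereal measure exp.

Lemma size_le_undup_fibres (A B : eqType) (f : A -> B) (s : seq A) m :
  (forall a, a \in s -> (count (fun a' => f a' == f a) s <= m)%N) ->
  (size s <= size (undup (map f s)) * m)%N.
Proof.
move=> h.
have E l r : uniq l -> {subset map f r <= l} -> size r = (\sum_(t <- l) count (fun a => f a == t) r)%N.
  move=> ul; elim: r => [|a r IH] sub /=; first by rewrite big1.
  rewrite big_split /= -IH => [|t tr]; last by apply: sub; rewrite inE tr orbT.
  rewrite -[LHS]add1n; congr (_ + _)%N; rewrite (bigD1_seq (f a)) ?sub ?inE ?eqxx //=.
  by rewrite big1 // => t; rewrite eq_sym => /negPf->.
rewrite (E _ s (undup_uniq (map f s))) => [|t]; last by rewrite mem_undup.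
rewrite -sum1_size big_distrl /= big_seq [X in (_ <= X)%N]big_seq.
by apply: leq_sum => t; rewrite mem_undup mul1n => /mapP[a sa ->]; apply: h.
Qed.

Lemma counting_ge (T : choiceType) (R : realType) (A : set T) (s : seq T) : uniq s ->
  (forall x, x \in s -> A x) -> ((size s)%:R%:E <= counting A :> \bar R)%E.
Proof.
move=> us sA; rewrite /counting; case: asboolP => fA; last by rewrite leey.
rewrite lee_fin ler_nat; apply: uniq_leq_size => // x /sA Ax.
by rewrite in_fset_set // inE.
Qed.

Section Count.
Variables (n : nat) (P Q : {poly int}) (c lam a b B w g1 g2 d : int) (e : nat).
Variables (A1 A2 U V : {poly int}).
Hypothesis gf : good_family n P Q c lam a b B w g1 g2 d e A1 A2 U V.
Hypothesis n3 : (3 <= n)%N.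
Local Notation fam := (family P Q c).

(** Fields are compared as subfields of [algC]. Hence the root attached to one index lies in the
    range of the embedding chosen for any other index with the same field, so the roots of a fibre
    come from one [L], as [fibre_bound] requires. *)
Lemma Zfields_lower (R : realType) : exists C1 C2 C3 k : nat, forall (X : R) J, (0 < J)%N ->
  (C1 * J ^ (4 * n - 4))%:R <= X -> exists F : seq (set algC),
  [/\ uniq F, forall K, K \in F -> Zfields 'Alt_('I_n)%G X K &
      (J <= size F * ((trunc_log 2 (C2 * J ^ k)).+1 ^ n * C3))%N].
Proof.
have [M [s1 [M0 s10 prog]]] := good_progression gf.
have [C1 C1P] := disc_root_le gf n3.
have [Cq [k [Cq0 QP]]] := root_bound gf.
have [C3 C3P] := fibre_bound (gf_c gf) (gf_monic gf) (gf_size gf) (gf_Q1 gf) (gf_Qn gf) (gf_B gf) (good_divides_norm gf).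
pose sj j := (s1 + M * j)%N; pose H := (s1 + M)%N.
have sj0 j : (0 < sj j)%N by rewrite addn_gt0 s10.
have sjH J j : (j < J)%N -> (sj j <= H * J)%N.
  move=> jJ; rewrite mulnDl leq_add // ?leq_mul2l ?(ltnW jJ) ?orbT //.
  by rewrite leq_pmulr // (leq_ltn_trans _ jJ).
exists (C1 * H ^ (4 * n - 4))%N, ((Cq * H ^ k) ^ n.+1)%N, C3, (k * n.+1)%N => X J J0 XJ.
(* The choice runs over all [j], but the discriminant bound is available only for [j < J]; hence the
   disjunction. *)
have /choice[K KP] j : exists K : set algC, exists (L : fieldExtType rat) (iota : {rmorphism L -> algC})
    (tau : 'I_n -> {rmorphism L -> algC}), [/\ K = range iota, Zfields 'Alt_('I_n)%G X K \/ (J <= j)%N,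
      conj_datum iota tau & exists x : L, root (map_poly intr (fam (sj j))) (iota x)].
  have [L [iota0 [tau [dL gL [r hr leD] cd rx]]]] := prog j.
  exists (range iota0), L, iota0, tau; split=> //.
  have [jJ|] := ltnP j J; [left | by right].
  exists L, iota0; split=> //; exists r => //.
  set D := (_ ^+ 2) in leD.
  have rD : `|r| <= D%:~R by rewrite -(ler_rat algC) ratr_int.
  apply: (@le_trans _ _ (ratr D%:~R)); first by rewrite ler_rat.
  rewrite ratr_int; apply: le_trans XJ; rewrite pmulrn ler_int.
  rewrite -[D]gez0_abs ?sqr_ge0 // lez_nat.
  apply: leq_trans (C1P _ (sj0 j)) _; rewrite -mulnA leq_mul2l -expnMn; apply/orP; right.
  by rewrite leq_exp2r ?sjH //; move: n3; clear; lia.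
pose F := undup [seq K j | j <- iota 0 J].
exists F; split; first exact: undup_uniq.
- move=> K0; rewrite mem_undup => /mapP[j]; rewrite mem_iota add0n => /= jJ -> {K0}.
  by have [L [iota0 [tau [_ [//|Jj] _ _]]]] := KP j; rewrite leqNgt jJ in Jj.
rewrite -{1}(size_iota 0 J); apply: size_le_undup_fibres => j0 _.
rewrite -size_filter; set s := seq.filter _ _.
have [L [iota0 [tau [EK _ cd _]]]] := KP j0.
rewrite -(size_map sj).
have -> : ((Cq * H ^ k) ^ n.+1 * J ^ (k * n.+1) = (Cq * (H * J) ^ k) ^ n.+1)%N.
  by rewrite expnM -expnMn -mulnA -expnMn.
apply: (C3P _ _ _ iota0 tau cd).
- rewrite map_inj_uniq ?filter_uniq ?iota_uniq // => i j /addnI/eqP.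
  by rewrite eqn_mul2l eqn0Ngt M0 => /eqP.
- by rewrite muln_gt0 Cq0 expn_gt0 muln_gt0 J0 addn_gt0 M0 orbT.
- move=> _ /mapP[j js ->]; have KK : K j = K j0 by move: js; rewrite mem_filter => /andP[/eqP].
  have [L1 [iota1 [tau1 [EK1 _ _ [x rx]]]]] := KP j.
  have [y _ Ey] : range iota0 (iota1 x) by rewrite -EK -KK EK1; exists x.
  by exists y; rewrite Ey.
- move=> _ x /mapP[j js ->] rx; have jJ : (j < J)%N by move: js; rewrite mem_filter mem_iota => /andP[].
  apply: le_trans (QP _ _ (sj0 j) rx) _; rewrite ler_nat leq_mul2l.
  by apply/orP; right; case: (k) => [|k']; rewrite ?expn0 // leq_exp2r ?sjH.
Qed.
End Count.

(** * Explicit pencils *)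

(** A common factor of positive degree would have a complex root, common to [p] and its derivative.
    Over the integers, the Bezout relation for coprime polynomials ends in a nonzero constant
    [d]. *)
Lemma int_separable_bezout (p : {poly int}) :
  (forall y : algC, root (map_poly intr p) y -> ~~ root (map_poly intr p^`()) y) -> p != 0 ->
  exists U V (d : int), U * p + V * p^`() = d%:P /\ d != 0.
Proof.
move=> sep p0.
have : coprimep p p^`().
  rewrite /coprimep; set g := gcdp _ _; apply/negPn/negP => g1.
  have g0 : g != 0 by rewrite gcdp_eq0 negb_and p0.
  have sg : size (map_poly intr g : {poly algC}) = size g.
    by apply: size_map_inj_poly; [exact: intr_inj | rewrite rmorph0].
  have /closed_rootP[y ry] : size (map_poly intr g : {poly algC}) != 1%N by rewrite sg.
  have dv (q : {poly int}) : g %| q -> root (map_poly intr q : {poly algC}) y.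
    case/Pdiv.Idomain.dvdpP => [[k r] /= k0 E].
    have := congr1 (map_poly (intr : int -> algC)) E.
    rewrite map_polyZ rmorphM /= => /(congr1 (fun q => q.[y])).
    rewrite hornerZ hornerM (rootP ry) mulr0 => /eqP.
    by rewrite mulf_eq0 intr_eq0 (negPf k0).
  by have := sep y (dv _ (dvdp_gcdl _ _)); rewrite dv // dvdp_gcdr.
case/Bezout_coprimepP => [[U V]] /=; rewrite -size_poly_eq1 => /size_poly1P[d d0 E].
by exists U, V, d.
Qed.

Section TripleRoot.
Variables (f Q G : {poly int}) (b : int).
Hypotheses (ode : f^`() * Q - f * Q^`() = ('X - b%:P) ^+ 2 * G) (fb : f.[b] = 0) (Qb : Q.[b] != 0).

(** As [f] vanishes at [b] and [Q] does not, [f] vanishes there to one order more than the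
    Wronskian. Each division by [X - b] leaves a relation of the same kind; the last one gives the
    value of the cofactor, which later shows that it is nonzero. *)
Lemma triple_root : exists A, f = ('X - b%:P) ^+ 3 * A /\ 3%:R * A.[b] * Q.[b] = G.[b].
Proof.
have X0 : 'X - b%:P != 0 :> {poly int} by rewrite polyXsubC_eq0.
have dX : ('X - b%:P)^`() = 1 :> {poly int} by rewrite derivXsubC.
have root_fact (h : {poly int}) : h.[b] = 0 -> exists h', h = ('X - b%:P) * h'.
  by move=> /rootP/factor_theorem[h' ->]; exists h'; rewrite mulrC.
have [h Ef] := root_fact f fb; move: ode; rewrite Ef derivM dX mul1r => ode1.
have E1 : h * Q = ('X - b%:P) * (('X - b%:P) * G - h^`() * Q + h * Q^`()).
  apply/eqP; rewrite -subr_eq0; move: ode1 => /eqP; rewrite -subr_eq0 => /eqP <-; apply/eqP; ring.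
have hb : h.[b] = 0.
  have := congr1 (fun q => q.[b]) E1; rewrite !hornerM hornerXsubC subrr mul0r => /eqP.
  by rewrite mulf_eq0 (negPf Qb) orbF => /eqP.
have [h2 Eh] := root_fact h hb; move: ode1; rewrite Eh derivM dX mul1r => ode2.
have E2 : 2%:R * h2 * Q = ('X - b%:P) * (G - h2^`() * Q + h2 * Q^`()).
  apply: (mulfI X0); apply/eqP; rewrite -subr_eq0; move: ode2 => /eqP; rewrite -subr_eq0 => /eqP <-; apply/eqP; ring.
have h2b : h2.[b] = 0.
  have := congr1 (fun q => q.[b]) E2; rewrite !hornerM hornerXsubC subrr mul0r => /eqP.
  by rewrite -polyC_natr hornerC !mulf_eq0 (negPf Qb) orbF => /eqP.
have [A EA] := root_fact h2 h2b.
move: ode2; rewrite EA derivM dX mul1r => ode3.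
exists A; split; first by ring.
have E3 : 3%:R * A * Q = G - ('X - b%:P) * (A^`() * Q - A * Q^`()).
  apply: (mulfI (expf_neq0 2 X0)); apply/eqP; rewrite -subr_eq0; move: ode3 => /eqP; rewrite -subr_eq0 => /eqP <-; apply/eqP; ring.
have := congr1 (fun q => q.[b]) E3.
by rewrite hornerD hornerN !hornerM hornerXsubC subrr mul0r subr0 -polyC_natr hornerC.
Qed.
End TripleRoot.

(** The critical values of [P0/Q] at [0], [a] and [b] are [0], [t] and [h]. Subtracting [t *: Q]
    moves the value at [a] to zero, whence [g1 = t] and [g2 = t - h]. A double root of [A2] would be
    a double root of [P0 - h *: Q], thus one of the critical points; this is impossible at [0] and
    [a] because the critical values are distinct, and at [b] because [A2.[b]] is nonzero. *)
Lemma good_family_of_pencil (n : nat) (P0 Q : {poly int}) (c lam a b B w t h : int) (e : nat) A1 :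
  P0 \is monic -> size P0 = n.+1 -> (1 < size Q)%N -> (size Q <= n)%N -> c != 0 ->
  P0^`() * Q - P0 * Q^`() = lam *: (('X^e * ('X - b%:P)) ^+ 2 * ('X - a%:P)) ->
  P0.[a] = t * Q.[a] -> P0.[b] = h * Q.[b] ->
  (forall s (alpha : 'I_n -> algC),
    map_poly intr (family (P0 - t *: Q) Q c s) = \prod_i ('X - (alpha i)%:P) ->
    \prod_i (map_poly intr Q).[alpha i] = B%:~R) -> B != 0 ->
  (-1) ^+ 'C(n, 2) * lam ^+ n * ((-1) ^+ n * c * Q.[a]) * B = w ^+ 2 -> w != 0 ->
  P0 = 'X^(e.*2.+1) * A1 -> t != 0 -> h != 0 -> h != t -> b != 0 -> b != a ->
  Q.[0] != 0 -> Q.[b] != 0 -> A1.[0] != 0 ->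
  n = e.*2.+2 \/ n = e.*2.+3 /\ (exists r, Q = 'X - r%:P) ->
  exists P g1 g2 d A2 U V, good_family n P Q c lam a b B w g1 g2 d e A1 A2 U V.
Proof.
move=> mP sP Q1 Qn c0 ode Pa Pb nB B0 sq w0 E1 t0 h0 ht b0 ba Q0 Qb A10 par.
have n0 : n != 0%N by case: par => [->|[-> _]].
have lam0 : lam != 0.
  apply: contra_neq w0 => l0; apply/eqP; rewrite -sqrf_eq0 -sq l0 expr0n (negPf n0).
  by rewrite mulr0 !mul0r.
have Qa : Q.[a] != 0.
  by apply: contra_neq w0 => Q0'; apply/eqP; rewrite -sqrf_eq0 -sq Q0' !mulr0 mul0r.
have odeg z : (P0 - z *: Q)^`() * Q - (P0 - z *: Q) * Q^`() = P0^`() * Q - P0 * Q^`().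
  by rewrite derivB derivZ -!mul_polyC; ring.
have odeb : (P0 - h *: Q)^`() * Q - (P0 - h *: Q) * Q^`() =
    ('X - b%:P) ^+ 2 * (lam *: (('X^e) ^+ 2 * ('X - a%:P))).
  by rewrite odeg ode -!mul_polyC; ring.
have fb : (P0 - h *: Q).[b] = 0 by rewrite hornerD hornerN hornerZ Pb subrr.
have [A2 [E2 A2b]] := triple_root odeb fb Qb.
have A2b0 : A2.[b] != 0.
  have : 3%:R * A2.[b] * Q.[b] != 0.
    rewrite A2b hornerZ hornerM horner_exp hornerXn hornerXsubC.
    by rewrite !mulf_neq0 ?expf_neq0 ?subr_eq0.
  by apply: contra_neq => ->; rewrite mulr0 mul0r.
have A20 : A2 != 0 by apply: contra_neq A2b0 => ->; rewrite horner0.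
have sep (y : algC) : root (map_poly intr A2) y -> ~~ root (map_poly intr A2^`()) y.
  move=> r1; apply/negP => r2.
  pose F := P0 - h *: Q; rewrite -/F in odeb E2 fb.
  pose i_ := map_poly (intr : int -> algC).
  have Fy : (i_ F).[y] = 0 by rewrite E2 /i_ rmorphM hornerM (rootP r1) mulr0.
  have F'y : (i_ F^`()).[y] = 0.
    by rewrite E2 derivM /i_ rmorphD !rmorphM !hornerE (rootP r1) (rootP r2) !mulr0 addr0.
  have := congr1 (fun q => (i_ q).[y]) odeb.
  rewrite /i_ rmorphB !rmorphM /= hornerD hornerN !hornerM -/i_ Fy F'y !mul0r subr0.
  rewrite /i_ map_polyZ !rmorphM !rmorphB /= map_polyXn map_polyX !map_polyC /=.
  rewrite hornerZ !hornerM hornerXn !hornerXsubC => /esym/eqP.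
  have noint (z : int) : F.[z] != 0 -> y != z%:~R.
    by move=> Fz; apply: contra_neq Fz => Ey; apply/eqP; rewrite -(intr_eq0 algC) -horner_map /= -Ey; exact/eqP.
  rewrite !mulf_eq0 ?expf_eq0 /= intr_eq0 (negPf lam0) !subr_eq0 /=.
  have yb : y != b%:~R.
    apply: contra_neq A2b0 => Ey; apply/eqP; rewrite -(intr_eq0 algC) -horner_map /= -Ey.
    by rewrite (rootP r1).
  have ya : y != a%:~R.
    by apply: noint; rewrite hornerD hornerN hornerZ Pa -mulrBl mulf_neq0 // subr_eq0 eq_sym.
  have y0 : y != 0.
    apply: (noint 0); rewrite hornerD hornerN hornerZ E1 hornerM hornerXn expr0n mul0r sub0r.
    by rewrite oppr_eq0 mulf_neq0.
  by rewrite (negPf yb) (negPf ya) (negPf y0) ?andbF.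
have [U [V [d [Ed d0]]]] := int_separable_bezout sep A20.
have sQ z : (size (- (z *: Q)) < size P0)%N.
  by rewrite size_polyN sP ltnS; apply: leq_trans (size_scale_leq _ _) Qn.
exists (P0 - t *: Q), t, (t - h), d, A2, U, V; split => //.
- by rewrite monicE lead_coefDl // -monicE.
- by rewrite size_polyDl.
- by rewrite odeg.
- by rewrite hornerD hornerN hornerZ Pa subrr.
- by rewrite subrK.
- by rewrite scalerBl addrA subrK.
- by rewrite subr_eq0 eq_sym.
Qed.

Lemma prod_sub_root (n : nat) (p : {poly algC}) (alpha : 'I_n -> algC) r :
  p = \prod_i ('X - (alpha i)%:P) -> \prod_i (alpha i - r) = (-1) ^+ n * p.[r].
Proof.
move=> ->; rewrite horner_prod -[in X in _ ^+ X](card_ord n) -prodr_const -big_split /=.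
by apply: eq_bigr => i _; rewrite hornerXsubC mulN1r opprB.
Qed.

(* The critical points of [P0/Q] are [0], [b = -M^2] and [a = M (M + 1)], and [t] is its value
   at [a]. *)
Section Odd.
Variable e : nat.
Let m := e.*2.+1.
Let n := e.*2.+3.
Let M : int := m%:Z.
Let A1 : {poly int} := 'X^2 + (2%:R * M ^+ 2 + 2%:R * M - 1)%:P * 'X + (M ^+ 2 * (M + 1) ^+ 2)%:P.
Let P0 : {poly int} := 'X^m * A1.
Let Q : {poly int} := 'X - (M ^+ 2)%:P.
Let t : int := M ^+ m * (M + 1) ^+ m.+1 * (4%:R * M ^+ 2 + 4%:R * M - 1).
Let c : int := (-1) ^+ e.+1.
Let B : int := - (4%:R * M ^+ (2 * m + 3) * (M + 1)).
Let w : int := 2%:R * M ^+ m.+2 * (M + 1) ^+ e.+2.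

Let M1 : 1 <= M. Proof. by rewrite lez_nat. Qed.
Let M0 : M != 0. Proof. by move: M1; clear; lia. Qed.
Let M10 : M + 1 != 0. Proof. by move: M1; clear; lia. Qed.

Let sA1 : size A1 = 3.
Proof. by rewrite /A1 -addrA size_polyDl ?size_polyXn // size_MXaddC; case: ifP => // _; rewrite ltnS size_polyC; case: eqP. Qed.
Let mA1 : A1 \is monic.
Proof.
rewrite monicE /A1 -addrA lead_coefDl ?lead_coefXn // size_polyXn size_MXaddC.
by case: ifP => // _; rewrite ltnS size_polyC; case: eqP.
Qed.

(** [M + 1 = n - 1] is the leading coefficient of the Wronskian. The root of [Q] is [M^2], so the
    norm of [Q] is [- P0(M^2)], which gives [B]; and [Q(a) = M]. As [n] is odd, what has to be a
    square up to sign is [(M + 1) Q(a) B], and this is [- 4 M^(2m+4) (M + 1)^2]. The sign [c]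
    cancels that of ['C(n, 2)]. *)
Lemma good_family_odd : exists P a b g1 g2 d A2 U V,
  good_family n P Q c (M + 1) a b B w g1 g2 d e A1 A2 U V.
Proof.
have hQ x : Q.[x] = x - M ^+ 2 by rewrite hornerXsubC.
have hA x : A1.[x] = x ^+ 2 + (2%:R * M ^+ 2 + 2%:R * M - 1) * x + M ^+ 2 * (M + 1) ^+ 2.
  by rewrite /A1 !(hornerD, hornerM, hornerXn, hornerX, hornerC).
have hP x : P0.[x] = x ^+ m * A1.[x] by rewrite hornerM hornerXn.
have mP : P0 \is monic by rewrite monicMl ?monicXn.
suff : exists P g1 g2 d A2 U V,
    good_family n P Q c (M + 1) (M * (M + 1)) (- M ^+ 2) B w g1 g2 d e A1 A2 U V.
  by case=> P [g1 [g2 [d [A2 [U [V gf]]]]]]; exists P, (M * (M + 1)), (- M ^+ 2), g1, g2, d, A2, U, V.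
apply: (@good_family_of_pencil n P0 Q c _ _ _ B w t (M ^+ (2 * m)) e A1) => //.
- by rewrite size_monicM ?monicXn ?monic_neq0 // size_polyXn sA1 addnC.
- by rewrite size_XsubC.
- by rewrite size_XsubC.
- by rewrite signr_eq0.
- rewrite /P0 derivM derivXn /A1 /Q !(derivD, derivN, derivM, derivXn, derivX, derivC).
  rewrite exprMn -exprM muln2 /m ['X^(e.*2.+1)]exprS -mul_polyC -mulr_natr.
  have -> : (e.*2.+1)%:R = M%:P :> {poly int} by rewrite /M /m -polyC_natr natz.
  rewrite -mulr_natr /=.
  move: 'X^(e.*2) => Y. ring.
- rewrite hP hA hQ /t !exprMn [(M + 1) ^+ m.+1]exprS; move: (M ^+ m) ((M + 1) ^+ m) => y z; ring.
- rewrite hP hA hQ mul2n -addnn exprD /m exprNn.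
  have -> : (-1 : int) ^+ e.*2.+1 = -1 by rewrite -signr_odd /= odd_double.
  rewrite -exprM mul2n -addnn exprD; ring.
- move=> s alpha E; under eq_bigr do rewrite /Q rmorphB /= map_polyX map_polyC hornerXsubC.
  rewrite (prod_sub_root _ E) fam_horner.
  rewrite rmorphB /= map_polyZ hornerD hornerN hornerZ /=.
  have rE (p : {poly int}) : (map_poly intr p).[(M ^+ 2)%:~R] = (p.[M ^+ 2])%:~R :> algC.
    exact: horner_map.
  rewrite !rE hQ subrr mulr0 subr0 mulr0 addr0 hP hA -signr_odd /= odd_double /= expr1 mulN1r /B.
  rewrite -rmorphN; congr (_%:~R); congr (- _); rewrite exprD -exprM; ring.
- by rewrite oppr_eq0 !mulf_neq0 ?expf_neq0.
- have -> : (-1) ^+ 'C(n, 2) = c :> int.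
    have -> : 'C(n, 2) = (n * e.+1)%N.
      by rewrite bin2 (_ : (n * n.-1 = (n * e.+1).*2)%N) ?doubleK // /n; clear; lia.
    by rewrite /c -signr_odd -[RHS]signr_odd oddM /= odd_double.
  have -> : (-1) ^+ n = -1 :> int by rewrite /n -signr_odd /= odd_double.
  rewrite hQ /B /w /n.
  rewrite [LHS](_ : _ = c * c * (4%:R * (M + 1) ^+ e.*2.+3 * (M + 1) * (M ^+ (2 * m + 3) * M))); last by ring.
  have -> : c * c = 1 by rewrite -expr2 sqrr_sign.
  have -> : M ^+ (2 * m + 3) * M = M ^+ m.+2 * M ^+ m.+2 by rewrite -exprSr -exprD; congr (_ ^+ _); lia.
  rewrite -[_ * _ * (M + 1)]mulrA.
  have -> : (M + 1) ^+ e.*2.+3 * (M + 1) = (M + 1) ^+ e.+2 * (M + 1) ^+ e.+2.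
    by rewrite -exprSr -exprD; congr (_ ^+ _); lia.
  move: (M ^+ m.+2) ((M + 1) ^+ e.+2) => y z; ring.
- exact: mulf_neq0 (mulf_neq0 (isT : 2%:R != 0 :> int) (expf_neq0 _ M0)) (expf_neq0 _ M10).
- have : 0 < 4%:R * M ^+ 2 + 4%:R * M - 1 by move: M1; clear; nia.
  by move=> /gt_eqF/negbT ?; exact: mulf_neq0 (mulf_neq0 (expf_neq0 _ M0) (expf_neq0 _ M10)) _.
- by rewrite expf_neq0.
- rewrite lt_eqF // /t mul2n -addnn exprD -mulrA ltr_pM2l ?exprn_gt0 ?(lt_le_trans _ M1) //.
  have l1 : M ^+ m <= (M + 1) ^+ m.+1.
    rewrite exprS; apply: (@le_trans _ _ ((M + 1) ^+ m)); last first.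
      by rewrite ler_peMl ?exprn_ge0 //; move: M1; clear; lia.
    by rewrite lerXn2r ?nnegrE //; move: M1; clear; lia.
  have p1 : 0 < (M + 1) ^+ m.+1 by rewrite exprn_gt0 //; move: M1; clear; lia.
  have l2 : 1 < 4%:R * M ^+ 2 + 4%:R * M - 1 by move: M1; clear; nia.
  by apply: le_lt_trans l1 _; rewrite ltr_pMr.
- by rewrite hQ sub0r oppr_eq0 expf_neq0.
- by rewrite hQ; move: M1; clear; nia.
- by rewrite hA mulr0 expr0n !add0r mulf_neq0 ?expf_neq0.
- by right; split=> //; exists (M ^+ 2).
Qed.
End Odd.

(* The pencil [X^k (X + k^2)], [X^2 - (2k^2-2k-1) X + k^2 (k-1)^2] has critical points [0], [k^2]
   and [- k (k-1)], with critical value a fraction of denominator [v] at the last one; replacing [X] by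
   [X / v] and clearing denominators makes it integral. *)
Section Even.
Variable q : nat.
Let e := q.+1.
Let k := e.*2.+1.
Let n := e.*2.+2.
Let K : int := k%:Z.
Let v : int := 4%:R * K ^+ 2 - 4%:R * K - 1.
Let N : int := v ^+ q.*2.+1.
Let A1 : {poly int} := 'X + (K ^+ 2 * v)%:P.
Let P0 : {poly int} := 'X^k * A1.
Let S : int := v * (2%:R * K ^+ 2 - 2%:R * K - 1).
Let Qm : {poly int} := 'X^2 - S%:P * 'X + (v ^+ 2 * K ^+ 2 * (K - 1) ^+ 2)%:P.
Let Q : {poly int} := N *: Qm.
Let t : int := - ((K * (K - 1)) ^+ e.*2 * K).
Let h : int := K ^+ (2 * k) * v.
Let c : int := (-1) ^+ e.+1.
Let B : int := N ^+ n * (v ^+ k * (K * (K - 1)) ^+ k * v) ^+ 2 * (4%:R * K ^+ 3 * (K - 1)).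
Let lam : int := K * N - N.
Let w : int := lam ^+ e.+1 * N ^+ e.+1 * v ^+ e.+1 * (v ^+ k * (K * (K - 1)) ^+ k * v) * (2%:R * K ^+ 2 * (K - 1)).

Let K3 : 3%:R <= K. Proof. by rewrite lez_nat. Qed.
Let K0 : K != 0. Proof. by move: K3; clear; lia. Qed.
Let K10 : K - 1 != 0. Proof. by move: K3; clear; lia. Qed.
Let vgt : 0 < v. Proof. by rewrite /v; move: K3; clear; nia. Qed.
Let v0 : v != 0. Proof. by rewrite gt_eqF. Qed.
Let N0 : N != 0. Proof. exact: expf_neq0. Qed.

Let sQm : size Qm = 3.
Proof.
rewrite /Qm -addrA -mulNr -polyCN size_polyDl ?size_polyXn // size_MXaddC.
by case: ifP => // _; rewrite ltnS size_polyC; case: eqP.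
Qed.
Let sQ : size Q = 3. Proof. by rewrite size_scale. Qed.

(** The norm of [Q] is [N^n] times the product of the values of [P0] at the two roots of [Qm],
    computed from their sum and product. Since [n] is even, what has to be a square is the product
    of [Q(a) = N v^3 K (K - 1)] and the factor [4 K^3 (K - 1)] of [B]. This is why [N] is an odd
    power of [v]; with the chosen exponent, [P0/Q] is [v] times the fraction before the
    substitution, so its critical value at [a] is an integer. *)
Lemma good_family_even : exists P a b g1 g2 d A2 U V,
  good_family n P Q c lam a b B w g1 g2 d e A1 A2 U V.
Proof.
have hQm (R : comNzRingType) (x : R) : (map_poly intr Qm).[x] = x ^+ 2 - S%:~R * x + (v ^+ 2 * K ^+ 2 * (K - 1) ^+ 2)%:~R.
  rewrite /Qm rmorphD rmorphB !rmorphM /= !map_polyX !map_polyC /=.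
  by rewrite !(hornerD, hornerN, hornerM, hornerXn, hornerX, hornerC).
have hQ x : Q.[x] = N * (x ^+ 2 - S * x + v ^+ 2 * K ^+ 2 * (K - 1) ^+ 2).
  by rewrite hornerZ /Qm !(hornerD, hornerN, hornerM, hornerXn, hornerX, hornerC).
have hP (R : comNzRingType) (x : R) : (map_poly intr P0).[x] = x ^+ k * (x + (K ^+ 2 * v)%:~R).
  rewrite /P0 /A1 rmorphM rmorphD /= map_polyXn map_polyX map_polyC.
  by rewrite hornerM hornerXn hornerD hornerX hornerC.
have hPi (x : int) : P0.[x] = x ^+ k * (x + K ^+ 2 * v).
  by rewrite /P0 hornerM hornerXn /A1 hornerD hornerX hornerC.
suff : exists P g1 g2 d A2 U V,
    good_family n P Q c lam (- (K * (K - 1) * v)) (K ^+ 2 * v) B w g1 g2 d e A1 A2 U V.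
  case=> P [g1 [g2 [d [A2 [U [V gf]]]]]].
  by exists P, (- (K * (K - 1) * v)), (K ^+ 2 * v), g1, g2, d, A2, U, V.
have mA1 : A1 \is monic by rewrite /A1 -[_%:P]opprK -polyCN monicXsubC.
have sA1 : size A1 = 2 by rewrite /A1 -[_%:P]opprK -polyCN size_XsubC.
have oddN (z : int) : (- z) ^+ k = - z ^+ k by rewrite exprNn -signr_odd /= odd_double mulN1r.
have vk : v ^+ k = N * v ^+ 2 by rewrite /N -exprD /k /e doubleS addn2.
have KKk : (K * (K - 1)) ^+ k = K * (K - 1) * (K * (K - 1)) ^+ e.*2 by rewrite /k exprS.
apply: (@good_family_of_pencil n P0 Q c _ _ _ B w t h e A1).
- by rewrite monicMl ?monicXn.
- by rewrite size_monicM ?monicXn ?monic_neq0 // size_polyXn sA1 addnC.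
- by rewrite sQ.
- by rewrite sQ.
- by rewrite signr_eq0.
- rewrite /Q derivZ -!scalerAr -scalerBr.
  rewrite /P0 derivM derivXn /A1 /Qm !(derivD, derivN, derivM, derivXn, derivX, derivC).
  rewrite exprMn -exprM muln2 /k ['X^(e.*2.+1)]exprS -!mul_polyC -mulr_natr.
  have -> : (e.*2.+1)%:R = K%:P :> {poly int} by rewrite /K /k -polyC_natr natz.
  rewrite -?mulr_natr /lam /S.
  move: 'X^(e.*2) => Y. rewrite /v. ring.
- rewrite hPi hQ oddN exprMn vk KKk /t /S; move: N ((K * (K - 1)) ^+ e.*2) => z y; rewrite /v; ring.
- rewrite hPi hQ /h exprMn vk /S mul2n -addnn exprD -exprM mul2n -addnn exprD.
  move: N (K ^+ k) => z y; rewrite /v; ring.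
- move=> s alpha E.
  pose Sc : algC := S%:~R; pose Pc : algC := (v ^+ 2 * K ^+ 2 * (K - 1) ^+ 2)%:~R.
  have sQC : size (map_poly intr Qm : {poly algC}) = 3.
    by rewrite -sQm; apply: size_map_inj_poly; [exact: intr_inj | rewrite rmorph0].
  have /closed_rootP[r1 /rootP r1P] : size (map_poly intr Qm : {poly algC}) != 1%N by rewrite sQC.
  rewrite hQm -/Sc -/Pc in r1P; pose r2 := Sc - r1.
  have EP : Pc = r1 * r2.
    apply/eqP; rewrite -subr_eq0; apply/eqP; rewrite -[RHS]r1P /r2; ring.
  have ES : Sc = r1 + r2 by rewrite /r2 addrC subrK.
  have fQ (x : algC) : (map_poly intr Q).[x] = N%:~R * ((x - r1) * (x - r2)).
    by rewrite map_polyZ hornerZ /= hQm -/Sc -/Pc EP ES; congr (_ * _); ring.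
  under eq_bigr do rewrite fQ.
  rewrite big_split /= prodr_const card_ord big_split /= !(prod_sub_root _ E).
  have -> : (-1) ^+ n = 1 :> algC by rewrite -signr_odd /= odd_double.
  rewrite !mul1r.
  have fr (r : algC) : (map_poly intr Q).[r] = 0 -> (map_poly intr (family (P0 - t *: Q) Q c s)).[r] = (map_poly intr P0).[r].
    move=> Qr; rewrite fam_horner rmorphB /= map_polyZ hornerD hornerN hornerZ Qr !mulr0.
    by rewrite subr0 addr0.
  rewrite !fr ?fQ ?subrr ?mul0r ?mulr0 // !hP [r1 ^+ k * _ * _]mulrACA -exprMn -EP.
  have -> : (r1 + (K ^+ 2 * v)%:~R) * (r2 + (K ^+ 2 * v)%:~R) =
      (v ^+ 2 * (4%:R * K ^+ 3 * (K - 1)))%:~R :> algC.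
    transitivity (Pc + (K ^+ 2 * v)%:~R * Sc + (K ^+ 2 * v)%:~R ^+ 2).
      by rewrite EP ES; ring.
    rewrite /Pc /Sc /S; move: K v => x y; ring.
  rewrite /Pc -[N%:~R ^+ n]rmorphXn -[_%:~R ^+ k]rmorphXn /= -!intrM; congr (_%:~R); rewrite /B.
  have -> : (v ^+ 2 * K ^+ 2 * (K - 1) ^+ 2) ^+ k = (v ^+ k * (K * (K - 1)) ^+ k) ^+ 2.
    transitivity ((v * (K * (K - 1))) ^+ k ^+ 2); last by congr (_ ^+ 2); rewrite exprMn.
    by rewrite exprAC; congr (_ ^+ _); ring.
  by move: (N ^+ n) (v ^+ k * (K * (K - 1)) ^+ k) v K => x y z u; ring.
- apply: mulf_neq0; last exact: mulf_neq0 (mulf_neq0 (isT : 4%:R != 0 :> int) (expf_neq0 _ K0)) K10.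
  apply: mulf_neq0 (expf_neq0 _ N0) (expf_neq0 _ (mulf_neq0 (mulf_neq0 (expf_neq0 _ v0) (expf_neq0 _ _)) v0)).
  exact: mulf_neq0.
- have -> : (-1) ^+ 'C(n, 2) = c :> int.
    have -> : 'C(n, 2) = (n.-1 * e.+1)%N.
      by rewrite bin2 (_ : (n * n.-1 = (n.-1 * e.+1).*2)%N) ?doubleK // /n; clear; lia.
    by rewrite /c -signr_odd -[RHS]signr_odd oddM /= odd_double.
  have -> : (-1) ^+ n = 1 :> int by rewrite /n -signr_odd /= odd_double.
  have cc : c * c = 1 by rewrite -expr2 sqrr_sign.
  rewrite hQ /B /w.
  have sq (z : int) : z ^+ n = z ^+ e.+1 * z ^+ e.+1.
    by rewrite -exprD addnn.
  have vN : v ^+ e.+1 * v ^+ e.+1 = N * v ^+ 3 by rewrite -exprD addnn -exprD /e doubleS addn3.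
  rewrite !sq.
  transitivity (c * c * (lam ^+ e.+1 * N ^+ e.+1 * (v ^+ k * (K * (K - 1)) ^+ k * v) * (2%:R * K ^+ 2 * (K - 1))) ^+ 2 * (N * v ^+ 3)).
    move: (lam ^+ e.+1) (N ^+ e.+1) (v ^+ k * (K * (K - 1)) ^+ k) c N => x y z s0 u; rewrite /S /v; ring.
  rewrite cc -vN; move: (lam ^+ e.+1) (N ^+ e.+1) (v ^+ k * (K * (K - 1)) ^+ k) (v ^+ e.+1) => x y z s0; ring.
- apply: mulf_neq0; last exact: mulf_neq0 (mulf_neq0 (isT : 2%:R != 0 :> int) (expf_neq0 _ K0)) K10.
  have lam0 : lam != 0 by rewrite /lam -[X in _ - X]mul1r -mulrBl mulf_neq0.
  apply: mulf_neq0; last first.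
    apply: mulf_neq0 (mulf_neq0 (expf_neq0 _ v0) (expf_neq0 _ _)) v0; exact: mulf_neq0.
  exact: mulf_neq0 (mulf_neq0 (expf_neq0 _ lam0) (expf_neq0 _ N0)) (expf_neq0 _ v0).
- by [].
- by rewrite oppr_eq0; apply: mulf_neq0 (expf_neq0 _ (mulf_neq0 K0 K10)) K0.
- exact: mulf_neq0 (expf_neq0 _ K0) v0.
- rewrite gt_eqF // (@lt_trans _ _ 0) //.
    rewrite oppr_lt0 mulr_gt0 ?exprn_gt0 ?mulr_gt0 //; move: K3; clear; lia.
  by rewrite mulr_gt0 ?exprn_gt0 //; move: K3; clear; lia.
- exact: mulf_neq0 (expf_neq0 _ K0) v0.
- rewrite -subr_eq0 opprK -mulrDl mulf_neq0 //; move: K3; clear; nia.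
- rewrite hQ expr0n mulr0 subr0 add0r mulf_neq0 //.
  exact: mulf_neq0 (mulf_neq0 (expf_neq0 _ v0) (expf_neq0 _ K0)) (expf_neq0 _ K10).
- rewrite hQ mulf_neq0 // (_ : _ + _ = 2%:R * K ^+ 2 * v ^+ 2); last by rewrite /S; ring.
  exact: mulf_neq0 (mulf_neq0 (isT : 2%:R != 0 :> int) (expf_neq0 _ K0)) (expf_neq0 _ v0).
- rewrite /A1 hornerD hornerX hornerC add0r; exact: mulf_neq0 (expf_neq0 _ K0) v0.
- by left.
Qed.
End Even.

(** * Absorbing the logarithms *)

Section LogSaving.
Variable R : realType.
Implicit Types x y X del : R.

Lemma powR_ge1 del x : 0 <= del -> 1 <= x -> 1 <= x `^ del.
Proof.
move=> d0 x1; have := @ge0_ler_powR R _ d0 1 x; rewrite powR1; apply=> //.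
  by rewrite nnegrE.
by rewrite nnegrE (le_trans _ x1).
Qed.

Lemma one_plus_ln_le del x : 0 < del -> 1 <= x -> 1 + ln x <= (1 + del^-1) * x `^ del.
Proof.
move=> d0 x1; have x0 : 0 < x by apply: lt_le_trans x1.
have h1 : 1 <= x `^ del := powR_ge1 (ltW d0) x1.
rewrite mulrDl mul1r lerD // -(ler_pM2l d0) mulVKf ?gt_eqF //.
rewrite /powR gt_eqF //; apply: le_trans (expR_ge1Dx _); by rewrite lerDr.
Qed.

(** Each of the [n] logarithmic factors is given the exponent [del / n]. Writing [C.+1] under the
    logarithm covers [C = 0]. *)
Lemma trunc_log_pow_le (n k C : nat) del : (0 < n)%N -> 0 < del ->
  exists2 A : R, 0 < A & forall J, (0 < J)%N ->
    ((trunc_log 2 (C * J ^ k)).+1 ^ n)%:R <= A * J%:R `^ del.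
Proof.
move=> n0 d0; pose d := del / n%:R.
have dp : 0 < d by rewrite divr_gt0 ?ltr0n.
have l2 : 0 < ln 2 :> R by rewrite ln_gt0 // ltr1n.
pose A0 : R := 1 + (ln C.+1%:R + k%:R) / ln 2.
have lC : 0 <= ln C.+1%:R :> R by rewrite ln_ge0 // ler1n.
have A00 : 0 < A0 by rewrite ltr_wpDr // divr_ge0 ?(ltW l2) // addr_ge0.
exists ((A0 * (1 + d^-1)) ^+ n) => [|J J0].
  by rewrite exprn_gt0 // mulr_gt0 // addr_gt0 // invr_gt0.
have J1 : 1 <= J%:R :> R by rewrite ler1n.
have Jp : 0 < J%:R :> R by rewrite ltr0n.
have lJ : 0 <= ln J%:R :> R by rewrite ln_ge0.
have -> : J%:R `^ del = (J%:R `^ d) ^+ n.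
  by rewrite -powR_mulrn ?powR_ge0 // -powRrM /d divfK // pnatr_eq0 -lt0n.
rewrite -exprMn natrX lerXn2r ?nnegrE ?ler0n //.
  by rewrite mulr_ge0 ?powR_ge0 // mulr_ge0 ?(ltW A00) // addr_ge0 // invr_ge0 ltW.
rewrite -mulrA; apply: (@le_trans _ _ (A0 * (1 + ln J%:R))); last first.
  by rewrite ler_wpM2l ?(ltW A00) // one_plus_ln_le.
set t := trunc_log _ _.
have tl : t%:R * ln 2 <= ln C.+1%:R + k%:R * ln J%:R :> R.
  have -> : ln C.+1%:R + k%:R * ln J%:R = ln (C.+1 * J ^ k)%:R :> R.
    by rewrite natrM natrX lnM ?posrE ?exprn_gt0 ?ltr0n // lnXn // mulr_natl.
  rewrite mulr_natl -lnXn // ler_ln ?posrE ?exprn_gt0 ?ltr0n ?muln_gt0 ?expn_gt0 ?J0 //.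
  rewrite -natrX ler_nat; have [E|C0] := posnP (C * J ^ k).
    by rewrite /t E trunc_log0 muln_gt0 expn_gt0 J0.
  by apply: leq_trans (trunc_logP _ C0) _; rewrite // leq_mul2r leqnSn orbT.
rewrite -addn1 natrD addrC mulrDl mul1r -addrA lerD2l.
apply: (@le_trans _ _ ((ln C.+1%:R + k%:R) / ln 2 * (1 + ln J%:R))); last by rewrite lerDr.
rewrite mulrAC ler_pdivlMr //; apply: le_trans tl _.
by have := mulr_ge0 lC lJ; have := ler0n R k; nra.
Qed.

(** [J] is the integer part of [(X / C1.+1)^(1/D)], about the largest index allowed by the
    discriminant bound. The fibres cost a factor of order [J^del], so at least a constant times
    [J^(1 - del)] fields remain. *)
Lemma count_from_index (n k D C1 C2 C3 : nat) del : (0 < n)%N -> (0 < D)%N ->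
  0 < del -> del <= 1 -> exists2 c : R, 0 < c & forall X, C1.+1%:R <= X -> exists2 J : nat,
    (0 < J)%N /\ (C1 * J ^ D)%:R <= X & forall N : nat,
    (J <= N * ((trunc_log 2 (C2 * J ^ k)).+1 ^ n * C3))%N -> c * X `^ ((1 - del) / D%:R) <= N%:R.
Proof.
move=> n0 D0 d0 d1; have [A A0 AP] := trunc_log_pow_le k C2 n0 d0.
have C1p : 0 < C1.+1%:R :> R by rewrite ltr0n.
have Dp : D%:R != 0 :> R by rewrite pnatr_eq0 -lt0n.
pose be := (1 - del) / D%:R.
(* The factors come from the size of the fibres, from [J >= y / 2] after rounding, and from the
   constant of the discriminant bound; the successors keep them positive. *)
exists ((A * C3.+1%:R)^-1 * 2^-1 `^ (1 - del) * C1.+1%:R^-1 `^ be).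
  rewrite !mulr_gt0 ?powR_gt0 ?invr_gt0 ?mulr_gt0 ?ltr0n //.
move=> X X1; have X0 : 0 < X by apply: lt_le_trans X1.
pose z := X / C1.+1%:R; have z1 : 1 <= z by rewrite ler_pdivlMr ?mul1r.
have z0 : 0 <= z by apply: le_trans z1.
pose y := z `^ (D%:R)^-1.
have y1 : 1 <= y by rewrite powR_ge1 ?invr_ge0.
have y0 : 0 <= y by apply: le_trans y1.
have yD : y ^+ D = z by rewrite -powR_mulrn // -powRrM mulVf // powRr1.
have /andP[Jy yJ] := truncn_itv y0; set J := Num.truncn y in Jy yJ.
have J0 : (0 < J)%N by rewrite truncn_gt0.
have Jp : 0 < J%:R :> R by rewrite ltr0n.
exists J; first split=> //.
  rewrite natrM natrX; apply: (@le_trans _ _ (C1.+1%:R * y ^+ D)).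
    by rewrite ler_pM ?ler0n ?exprn_ge0 ?ler_nat ?lerXn2r ?nnegrE ?ler0n.
  by rewrite yD mulrC divfK ?gt_eqF.
move=> N JN.
have JN' : J%:R <= N%:R * (A * J%:R `^ del * C3.+1%:R).
  apply: (@le_trans _ _ (N * ((trunc_log 2 (C2 * J ^ k)).+1 ^ n * C3))%N%:R); first by rewrite ler_nat.
  by rewrite !natrM ler_wpM2l ?ler0n // ler_pM ?ler0n ?AP ?ler_nat.
have JE : J%:R `^ (1 - del) <= N%:R * (A * C3.+1%:R).
  rewrite powRB; last by rewrite implybE pnatr_eq0 -lt0n J0 orbT.
  rewrite powRr1 ?(ltW Jp) // ler_pdivrMr ?powR_gt0 //.
  by apply: le_trans JN' _; rewrite -!mulrA [C3.+1%:R * _]mulrC.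
have AC0 : 0 < A * C3.+1%:R by rewrite mulr_gt0 ?ltr0n.
rewrite -!mulrA ler_pdivrMl // [_ * N%:R]mulrC; apply: le_trans JE; rewrite -/be.
have -> : C1.+1%:R^-1 `^ be * X `^ be = y `^ (1 - del).
  rewrite -powRM ?invr_ge0 ?(ltW X0) // mulrC -/z /y -powRrM; congr (_ `^ _).
  by rewrite mulrC.
rewrite -powRM ?invr_ge0 ?ler0n // ge0_ler_powR ?nnegrE ?subr_ge0 //.
- by rewrite mulr_ge0 ?invr_ge0.
rewrite ler_pdivrMl //; apply: le_trans (ltW yJ) _.
by rewrite -natrM ler_nat mul2n -addnn -addn1 leq_add2l.
Qed.
End LogSaving.

(* Good pencils in every degree and the lower bound *)
From mathcomp Require Import all_classical all_reals all_analysis.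
Local Open Scope classical_set_scope.

Lemma exists_good_family (n : nat) : (3 <= n)%N ->
  exists P Q c lam a b B w g1 g2 d e A1 A2 U V, good_family n P Q c lam a b B w g1 g2 d e A1 A2 U V.
Proof.
move=> n3; have En := odd_double_half n; have [odd_n|even_n] := boolP (odd n).
  have -> : n = ((n./2).-1).*2.+3 by move: n3 En; rewrite odd_n; clear; lia.
  case: (good_family_odd (n./2).-1) => P [a [b [g1 [g2 [d [A2 [U [V gf]]]]]]]].
  by do 16 eexists; exact: gf.
have -> : n = ((n./2).-2).+1.*2.+2 by move: n3 En; rewrite (negPf even_n); clear; lia.
case: (good_family_even (n./2).-2) => P [a [b [g1 [g2 [d [A2 [U [V gf]]]]]]]].
by do 16 eexists; exact: gf.
Qed.

(** The estimate is obtained with the exponent [beta R n] itself and with constants independent of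
    [eps]; since [X >= 1], subtracting [eps] only weakens it. A threshold [X0] is unavoidable: by
    Minkowski's theorem no field of degree at least 2 has discriminant [1] or [-1], so the set is
    empty for [X = 1]. *)
Theorem theorem2p4 (R : realType) (n : nat) (hn : (3 <= n)%N) :
  exists X0 : R, 1 <= X0 /\
    forall eps : R, 0 < eps ->
    exists c : R, 0 < c /\
      forall X : R, X0 <= X ->
        ((c * X `^ (beta R n - eps))%:E
           <= counting (Zfields 'Alt_('I_n)%G X) :> \bar R)%E.
Proof.
case: (exists_good_family hn) => P [Q [c [lam [a [b [B [w [g1 [g2 [d [e [A1 [A2 [U [V gf]]]]]]]]]]]]]]].
have [C1 [C2 [C3 [k lower]]]] := Zfields_lower gf hn R.
have n0 : (0 < n)%N by apply: leq_trans hn.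
have D0 : (0 < 4 * n - 4)%N by move: hn; clear; lia.
have f2 : 2 <= n`!%:R :> R.
  by rewrite ler_nat; apply: (leq_trans _ (fact_geq n)); apply: ltnW.
have f0 : 0 < n`!%:R :> R by apply: lt_le_trans f2.
have del0 : 0 < 2 / n`!%:R :> R by rewrite divr_gt0.
have del1 : 2 / n`!%:R <= 1 :> R by rewrite ler_pdivrMr ?mul1r.
have [C C0 index] := count_from_index k C1 C2 C3 n0 D0 del0 del1.
exists C1.+1%:R; split=> [|eps eps0]; first by rewrite ler1n.
exists C; split=> // X X1; have [J [J0 CJ] bound] := index X X1.
have [F [uF ZF JF]] := lower X J J0 CJ.
apply: le_trans (counting_ge R uF ZF); rewrite lee_fin.
apply: le_trans (bound _ JF); rewrite ler_pM2l //.
have -> : (1 - 2 / n`!%:R) / (4 * n - 4)%N%:R = beta R n.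
  by rewrite /beta natrB ?natrM // leq_pmulr.
rewrite ler_powR //; first by apply: le_trans X1; rewrite ler1n.
by rewrite gerBl ltW.
Qed.
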